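(* Let $\mathcal{G}$ be a connected finite compact metric graph with vertex set $\mathsf V$, edge set $\mathsf E$ and total length $\mathcal L$, and let $q=(q_{\mathsf e})_{\mathsf e\in\mathsf E}$ be a real-valued potential with $q_{\mathsf e}\in (C^\infty\cap L^\infty)(0,\ell_{\mathsf e})$ for every $\mathsf e\in\mathsf E$. Let $\mathsf v\in\mathsf V$ be a vertex and let $\beta\in\mathbb R^{|\mathsf V|}$ be such that $\beta_{\mathsf v}\neq0$. Let $(f_n^{\beta,q})_{n\in\mathbb N}$ be an orthonormal basis of $L^2(\mathcal G)$ consisting of eigenfunctions of the Schrödinger operator $H^q_\beta$ with $\delta'$-coupling conditions, ordered according to non-decreasing eigenvalues $\lambda_1^q(\beta)\le\lambda_2^q(\beta)\le\dots$ (counted with multiplicity). Then $$\lim_{N\to\infty}\frac1N\sum_{n=1}^N\Big|\sum_{\mathsf e\sim\mathsf v}(f_n^{\beta,q})_{\mathsf e}(\mathsf v)\Big|^2=\frac{2\deg(\mathsf v)}{\mathcal L}.$$ Furthermore, for every edge $\mathsf e\in\mathsf E$ and every interior point $x\in(0,\ell_{\mathsf e})$ one has $$\lim_{N\to\infty}\frac1N\sum_{n=1}^N\big|f_n^{\beta,q}(x)\big|^2=\frac1{\mathcal L}.$$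
   Context: Metric graph: $\mathcal G$ has finite edge set $\mathsf E$ and finite vertex set $\mathsf V$; each edge $\mathsf e$ is identified with an interval $(0,\ell_{\mathsf e})$, $0<\ell_{\mathsf e}<\infty$, whose two endpoints are attached to vertices. $\mathcal L=\sum_{\mathsf e\in\mathsf E}\ell_{\mathsf e}$, $L^2(\mathcal G)=\bigoplus_{\mathsf e}L^2(0,\ell_{\mathsf e})$, $\widetilde H^m(\mathcal G)=\bigoplus_{\mathsf e}H^m(0,\ell_{\mathsf e})$. Write $\mathsf e\sim\mathsf v$ if $\mathsf e$ is incident to $\mathsf v$; $\deg(\mathsf v)$ is the number of edges incident to $\mathsf v$ (sums over $\mathsf e\sim\mathsf v$ and the degree count edge ends, so a loop counts twice). For $f=(f_{\mathsf e})_{\mathsf e}$, $f_{\mathsf e}(\mathsf v)$ is the boundary value of $f_{\mathsf e}$ at the endpoint of $\mathsf e$ attached to $\mathsf v$, and $f'_{\mathsf e}(\mathsf v)$ is the derivative at that endpoint taken in the direction from $\mathsf v$ into the edge. For $x\in(0,\ell_{\mathsf e})$, $f(x)$ means $f_{\mathsf e}(x)$. Operator: for $\beta=(\beta_{\mathsf v})_{\mathsf v}\in\mathbb R^{|\mathsf V|}$, $H^q_\beta$ acts on $L^2(\mathcal G)$ by $(H^q_\beta f)_{\mathsf e}=-f''_{\mathsf e}+q_{\mathsf e}f_{\mathsf e}$ on the domain $\mathcal D_\beta$ of all $f\in\widetilde H^2(\mathcal G)$ such that at every vertex $\mathsf v$ the values $f'_{\mathsf e}(\mathsf v)$, $\mathsf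 e\sim\mathsf v$, coincide (common value $f'(\mathsf v)$) and $\sum_{\mathsf e\sim\mathsf v}f_{\mathsf e}(\mathsf v)=\beta_{\mathsf v}f'(\mathsf v)$. It is self-adjoint, bounded from below, with purely discrete spectrum accumulating only at $+\infty$. *)

(* Defs.v *)
From HB Require Import structures.
From mathcomp Require Import all_boot all_order all_algebra.
From mathcomp Require Import all_classical all_reals all_analysis.
From mathcomp Require Import complex.

Set Implicit Arguments.
Unset Strict Implicit.
Unset Printing Implicit Defensive.

Import Order.TTheory GRing.Theory Num.Theory.
Import numFieldNormedType.Exports.

Local Open Scope classical_set_scope.
Local Open Scope ring_scope.
Local Open Scope complex_scope.

(* R[i] carries no topology or measurable structure over R in the libraries,  *)
(* so continuity, measurability and integration of complex-valued functions   *)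
(* are taken on real and imaginary parts.                                     *)

(* Loops and parallel edges are allowed. An edge e is the interval            *)
(* (0, elen e); endpt e false is the vertex attached to the endpoint 0 and    *)
(* endpt e true the vertex attached to the endpoint elen e.                   *)
Record metric_graph (R : realType) := MetricGraph {
  vertex : finType;
  edge : finType;
  elen : edge -> R;
  elen_gt0 : forall e, 0 < elen e;
  endpt : edge -> bool -> vertex
}.

Section Graph.
Variables (R : realType) (G : metric_graph R).

Definition total_length : R := \sum_(e : edge G) elen e.

Definition edge_rel : rel (vertex G) := fun u w =>
  [exists e : edge G, exists b : bool, (endpt e b == u) && (endpt e (~~ b) == w)].

Definition graph_connected : Prop := forall u w : vertex G, connect edge_rel u w.

(* An edge end is a pair (e, b); a loop at v contributes two ends to v.       *)
Definition ends_at (v : vertex G) : {set edge G * bool} :=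
  [set p | endpt p.1 p.2 == v].

Definition deg (v : vertex G) : nat := #|ends_at v|.

End Graph.

Section Interval.
Variable R : realType.
Implicit Types (l : R) (f g : R -> R[i]) (phi q : R -> R).

Local Notation mu := (@lebesgue_measure R).

Definition cintegral l f : R[i] :=
  (\int[mu]_(x in `]0, l[) complex.Re (f x)) +i* (\int[mu]_(x in `]0, l[) complex.Im (f x)).

Definition L2 l f : Prop :=
  ((fun x => complex.Re (f x)) \_ `]0, l[ \in Lfun mu 2%:E) /\
  ((fun x => complex.Im (f x)) \_ `]0, l[ \in Lfun mu 2%:E).

Definition continuous_cc l f : Prop :=
  {within `[0, l], continuous (fun x => complex.Re (f x))} /\
  {within `[0, l], continuous (fun x => complex.Im (f x))}.

Definition smooth_on (D : set R) phi : Prop :=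
  forall (k : nat) (x : R), D x -> derivable (derive1n k phi) x 1.

Definition test_function l phi : Prop :=
  smooth_on setT phi /\
  exists a b : R, [/\ 0 < a, b < l & forall x, x \notin `[a, b] -> phi x = 0].

Definition weak_derivative l f g : Prop :=
  forall phi, test_function l phi ->
    cintegral l (fun x => f x * (derive1 phi x)%:C) =
    - cintegral l (fun x => g x * (phi x)%:C).

(* f belongs to H^2(0, l), with first and second weak derivatives f1 and f2;  *)
(* f and f1 are the representatives of their a.e.-classes that are continuous *)
(* up to the boundary. They exist by Sobolev embedding and are unique on      *)
(* [0, l]; point values and boundary values are values of f and f1.           *)
Definition sobolev2 l f f1 f2 : Prop :=
  [/\ [/\ L2 l f, L2 l f1 & L2 l f2],
      weak_derivative l f f1,
      weak_derivative l f1 f2,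
      continuous_cc l f &
      continuous_cc l f1].

(* C^oo and L^oo on (0, l); the values of q outside (0, l) are irrelevant.    *)
Definition smooth_bounded l q : Prop :=
  smooth_on `]0, l[ q /\ q \_ `]0, l[ \in Lfun mu +oo%E.

End Interval.

Section Schroedinger.
Variables (R : realType) (G : metric_graph R).

Local Notation mu := (@lebesgue_measure R).

(* Only the values of f e on [0, elen e] are meaningful.                      *)
Definition gfun : Type := edge G -> R -> R[i].

Implicit Types (f g h : gfun) (q : edge G -> R -> R) (beta : vertex G -> R).

Definition L2graph f : Prop := forall e, L2 (elen e) (f e).

Definition inner f g : R[i] :=
  \sum_(e : edge G) cintegral (elen e) (fun x => f e x * conjc (g e x)).

Definition normsq f : R := complex.Re (inner f f).

Definition end_value f (p : edge G * bool) : R[i] :=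
  f p.1 (if p.2 then elen p.1 else 0).

(* Derivative into the edge, where f1 is the derivative of the function       *)
(* in the coordinate of the edge.                                             *)
Definition end_slope (f1 : gfun) (p : edge G * bool) : R[i] :=
  if p.2 then - end_value f1 p else end_value f1 p.

Definition vertex_sum f (v : vertex G) : R[i] :=
  \sum_(p in ends_at v) end_value f p.

(* Here d is the common value f'(v).                                          *)
Definition delta_prime_conditions beta f (f1 : gfun) : Prop :=
  forall v : vertex G, exists d : R[i],
    (forall p, p \in ends_at v -> end_slope f1 p = d) /\
    vertex_sum f v = (beta v)%:C * d.

(* The graph of the operator: f is in the domain and h is its image.          *)
Definition schroedinger q beta f h : Prop :=
  exists f1 f2 : gfun,
    [/\ forall e, sobolev2 (elen e) (f e) (f1 e) (f2 e),
        delta_prime_conditions beta f f1 &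
        forall e, {ae mu, forall x, `]0, elen e[%classic x ->
          h e x = - f2 e x + (q e x)%:C * f e x}].

Definition eigenfunction q beta (lambda : R) f : Prop :=
  normsq f != 0 /\
  schroedinger q beta f (fun e x => lambda%:C * f e x).

Definition orthonormal_basis (f : nat -> gfun) : Prop :=
  [/\ forall n, L2graph (f n),
      forall n m, inner (f n) (f m) = (n == m)%:R &
      forall g, L2graph g ->
        normsq (fun e x => g e x - \sum_(n < N) inner g (f n) * f n e x)
          @[N --> \oo] --> (0 : R)].

End Schroedinger.

(* Main.v *)
Require Import Defs.
From HB Require Import structures.
From mathcomp Require Import all_boot all_order all_algebra.
From mathcomp Require Import all_classical all_reals all_analysis.
From mathcomp Require Import measurable_realfun ess_sup_inf.
From mathcomp Require Import complex.
From mathcomp Require Import ring lra.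
Import Order.TTheory GRing.Theory Num.Theory.
Import numFieldNormedType.Exports.
Import ComplexField.
Local Open Scope classical_set_scope.
Local Open Scope ring_scope.

(** The averages are read off from the squared resolvent.  For s = k^2 put
    W_k(x) = sum_n |f_n(x)|^2 / (lambda_n + s)^2, the squared norm of the Green
    function of H + s with pole x.  If psi is a test function such that
    - psi'' + (q + s) psi equals a point mass at x up to a residual r, then
    integration by parts against an eigenfunction gives
    f_n(x) = (lambda_n + s) <f_n, psi> - <f_n, r>, and Parseval's identity
    compares W_k(x) with ||psi||^2 up to an error of order ||r||^2 / s^2.  So an
    explicit psi with a small residual replaces the Green function
    ([l2_upper], [l2_lower]).

    The building block is the half kernel exp (- k t) * cutoff t, where t is the
    distance to the pole and the support lies on one side of the pole
    ([hker]).  Paired with f_n it produces k f_n(x) plus the slope of f_n at x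
    in the direction of the support ([hker_identity]).  It is used in three
    ways.
    - Two half kernels back to back: the slopes cancel, and k^3 W_k(x) tends to
      1/4, uniformly in x away from the vertices ([interior_law]).
    - One half kernel on each edge end at v: the slopes add up to
      deg(v) f_n'(v) = (deg(v) / beta_v) * (sum of the end values), which is of
      lower order than the contribution k * (sum of the end values) of the
      values.  The corresponding limit is deg(v) / 2 ([vertex_law]).
    - The difference of the half kernels with parameters 2k and k, on the same
      side: the slope disappears, and k^3 W_k(x) is bounded up to the vertices,
      whatever the vertex conditions are ([uniform_bound]).  Hence the interior
      law can be integrated over the graph, and
      k^3 * sum_n 1 / (lambda_n + s)^2 tends to L / 4 ([trace_law]).

    A Tauberian theorem ([karamata]) turns these limits into averages: if
    k^3 * sum_n a_n / (lambda_n + k^2)^2 tends to A, and to B > 0 for the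
    constant sequence 1, then the mean of a_0, ..., a_(N-1) tends to A / B.  The
    quotients are (1/4) / (L/4) and (deg(v)/2) / (L/4).

    Integration by parts needs classical derivatives.  The weak derivatives of
    an eigenfunction are continuous or bounded, so the lemma of du Bois-Reymond
    ([du_bois_reymond]) makes it a classical solution of
    u'' = (q - lambda) u inside each edge, with u and u' continuous up to the
    ends.  Subtracting lambda_0 from q makes all eigenvalues nonnegative. *)

Set Implicit Arguments.
Unset Strict Implicit.
Unset Printing Implicit Defensive.

(** * Smooth cut-offs *)

Section SmoothFunctions.
Variable R : realType.
Implicit Types (f g : R -> R) (x : R) (j : nat).

(** Differentiating exp (- 1/x) brings down powers of 1/x; keeping them as a
    parameter makes the family closed under differentiation up to linear
    combinations ([is_derive_flat]). *)
Definition flat j x : R := if 0 < x then x^-1 ^+ j * expR (- x^-1) else 0.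

Lemma flat_le0 j x : x <= 0 -> flat j x = 0.
Proof. by rewrite /flat ltNge => ->. Qed.

Lemma flat_gt0 x : 0 < x -> 0 < flat 0 x.
Proof. by rewrite /flat => ->; rewrite expr0 mul1r expR_gt0. Qed.

Lemma flat_ge0 j x : 0 <= flat j x.
Proof.
rewrite /flat; case: ifPn => // x0.
by rewrite mulr_ge0 ?expR_ge0// exprn_ge0// invr_ge0 ltW.
Qed.

Lemma flat_mulr j x : flat j x = flat j.+1 x * x.
Proof.
rewrite /flat; case: ifPn => [x0|]; last by rewrite mul0r.
by rewrite exprS mulrC (mulrC _ x) !mulrA divff ?gt_eqF// mul1r mulrC.
Qed.

(** The exponential series beats every power of 1/x.  One power to spare is what
    the difference quotient of [flat] at the origin needs. *)
Lemma flat_le_norm j x : flat j x <= j.+1`!%:R * `|x|.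
Proof.
rewrite /flat; case: ifPn => [x0|_]; last by rewrite mulr_ge0.
have y0 : 0 < x^-1 by rewrite invr_gt0.
rewrite gtr0_norm// expRN ler_pdivrMr ?expR_gt0//.
rewrite -[X in _ * X * _]invrK [leRHS]mulrAC ler_pdivlMr// -exprSr.
have := @expR_ge1Dxn R x^-1 j (ltW y0).
have f0 : 0 < j.+1`!%:R :> R by rewrite ltr0n fact_gt0.
rewrite -(ler_pM2l f0) mulrDr mulr1 => /(le_trans _); apply.
by rewrite mulrCA divff ?gt_eqF// mulr1 lerDr ltW.
Qed.

Lemma is_derive_flat j x : is_derive x 1 (flat j) (flat j.+2 x - j%:R * flat j.+1 x).
Proof.
have [x0|x0|<-] := ltgtP 0 x.
- have xn0 : x != 0 by rewrite gt_eqF.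
  suff : is_derive x 1 (fun y : R => y^-1 ^+ j * expR (- y^-1))
      (flat j.+2 x - j%:R * flat j.+1 x).
    apply: near_eq_is_derive.
    by near=> y; rewrite /flat ifT//; near: y; exact: lt_nbhsr.
  have dV : is_derive x 1 (fun y : R => y^-1) (- x ^- 2).
    have := @is_deriveV R id x 1 1 xn0 (is_derive_id _ _).
    by rewrite /= /GRing.scale /= mulr1.
  have dE : is_derive x 1 (fun y : R => expR (- y^-1)) (expR (- x^-1) * x ^- 2).
    apply: (is_derive1_comp (g := fun y => - y^-1)).
    by rewrite -[X in is_derive _ _ _ X]opprK; exact: is_deriveN.
  have := is_deriveM (is_deriveX j dV) dE.
  rewrite (_ : _ * _ = fun y : R => y^-1 ^+ j * expR (- y^-1)); last first.
    by apply/funext => y; rewrite mulrfctE exprfctE.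
  move=> H; apply: is_derive_eq H _.
  rewrite /flat x0 /GRing.scale /= fctE.
  case: j {dE dV} => [|j] /=; first by rewrite !expr0; field; rewrite xn0.
  by rewrite !exprS; field; rewrite xn0.
- apply: (near_eq_is_derive (f := cst 0)).
    near=> y; rewrite /cst flat_le0// ltW//; near: y; exact: lt_nbhsl.
  rewrite !flat_le0 ?(ltW x0)// mulr0 subrr; exact: is_derive_cst.
(* At the origin the slope function is flat j x / x = flat j.+1 x. *)
- apply/is_derive1_caratheodory; exists (flat j.+1); split.
  + by move=> z; rewrite (@flat_le0 _ 0)// !subr0 -flat_mulr.
  + rewrite /prop_for /continuous_at /= (@flat_le0 _ 0)//.
    apply: (@squeeze_cvgr _ _ _ _ (cst 0) (fun y => j.+2`!%:R * `|y|)).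
    * near=> y; rewrite flat_ge0 /=; exact: flat_le_norm.
    * exact: cvg_cst.
    * have H : j.+2`!%:R * `|y| @[y --> (0 : R)] --> j.+2`!%:R * `|0 : R|.
        by apply: cvgMl_tmp; apply: cvg_norm; exact: cvg_id.
      by rewrite normr0 mulr0 in H.
  + by rewrite !flat_le0// mulr0 subrr.
Unshelve. all: by end_near. Qed.

(** A syntactic class that contains its own derivatives.  Membership therefore
    gives smoothness of all orders by a one-line induction
    ([elementary_smooth]), with no formula for the higher derivatives. *)
Inductive elementary : (R -> R) -> Prop :=
| elementary_flat j : elementary (flat j)
| elementary_cst (c : R) : elementary (cst c)
| elementary_add f g : elementary f -> elementary g -> elementary (fun x => f x + g x)
| elementary_mul f g : elementary f -> elementary g -> elementary (fun x => f x * g x)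
| elementary_inv f : (forall x, f x != 0) -> elementary f ->
    elementary (fun x => (f x)^-1)
| elementary_aff f (a b : R) : elementary f -> elementary (fun x => f (a * x + b)).

Lemma is_derive_affine (a b x : R) : is_derive x 1 (fun y : R => a * y + b) a.
Proof.
have H : is_derive x 1 (fun y : R => a *: y + b) (a *: 1 + 0).
  exact: is_deriveD.
by rewrite addr0 /GRing.scale/= mulr1 in H.
Qed.

Lemma elementary_derive f : elementary f ->
  exists2 g, elementary g & forall x, is_derive x 1 f (g x).
Proof.
elim=> {f}.
- move=> j; exists (fun x => flat j.+2 x + cst (- j%:R) x * flat j.+1 x).
    by apply: elementary_add; [|apply: elementary_mul]; constructor.
  move=> x; rewrite /= mulNr; exact: is_derive_flat.
- by move=> c; exists (cst 0) => [|x]; [constructor | exact: is_derive_cst].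
- move=> f g _ [f' ef df] _ [g' eg dg]; exists (fun x => f' x + g' x).
    exact: elementary_add.
  by move=> x; exact: is_deriveD.
- move=> f g ef [f' ef' df] eg [g' eg' dg].
  exists (fun x => f x * g' x + g x * f' x).
    by apply: elementary_add; exact: elementary_mul.
  by move=> x; exact: is_deriveM.
- move=> f f0 ef [f' ef' df].
  exists (fun x => cst (-1) x * ((f x)^-1 * (f x)^-1) * f' x).
    do 2 ?apply: elementary_mul => //; first by constructor.
    by apply: elementary_mul; exact: elementary_inv.
  move=> x; have := @is_deriveV R f x (f' x) 1 (f0 x) (df x).
  by rewrite /GRing.scale /= mulN1r -invfM -expr2.
- move=> f a b ef [f' ef' df]; exists (fun x => f' (a * x + b) * cst a x).
    by apply: elementary_mul; [exact: (@elementary_aff f') | constructor].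
  move=> x; apply: (@is_derive1_comp _ f (fun y => a * y + b)) => //.
  exact: is_derive_affine.
Qed.

Lemma elementary_smooth f : elementary f -> smooth_on setT f.
Proof.
move=> ef k x _; suff: elementary (derive1n k f).
  by move=> /elementary_derive[g _ dg]; exact: ex_derive.
elim: k => [//|k /elementary_derive[g eg dg]].
rewrite derive1nS; suff -> : derive1 (derive1n k f) = g by [].
by apply/funext => y; rewrite derive1E; exact: derive_val.
Qed.

(** The denominator is positive everywhere, because x and 1 - x are never both
    nonpositive. *)
Definition smooth_step x : R := flat 0 x / (flat 0 x + flat 0 (1 - x)).

Lemma smooth_step_denom_gt0 x : 0 < flat 0 x + flat 0 (1 - x).
Proof.
have [x0|x0] := ltP 0 x; first by rewrite ltr_wpDr ?flat_ge0 ?flat_gt0.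
by rewrite ltr_wpDl ?flat_ge0// flat_gt0// subr_gt0 (le_lt_trans x0).
Qed.

Lemma elementary_smooth_step : elementary smooth_step.
Proof.
apply: elementary_mul; first by constructor.
apply: elementary_inv; first by move=> x; rewrite gt_eqF ?smooth_step_denom_gt0.
apply: elementary_add; first by constructor.
have := @elementary_aff (flat 0) (-1) 1 (elementary_flat 0).
by congr elementary; apply/funext => x; rewrite mulN1r addrC.
Qed.

Lemma smooth_step_le0 x : x <= 0 -> smooth_step x = 0.
Proof. by move=> x0; rewrite /smooth_step flat_le0// mul0r. Qed.

Lemma smooth_step_ge1 x : 1 <= x -> smooth_step x = 1.
Proof.
move=> x1; rewrite /smooth_step (@flat_le0 _ (1 - x)) ?subr_le0// addr0 divff//.
by rewrite gt_eqF// flat_gt0// (lt_le_trans ltr01).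
Qed.

Lemma smooth_step_itv x : 0 <= smooth_step x <= 1.
Proof.
rewrite /smooth_step ler_pdivrMr ?smooth_step_denom_gt0// mul1r lerDl flat_ge0.
by rewrite divr_ge0 ?flat_ge0// ltW// smooth_step_denom_gt0.
Qed.

(** The sign makes the derivative of a rescaled step a probability density,
    against which continuous functions can be averaged. *)
Lemma smooth_step_derive : exists2 rho, elementary rho &
  forall x, is_derive x 1 smooth_step (rho x) /\ 0 <= rho x.
Proof.
have [rho er dr] := elementary_derive elementary_smooth_step.
exists rho => // x; split => //.
pose D := fun y => flat 0 y + flat 0 (1 - y).
have D0 y : D y != 0 by rewrite gt_eqF ?smooth_step_denom_gt0.
have dflat (y : R) : is_derive y 1 (flat 0) (flat 2 y).
  by have := is_derive_flat 0 y; rewrite mul0r subr0.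
have d1 : is_derive x 1 (fun y => flat 0 (1 - y)) (flat 2 (1 - x) * (-1)).
  apply: (@is_derive1_comp _ (flat 0) (fun y => 1 - y)) => //.
  have := is_derive_affine (-1) 1 x; congr is_derive; apply/funext => y.
  by rewrite mulN1r addrC.
have dD : is_derive x 1 D (flat 2 x + flat 2 (1 - x) * (-1)) by exact: is_deriveD.
have ds := is_deriveM (dflat x) (@is_deriveV R D x _ 1 (D0 x) dD).
have e : 'D_1 smooth_step x = rho x by exact: derive_val.
have e' := @derive_val _ _ _ _ _ _ _ ds.
rewrite -e (_ : smooth_step = flat 0 * (fun y => (D y)^-1))// e' /GRing.scale /=.
set F := flat 0 x; set F2 := flat 2 x; set H2 := flat 2 (1 - x).
have -> : F * (- D x ^- 2 * (F2 + H2 * (-1))) + (D x)^-1 * F2 =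
   (flat 0 (1 - x) * F2 + F * H2) / D x ^+ 2.
  rewrite -/(F) /D -/F; field; exact: D0.
by rewrite divr_ge0 ?sqr_ge0// addr_ge0// mulr_ge0// flat_ge0.
Qed.

End SmoothFunctions.

(** * Bounded functions and integrals over open intervals *)

Section OpenIntegral.
Variable R : realType.
Implicit Types (f g : R -> R) (a b c d x M : R).
Local Notation mu := (@lebesgue_measure R).

Definition oint a b g : R := \int[mu]_(x in `]a, b[) g x.

(** Eigenfunctions, potentials and test functions are all bounded and measurable
    on the open edge.  Unlike integrability, this property is stable under
    products. *)
Definition bmeas a b g : Prop :=
  measurable_fun `]a, b[%classic g /\ exists M, forall x, a < x < b -> `|g x| <= M.

Lemma in_oo a b x : (`]a, b[%classic x) = (a < x < b) :> Prop.
Proof. by rewrite /= in_itv. Qed.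

Lemma oo_finite a b : (mu `]a, b[%classic < +oo)%E.
Proof. by rewrite lebesgue_measure_itv/=; case: ifP => // _; rewrite -EFinB ltry. Qed.

Lemma bmeas_integrable a b g : bmeas a b g -> mu.-integrable `]a, b[ (EFin \o g).
Proof.
move=> [mg [M gM]]; apply: measurable_bounded_integrable => //; first exact: oo_finite.
exists M; split; first exact: num_real.
by move=> y My x /=; rewrite in_itv/= => abx; rewrite (le_trans (gM x abx)) ?ltW.
Qed.

Lemma bmeas_sub a b c d g : a <= c -> d <= b -> bmeas a b g -> bmeas c d g.
Proof.
move=> ac db [mg [M gM]]; split.
  apply: measurable_funS mg => // x; rewrite !in_oo => /andP[cx xd].
  by rewrite (le_lt_trans ac)//= (lt_le_trans xd).
by exists M => x /andP[cx xd]; rewrite gM// (le_lt_trans ac)//= (lt_le_trans xd).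
Qed.

Lemma bmeas_cst a b M : bmeas a b (cst M).
Proof. by split; [exact: measurable_cst | exists `|M|]. Qed.

Lemma bmeasD a b f g : bmeas a b f -> bmeas a b g -> bmeas a b (fun x => f x + g x).
Proof.
move=> [mf [M fM]] [mg [N gN]]; split; first exact: measurable_funD.
exists (M + N) => x abx.
by rewrite (le_trans (ler_normD _ _))// lerD ?fM ?gN.
Qed.

Lemma bmeasM a b f g : bmeas a b f -> bmeas a b g -> bmeas a b (fun x => f x * g x).
Proof.
move=> [mf [M fM]] [mg [N gN]]; split; first exact: measurable_funM.
by exists (M * N) => x abx; rewrite normrM ler_pM ?fM ?gN.
Qed.

Lemma bmeasZ a b M g : bmeas a b g -> bmeas a b (fun x => M * g x).
Proof. by move=> bg; apply: bmeasM bg; exact: bmeas_cst. Qed.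

Lemma bmeasN a b g : bmeas a b g -> bmeas a b (fun x => - g x).
Proof.
by move=> /(@bmeasZ _ _ (-1)); congr bmeas; apply/funext => x; rewrite mulN1r.
Qed.

Lemma bmeasB a b f g : bmeas a b f -> bmeas a b g -> bmeas a b (fun x => f x - g x).
Proof. by move=> bf bg; apply: bmeasD bf _; exact: bmeasN. Qed.

Lemma bmeasX a b g n : bmeas a b g -> bmeas a b (fun x => g x ^+ n).
Proof.
move=> bg; elim: n => [|n IH]; first exact: bmeas_cst.
by rewrite (_ : (fun x => _) = fun x => g x * g x ^+ n);
  [exact: bmeasM | apply/funext => x; rewrite exprS].
Qed.

Lemma bmeas_sum (I : Type) (r : seq I) (F : I -> R -> R) a b :
  (forall i, bmeas a b (F i)) -> bmeas a b (fun x => \sum_(i <- r) F i x).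
Proof.
move=> bF; elim: r => [|i r IH].
  rewrite (_ : (fun x => _) = cst 0); first exact: bmeas_cst.
  by apply/funext => x; rewrite big_nil.
rewrite (_ : (fun x => _) = fun x => F i x + \sum_(j <- r) F j x).
  exact: bmeasD.
by apply/funext => x; rewrite big_cons.
Qed.

Lemma bmeas_norm a b g : bmeas a b g -> bmeas a b (fun x => `|g x|).
Proof.
move=> [mg [M gM]]; split; first exact: measurableT_comp.
by exists M => x abx; rewrite normr_id gM.
Qed.

Lemma bmeas_continuous a b g M : (forall x, a < x < b -> {for x, continuous g}) ->
  (forall x, a < x < b -> `|g x| <= M) -> bmeas a b g.
Proof.
move=> cg gM; split; last by exists M.
apply: open_continuous_measurable_fun.
  exact: interval_open.
by move=> x; rewrite inE in_oo => /cg.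
Qed.

Lemma bmeas_within a b g : {within `[a, b], continuous g} -> bmeas a b g.
Proof.
move=> cg; have [ab|ba] := ltP a b; last first.
  have e : `]a, b[%classic = set0 :> set R by apply/eqP; rewrite set_itv_ge// bnd_simp -leNgt.
  split; first by rewrite e; exact: measurable_fun_set0.
  by exists 0 => x /andP[ax xb]; have := lt_trans ax xb; rewrite ltNge ba.
have [c1 _ hc1] := EVT_max (ltW ab) cg.
have [c2 _ hc2] := EVT_min (ltW ab) cg.
apply: (@bmeas_continuous _ _ _ (`|g c1| + `|g c2|)) => x /andP[ax xb].
  by apply: (within_continuous_continuous ab cg); rewrite in_itv/= ax.
have xab : x \in `[a, b] by rewrite in_itv/= !ltW.
have := hc1 _ xab; have := hc2 _ xab.
have := ler_norm (g c1); have := ler_norm (- g c2); rewrite normrN => *.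
have := normr_ge0 (g c1); have := normr_ge0 (g c2) => *.
by rewrite ler_norml; apply/andP; split; lra.
Qed.

Lemma eq_oint a b f g : (forall x, a < x < b -> f x = g x) -> oint a b f = oint a b g.
Proof. by move=> e; apply: eq_Rintegral => x; rewrite inE in_oo => /e. Qed.

Lemma ointD a b f g : bmeas a b f -> bmeas a b g ->
  oint a b (fun x => f x + g x) = oint a b f + oint a b g.
Proof. by move=> /bmeas_integrable bf /bmeas_integrable bg; exact: RintegralD. Qed.

Lemma ointB a b f g : bmeas a b f -> bmeas a b g ->
  oint a b (fun x => f x - g x) = oint a b f - oint a b g.
Proof. by move=> /bmeas_integrable bf /bmeas_integrable bg; exact: RintegralB. Qed.

Lemma ointZ a b M g : bmeas a b g -> oint a b (fun x => M * g x) = M * oint a b g.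
Proof. by move=> /bmeas_integrable bg; exact: RintegralZl. Qed.

Lemma oint0 a b : oint a b (cst 0) = 0.
Proof. by rewrite /oint Rintegral_cst// mul0r. Qed.

Lemma oint_sum (I : Type) (r : seq I) (F : I -> R -> R) a b :
  (forall i, bmeas a b (F i)) ->
  oint a b (fun x => \sum_(i <- r) F i x) = \sum_(i <- r) oint a b (F i).
Proof.
move=> bF; elim: r => [|i r IH].
  rewrite big_nil -[RHS](oint0 a b); congr oint; apply/funext => x.
  by rewrite big_nil.
rewrite big_cons -IH -ointD//; last exact: bmeas_sum.
by congr oint; apply/funext => x; rewrite big_cons.
Qed.

Lemma le_oint a b f g : bmeas a b f -> bmeas a b g ->
  (forall x, a < x < b -> f x <= g x) -> oint a b f <= oint a b g.
Proof.
move=> /bmeas_integrable bf /bmeas_integrable bg fg; exact: le_Rintegral.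
Qed.

Lemma oint_ge0 a b g : (forall x, a < x < b -> 0 <= g x) -> 0 <= oint a b g.
Proof. by move=> g0; apply: Rintegral_ge0 => x; rewrite in_oo; exact: g0. Qed.

Lemma oint_cst a b M : a <= b -> oint a b (cst M) = M * (b - a).
Proof.
move=> ab; rewrite /oint Rintegral_cst//; congr (_ * _).
transitivity (fine (lebesgue_measure (`]a, b[%classic : set R))) => //.
rewrite lebesgue_measure_itv/= lte_fin.
by case: ltgtP ab => //= -> _; rewrite subrr.
Qed.

Lemma oint_norm_le a b g M : a <= b -> bmeas a b g ->
  (forall x, a < x < b -> `|g x| <= M) -> `|oint a b g| <= M * (b - a).
Proof.
move=> ab bg gM; rewrite -oint_cst//; apply: (@le_trans _ _ (oint a b (fun x => `|g x|))).
  by apply: le_normr_Rintegral => //; exact: bmeas_integrable.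
by apply: le_oint => //; [exact: bmeas_norm|exact: bmeas_cst].
Qed.

Lemma oint_split a c b g : a <= c <= b -> bmeas a b g ->
  oint a b g = oint a c g + oint c b g.
Proof.
move=> /andP[ac cb] bg.
have ig : mu.-integrable `]a, b[ (EFin \o g) by exact: bmeas_integrable.
have [<-|ac'] := eqVneq a c.
  by rewrite [oint a a g]/oint set_itv_ge ?bnd_simp ?ltxx// Rintegral_set0 add0r.
have [->|cb'] := eqVneq c b.
  by rewrite [oint b b g]/oint set_itv_ge ?bnd_simp ?ltxx// Rintegral_set0 addr0.
have lac : a < c by rewrite lt_neqAle ac'.
have lcb : c < b by rewrite lt_neqAle cb'.
have := @Rintegral_itvB R g (BRight a) (BLeft b) c ig.
rewrite !bnd_simp => /(_ ac lcb) e.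
rewrite /oint -e [X in X + _]Rintegral_itv_bndo_bndc.
  by rewrite addrC subrK.
by apply: bmeas_integrable; exact: bmeas_sub bg.
Qed.

Definition restr c d g x : R := if c < x < d then g x else 0.

Lemma restrE c d g : restr c d g = g \_ `]c, d[.
Proof.
apply/funext => x; rewrite /restr /restrict /patch.
have -> : (x \in `]c, d[%classic) = (c < x < d); last by [].
by apply/idP/idP; rewrite inE in_oo.
Qed.

Lemma bmeas_restr a b c d g : bmeas c d g -> bmeas a b (restr c d g).
Proof.
move=> [mg [M gM]]; split.
  rewrite restrE; apply: measurable_funTS.
  exact/(measurable_restrictT _ _).1.
exists `|M| => x _; rewrite /restr; case: ifPn => [cdx|_]; last by rewrite normr0.
by rewrite (le_trans (gM _ cdx))// ler_norm.
Qed.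

Lemma oint_restr a b c d g : a <= c -> d <= b ->
  oint a b (restr c d g) = oint c d g.
Proof.
move=> ac db; rewrite /oint restrE -Rintegral_mkcondr; congr Rintegral.
apply/seteqP; split=> x /=; rewrite !in_itv/=; first by move=> [].
move=> /andP[cx xd]; rewrite cx xd; split=> //.
by rewrite (le_lt_trans ac)//= (lt_le_trans xd).
Qed.

(** The integrand may have no limit at the end points, as happens for a
    potential, so the primitive is only differentiable in the open interval.
    The function Phi is compared with the indefinite integral of k: their
    difference has derivative zero inside and is continuous up to the ends. *)
Lemma oint_ftc a b (k Phi : R -> R) : a < b -> bmeas a b k ->
  (forall x, a < x < b -> {for x, continuous k}) ->
  {within `[a, b], continuous Phi} ->
  (forall x, a < x < b -> is_derive x 1 Phi (k x)) ->
  oint a b k = Phi b - Phi a.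
Proof.
move=> ab bk ck cPhi dPhi; set k' := restr a b k.
have ik' A : measurable A -> mu.-integrable A (EFin \o k').
  move=> mA; have : mu.-integrable setT (EFin \o k').
    rewrite /k' restrE; rewrite -restrict_EFin -integrable_mkcond//.
    exact: bmeas_integrable.
  exact: integrableS.
pose G x : R := \int[mu]_(t in `[a, x]) k' t.
have dG x : a < x < b -> is_derive x 1 G (k x).
  move=> abx; have /andP[ax xb] := abx.
  have ck' : {for x, continuous k'}.
    have : k @ x --> k' x by rewrite /k' /restr abx; exact: ck.
    apply: cvg_trans; apply: near_eq_cvg; near=> y; rewrite /k' /restr ifT//.
    apply/andP; split; near: y; [exact: lt_nbhsr | exact: lt_nbhsl].
  have := @continuous_FTC1 R k' (BLeft a) x b xb (ik' _ _).
  have mI : measurable `[a, b]%classic by [].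
  have lta : ((BLeft a : \bar R) < BRight x)%E by rewrite /= lte_fin.
  move=> /(_ mI lta ck')[].
  move=> h1 h2; split; first exact: h1.
  by rewrite -derive1E h2 /k' /restr abx.
have cG : {within `[a, b], continuous G}.
  by apply: parameterized_integral_continuous; [exact: ltW|exact: ik'].
have dH x : x \in `]a, b[ -> is_derive x 1 (Phi - G) ((fun=> 0) x).
  by rewrite in_itv/= => xab; have := is_deriveB (dPhi _ xab) (dG _ xab); rewrite subrr.
have [c _ /=] := MVT ab dH (within_continuousB cPhi cG).
rewrite mul0r => e.
have Ga : G a = 0 by rewrite /G set_itv1 Rintegral_set1.
have Gb : G b = oint a b k.
  rewrite /G -Rintegral_itv_bndo_bndc; last by apply: ik'.
  rewrite -Rintegral_itv_obnd_cbnd; last by apply: ik'.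
  by apply: eq_oint => x abx; rewrite /k' /restr abx.
have e' : Phi b - G b - (Phi a - G a) = 0 := e.
by rewrite -Gb; lra.
Unshelve. all: by end_near. Qed.

End OpenIntegral.

(** * The lemma of du Bois-Reymond *)

Section WeakDerivative.
Variable R : realType.
Implicit Types (f g h : R -> R) (a b c x e : R).
Local Notation mu := (@lebesgue_measure R).

Lemma is_derive_continuous g x (d : R) : is_derive x 1 g d -> {for x, continuous g}.
Proof.
by move=> H; apply: differentiable_continuous; apply/derivable1_diffP; exact: ex_derive.
Qed.

Lemma elementary_continuous f x : elementary f -> {for x, continuous f}.
Proof. by move=> /elementary_derive[g _ /(_ x)/is_derive_continuous]. Qed.

Definition ramp c e x : R := smooth_step (e^-1 * x + (- (c / e))).

Lemma ramp_arg c e x : e^-1 * x + (- (c / e)) = (x - c) / e.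
Proof. by rewrite mulrBl mulrC. Qed.

Lemma elementary_ramp c e : elementary (ramp c e).
Proof. apply: (@elementary_aff _ (@smooth_step R)); exact: elementary_smooth_step. Qed.

Lemma ramp_left c e x : 0 < e -> x <= c -> ramp c e x = 0.
Proof.
move=> e0 xc; rewrite /ramp ramp_arg smooth_step_le0//.
by rewrite ler_pdivrMr// mul0r subr_le0.
Qed.

Lemma ramp_right c e x : 0 < e -> c + e <= x -> ramp c e x = 1.
Proof.
move=> e0 xc; rewrite /ramp ramp_arg smooth_step_ge1//.
by rewrite ler_pdivlMr// mul1r lerBrDl.
Qed.

Lemma ramp_itv c e x : 0 <= ramp c e x <= 1.
Proof. exact: smooth_step_itv. Qed.

(** The derivative of a short ramp is an approximate identity at c: nonnegative,
    of mass 1, and concentrated on [c, c + e]. *)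
Lemma ramp_derive c e : 0 < e -> exists rho : R -> R,
  [/\ forall x, is_derive x 1 (ramp c e) (rho x),
      forall x, {for x, continuous rho},
      forall x, 0 <= rho x,
      forall x, ~~ (c <= x <= c + e) -> rho x = 0 &
      oint c (c + e) rho = 1].
Proof.
move=> e0; have [r er dr] := smooth_step_derive R.
pose rho x := r (e^-1 * x + (- (c / e))) * e^-1.
have drho x : is_derive x 1 (ramp c e) (rho x).
  apply: (@is_derive1_comp _ (@smooth_step R) (fun y => e^-1 * y + (- (c / e)))).
    exact: (dr _).1.
  exact: is_derive_affine.
have crho x : {for x, continuous rho}.
  apply: elementary_continuous; apply: elementary_mul; last exact: elementary_cst.
  exact: (@elementary_aff _ r).
have rho0 x : 0 <= rho x.
  by rewrite mulr_ge0 ?invr_ge0 ?(ltW e0)//; exact: (dr _).2.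
exists rho; split => //.
- move=> x xc; have d := drho x.
  have [xltc|cx] := ltP x c.
    have d' : is_derive x 1 (ramp c e) 0.
      apply: near_eq_is_derive (is_derive_cst (0 : R) x 1).
      near=> y; rewrite /cst ramp_left// ltW//; near: y; exact: lt_nbhsl.
    by rewrite -(@derive_val _ _ _ _ _ _ _ d) (@derive_val _ _ _ _ _ _ _ d').
  move: xc; rewrite cx/= -ltNge => cex.
  have d' : is_derive x 1 (ramp c e) 0.
    apply: near_eq_is_derive (is_derive_cst (1 : R) x 1).
    near=> y; rewrite /cst ramp_right// ltW//; near: y; exact: lt_nbhsr.
  by rewrite -(@derive_val _ _ _ _ _ _ _ d) (@derive_val _ _ _ _ _ _ _ d').
- have ce : c < c + e by rewrite ltrDl.
  rewrite (@oint_ftc _ _ _ _ (ramp c e))//.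
  + by rewrite ramp_right// ramp_left// subr0.
  + apply: bmeas_within; apply: continuous_subspaceT => x; exact: crho.
  + apply: continuous_subspaceT => x; exact: is_derive_continuous (drho x).
Unshelve. all: by end_near. Qed.

Lemma oint_mulr_ramp_derive l g c e (eta : R) (rho : R -> R) :
  bmeas 0 l g -> 0 < c -> 0 < e -> c + e < l ->
  (forall x, {for x, continuous rho}) -> (forall x, 0 <= rho x) ->
  (forall x, ~~ (c <= x <= c + e) -> rho x = 0) -> oint c (c + e) rho = 1 ->
  (forall x, c <= x <= c + e -> `|g x - g c| <= eta) ->
  `|oint 0 l (fun x => g x * rho x) - g c| <= eta.
Proof.
move=> bg c0 e0 cel crho rho0 rhoE irho geta.
have ce : c < c + e by rewrite ltrDl.
have brho a b : bmeas a b rho.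
  by apply: bmeas_within; apply: continuous_subspaceT => x; exact: crho.
have bgr : bmeas 0 l (fun x => g x * rho x) by exact: bmeasM.
have bg' : bmeas c (c + e) g by apply: bmeas_sub bg; exact: ltW.
have e1 : oint 0 l (fun x => g x * rho x) = oint c (c + e) (fun x => g x * rho x).
  rewrite (@oint_split _ 0 c)//; last by rewrite ltW//= ltW// (lt_trans ce).
  rewrite (@oint_split _ c (c + e) l); last 2 first.
  - by rewrite ltW//= ltW.
  - by apply: bmeas_sub bgr => //; exact: ltW.
  rewrite (@eq_oint _ 0 c _ (cst 0)); last first.
    by move=> x /andP[_ xc]; rewrite rhoE ?mulr0// leNgt xc.
  rewrite (@eq_oint _ (c + e) l _ (cst 0)); last first.
    by move=> x /andP[xc _]; rewrite rhoE ?mulr0// [x <= _]leNgt xc andbF.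
  by rewrite !oint0 add0r addr0.
have e2 : oint c (c + e) (fun x => g x * rho x) - g c =
    oint c (c + e) (fun x => (g x - g c) * rho x).
  rewrite -{1}[g c]mulr1 -irho -ointZ// -ointB//.
  - by apply: eq_oint => x _; rewrite mulrBl.
  - exact: bmeasM.
  - exact: bmeasZ.
have bd : bmeas c (c + e) (fun x => (g x - g c) * rho x).
  by apply: bmeasM => //; apply: bmeasB => //; exact: bmeas_cst.
rewrite e1 e2 -[leRHS]mulr1 -irho -ointZ// ler_norml; apply/andP; split.
  rewrite -mulN1r -ointZ; last exact: bmeasZ.
  apply: le_oint => //; first by do 2 apply: bmeasZ.
  move=> x /andP[cx xc]; rewrite mulN1r -mulNr ler_wpM2r//.
  by have := geta x; rewrite (ltW cx) (ltW xc) => /(_ isT); rewrite ler_norml => /andP[].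
apply: le_oint => //; first by apply: bmeasZ.
move=> x /andP[cx xc]; rewrite ler_wpM2r//.
by have := geta x; rewrite (ltW cx) (ltW xc) => /(_ isT); rewrite ler_norml => /andP[].
Qed.

(** The test function is the difference of two ramps of width e, one starting at
    a and the other at b.  It tends to the indicator function of the interval,
    and its derivative to the difference of the point masses at a and b, so the
    weak identity turns into the fundamental theorem of calculus.  Each of the
    four errors is at most eta once e is small. *)
Lemma du_bois_reymond l g h :
  (forall phi, test_function l phi -> oint 0 l (fun x => g x * derive1 phi x) =
     - oint 0 l (fun x => h x * phi x)) ->
  bmeas 0 l g -> bmeas 0 l h -> (forall x, 0 < x < l -> {for x, continuous g}) ->
  forall a b, 0 < a -> a < b -> b < l -> g b - g a = oint a b h.
Proof.
move=> weak bg bh cg a b a0 ab bl; have [mh [M' hM']] := bh.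
pose M := `|M'| + 1; have M_gt0 : 0 < M by rewrite ltr_wpDl.
have hM x : 0 < x < l -> `|h x| <= M.
  by move=> /hM'/le_trans; apply; rewrite (le_trans (ler_norm _))// lerDl.
apply/eqP; rewrite -subr_eq0 -normr_eq0 eq_le normr_ge0 andbT.
apply/ler_addgt0Pl => eta0 eta00; rewrite addr0.
pose eta := eta0 / 4; have eta_gt0 : 0 < eta by rewrite divr_gt0.
have near_c c : 0 < c < l -> \forall e \near 0^'+, forall x, c <= x <= c + e -> `|g x - g c| <= eta.
  move=> cl; have /cvgrPdist_le/(_ _ eta_gt0) := cg c cl.
  move=> /nbhs_ballP[d /= d0 hd]; near=> e => x /andP[cx xe].
  rewrite distrC; apply: hd; rewrite /ball /= distrC ger0_norm ?subr_ge0//.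
  rewrite ltrBlDl (le_lt_trans xe)// ltrD2l; near: e; exact: nbhs_right_lt.
have : \forall e \near (0 : R)^'+, `|g b - g a - oint a b h| <= eta0.
  have bl' : 0 < b < l by rewrite bl andbT (lt_trans a0).
  have al' : 0 < a < l by rewrite a0 (lt_trans ab).
  near=> e.
  have e0 : 0 < e by near: e; exact: nbhs_right_gt.
  have aeb : a + e < b.
    by rewrite -ltrBrDl; near: e; apply: nbhs_right_lt; rewrite subr_gt0.
  have bel : b + e < l.
    by rewrite -ltrBrDl; near: e; apply: nbhs_right_lt; rewrite subr_gt0.
  have Me : M * e <= eta.
    by rewrite mulrC -ler_pdivlMr//; near: e; apply: nbhs_right_le; rewrite divr_gt0.
  have ga x : a <= x <= a + e -> `|g x - g a| <= eta.
    by move: x; near: e; exact: near_c.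
  have gb x : b <= x <= b + e -> `|g x - g b| <= eta.
    by move: x; near: e; exact: near_c.
  have [ra [dra cra ra0 raE ira]] := ramp_derive a e0.
  have [rb [drb crb rb0 rbE irb]] := ramp_derive b e0.
  pose phi x := ramp a e x + cst (-1) x * ramp b e x.
  have el : elementary phi.
    apply: elementary_add; first exact: elementary_ramp.
    by apply: elementary_mul; [exact: elementary_cst|exact: elementary_ramp].
  have tphi : test_function l phi.
    split; first exact: elementary_smooth.
    exists a, (b + e); split=> // x; rewrite in_itv/= negb_and -!ltNge => /orP[xa|xb].
      by rewrite /phi !ramp_left ?mulr0 ?addr0 ?ltW// (lt_trans xa).
    rewrite /phi !ramp_right ?(ltW xb)// /cst ?mulr1 ?subrr//.
    by rewrite ltW// (lt_trans _ xb)// ltrD2r.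
  have dphi x : derive1 phi x = ra x - rb x.
    have d : is_derive x 1 phi (ra x + (-1) * rb x).
      exact: (is_deriveD (dra x) (is_deriveZ (-1) (drb x))).
    by rewrite derive1E (@derive_val _ _ _ _ _ _ _ d) mulN1r.
  have bra u v : bmeas u v ra by apply: bmeas_within; apply: continuous_subspaceT => x; exact: cra.
  have brb u v : bmeas u v rb by apply: bmeas_within; apply: continuous_subspaceT => x; exact: crb.
  have bphi u v : bmeas u v phi.
    by apply: bmeas_within; apply: continuous_subspaceT => x; exact: elementary_continuous.
  have := weak _ tphi.
  rewrite (@eq_oint _ _ _ _ (fun x => g x * ra x - g x * rb x)); last first.
    by move=> x _; rewrite dphi mulrBr.
  rewrite ointB; [|exact: bmeasM..]; move=> wk.
  have ha := @oint_mulr_ramp_derive l g a e eta ra bg a0 e0 (lt_trans aeb bl) cra ra0 raE ira ga.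
  have b0 : 0 < b := lt_trans a0 ab.
  have hb := @oint_mulr_ramp_derive l g b e eta rb bg b0 e0 bel crb rb0 rbE irb gb.
  have bhp : bmeas 0 l (fun x => h x * phi x) by exact: bmeasM.
  have hsub u v : 0 <= u -> v <= l -> bmeas u v h by move=> u0 vl; exact: bmeas_sub bh.
  have ale : a <= l by rewrite ltW// (lt_trans ab).
  have b0' : b <= l := ltW bl.
  have hE : oint 0 l (fun x => h x * phi x) =
      oint a b (fun x => h x * phi x) + oint b (b + e) (fun x => h x * phi x).
    rewrite (@oint_split _ 0 a l)//; last by rewrite (ltW a0).
    rewrite (@eq_oint _ 0 a _ (cst 0)) ?oint0 ?add0r; last first.
      move=> x /andP[_ xa]; rewrite /phi !ramp_left ?mulr0 ?addr0 ?mulr0 ?ltW//.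
      exact: lt_trans xa ab.
    rewrite (@oint_split _ a b l); last 2 first.
    - by rewrite (ltW ab) (ltW bl).
    - by apply: bmeas_sub bhp => //; rewrite ltW.
    rewrite (@oint_split _ b (b + e) l); last 2 first.
    - by rewrite lerDl !ltW.
    - by apply: bmeas_sub bhp => //; rewrite ltW.
    rewrite (@eq_oint _ (b + e) l _ (cst 0)) ?oint0 ?addr0//.
    move=> x /andP[xb _]; rewrite /phi !ramp_right ?(ltW xb)//.
      by rewrite /cst mulr1 subrr mulr0.
    have aebe : a + e < b + e by rewrite ltrD2r.
    exact: ltW (lt_trans aebe xb).
  have phi1 x : x < b -> phi x = ramp a e x.
    by move=> xb; rewrite /phi (@ramp_left b) ?mulr0 ?addr0 ?ltW.
  have phiI x : `|phi x| <= 1.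
    have := ramp_itv a e x; have := ramp_itv b e x; rewrite /phi /cst.
    by move=> /andP[? ?] /andP[? ?]; rewrite ler_norml; apply/andP; split; lra.
  have i1 : `|oint a b (fun x => h x * phi x) - oint a b h| <= eta.
    rewrite -ointB; [|by apply: bmeasM => //; apply: hsub; exact: ltW|by apply: hsub; exact: ltW].
    have bd : bmeas a b (fun x => h x * phi x - h x).
      apply: bmeasB; last by apply: hsub; exact: ltW.
      by apply: bmeasM => //; apply: hsub; exact: ltW.
    rewrite (@oint_split _ a (a + e) b)//; last by rewrite lerDl !ltW.
    rewrite (@eq_oint _ (a + e) b _ (cst 0)) ?oint0 ?addr0; last first.
      by move=> x /andP[xa xb]; rewrite phi1// ramp_right ?(ltW xa)// mulr1 subrr.
    apply: le_trans Me; rewrite -[X in M * X](addrK a e) [e + a]addrC.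
    apply: oint_norm_le; first by rewrite lerDl ltW.
      by apply: bmeas_sub bd => //; exact: ltW.
    move=> x /andP[ax xa]; rewrite -{2}[h x]mulr1 -mulrBr normrM -[leRHS]mulr1.
    rewrite ler_pM ?normr_ge0 ?hM//.
      by rewrite (lt_trans a0)//= (lt_trans xa)// (lt_trans aeb).
    rewrite phi1 ?(lt_trans xa)//; have := ramp_itv a e x.
    by move=> /andP[? ?]; rewrite ler_norml; apply/andP; split; lra.
  have i2 : `|oint b (b + e) (fun x => h x * phi x)| <= eta.
    apply: le_trans Me; rewrite -[X in M * X](addrK b e) [e + b]addrC.
    apply: oint_norm_le; first by rewrite lerDl ltW.
      by apply: bmeas_sub bhp => //; exact: ltW.
    move=> x /andP[bx xb]; rewrite normrM -[leRHS]mulr1.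
    by rewrite ler_pM ?normr_ge0 ?hM// (lt_trans b0)//= (lt_trans xb).
  have eE : eta0 = eta + eta + eta + eta by rewrite /eta; field.
  move: ha hb i1 i2 wk; rewrite hE !ler_norml eE.
  move=> /andP[? ?] /andP[? ?] /andP[? ?] /andP[? ?] E.
  by apply/andP; split; lra.
by move=> /filter_ex[].
Unshelve. all: by end_near. Qed.

(** By [du_bois_reymond], g is a primitive of the continuous function h. *)
Lemma weak_is_derive l g h :
  (forall phi, test_function l phi -> oint 0 l (fun x => g x * derive1 phi x) =
     - oint 0 l (fun x => h x * phi x)) ->
  bmeas 0 l g -> bmeas 0 l h -> (forall x, 0 < x < l -> {for x, continuous g}) ->
  (forall x, 0 < x < l -> {for x, continuous h}) ->
  forall x, 0 < x < l -> is_derive x 1 g (h x).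
Proof.
move=> weak bg bh cg ch x /andP[x0 xl].
pose a := x / 2; pose b := (x + l) / 2.
have ax : a < x by rewrite /a; lra.
have a0 : 0 < a by rewrite /a; lra.
have xb : x < b by rewrite /b; lra.
have bl : b < l by rewrite /b; lra.
pose k := restr 0 l h.
have ik A : measurable A -> mu.-integrable A (EFin \o k).
  move=> mA; have : mu.-integrable setT (EFin \o k).
    rewrite /k restrE; rewrite -restrict_EFin -integrable_mkcond//.
    exact: bmeas_integrable.
  exact: integrableS.
have kx : k x = h x by rewrite /k /restr x0 xl.
have ck : {for x, continuous k}.
  have : h @ x --> k x by rewrite kx; apply: ch; rewrite x0.
  apply: cvg_trans; apply: near_eq_cvg; near=> y; rewrite /k /restr ifT//.
  by apply/andP; split; near: y; [exact: lt_nbhsr | exact: lt_nbhsl].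
have := @continuous_FTC1 R k (BLeft a) x b xb (ik _ _).
have mI : measurable `[a, b]%classic by [].
have lta : ((BLeft a : \bar R) < BRight x)%E by rewrite /= lte_fin.
move=> /(_ mI lta ck)[].
set F := fun _ => _ => dF F'.
have dF' : is_derive x 1 F (h x) by split; [exact: dF | rewrite -derive1E F' kx].
have d : is_derive x 1 (F + cst (g a)) (h x + 0) by apply: is_deriveD.
rewrite addr0 in d; apply: near_eq_is_derive d.
near=> y.
have ay : a < y by near: y; exact: lt_nbhsr.
have yl : y < l by near: y; exact: lt_nbhsl.
rewrite /= /cst -[RHS](subrK (g a)) (du_bois_reymond weak bg bh cg a0 ay yl).
congr (_ + _); rewrite /F -Rintegral_itv_bndo_bndc; last by apply: ik.
rewrite -Rintegral_itv_obnd_cbnd; last by apply: ik.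
apply: eq_oint => z /andP[az zy]; rewrite /k /restr ifT//.
by rewrite (lt_trans a0)//= (lt_trans zy).
Unshelve. all: by end_near. Qed.

End WeakDerivative.

(** * Green's identity and half kernels *)

Section HalfKernel.
Variable R : realType.
Implicit Types (u q w : R -> R) (l a b k d x y t M : R).

(** Classical solutions of u'' = (q - la) u with derivative u1, both continuous up
    to the ends of the edge. *)
Definition solves l q (la : R) u u1 : Prop :=
  [/\ {within `[0, l], continuous u}, {within `[0, l], continuous u1},
      forall x, 0 < x < l -> is_derive x 1 u (u1 x) &
      forall x, 0 < x < l -> is_derive x 1 u1 ((q x - la) * u x)].

Definition potential l M q : Prop :=
  [/\ bmeas 0 l q, forall x, 0 < x < l -> {for x, continuous q} &
      forall x, 0 < x < l -> `|q x| <= M].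

(** The function u1 * w - u * w1 has the derivative
    (q - la) * u * w - u * w2. *)
Lemma green l M q la u u1 (s : R) a b w w1 w2 :
  potential l M q -> solves l q la u u1 ->
  0 <= a -> a < b -> b <= l ->
  (forall y, is_derive y 1 w (w1 y)) -> (forall y, is_derive y 1 w1 (w2 y)) ->
  (forall y, {for y, continuous w2}) ->
  (la + s) * oint a b (fun y => u y * w y) =
  oint a b (fun y => u y * (s * w y + q y * w y - w2 y)) -
  ((u1 b * w b - u b * w1 b) - (u1 a * w a - u a * w1 a)).
Proof.
move=> [bq cq _] [cu cu1 du du1] a0 ab bl dw dw1 cw2.
have bc (v : R -> R) : (forall y : R, {for y, continuous v}) -> bmeas a b v.
  by move=> cv; apply: bmeas_within; apply: continuous_subspaceT => y; exact: cv.
have cw y : {for y, continuous w} by exact: is_derive_continuous (dw y).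
have cw1 y : {for y, continuous w1} by exact: is_derive_continuous (dw1 y).
have sub v : bmeas 0 l v -> bmeas a b v by exact: bmeas_sub.
have bu : bmeas a b u by apply: sub; exact: bmeas_within.
have bqu : bmeas a b q by exact: sub.
have bw : bmeas a b w by exact: bc.
have bw2 : bmeas a b w2 by exact: bc.
have inn y : a < y < b -> 0 < y < l.
  by move=> /andP[ay yb]; rewrite (le_lt_trans a0)//= (lt_le_trans yb).
have sabl : `[a, b] `<=` (`[0, l] : set R).
  move=> y; rewrite /= !in_itv/= => /andP[ay yb].
  by rewrite (le_trans a0)//= (le_trans yb).
have cua := continuous_subspaceW sabl cu.
have cu1a := continuous_subspaceW sabl cu1.
pose Phi y := u1 y * w y - u y * w1 y.
pose kk y := (q y - la) * u y * w y - u y * w2 y.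
have wm (f g : R -> R) : {within `[a, b], continuous f} -> (forall y : R, {for y, continuous g}) ->
    {within `[a, b], continuous (fun y => f y * g y)}.
  move=> cf cg y; apply: cvgM; first exact: cf.
  by apply: continuous_subspaceT => z; exact: cg.
have e : oint a b kk = Phi b - Phi a.
  apply: oint_ftc => //.
  - rewrite /kk; apply: bmeasB; last exact: bmeasM.
    by apply: bmeasM => //; apply: bmeasM => //; apply: bmeasB => //; exact: bmeas_cst.
  - move=> y /inn yl; apply: cvgB.
      apply: cvgM; last exact: cw.
      apply: cvgM; last exact: is_derive_continuous (du y yl).
      by apply: cvgB; [exact: cq|exact: cvg_cst].
    by apply: cvgM; [exact: is_derive_continuous (du y yl)|exact: cw2].
  - by apply: within_continuousB; exact: wm.
  - move=> y /inn yl.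
    have := is_deriveB (is_deriveM (du1 y yl) (dw y)) (is_deriveM (du y yl) (dw1 y)).
    move=> H; apply: is_derive_eq H _.
    by rewrite /GRing.scale /= /kk; ring.
rewrite -/(Phi b) -/(Phi a) -e.
have buw : bmeas a b (fun y => u y * w y) by exact: bmeasM.
rewrite -ointZ// /kk -ointB.
- by apply: eq_oint => y _; ring.
- apply: bmeasM => //; apply: bmeasB => //; apply: bmeasD; first exact: bmeasZ.
  exact: bmeasM.
- apply: bmeasB; last exact: bmeasM.
  by apply: bmeasM => //; apply: bmeasM => //; apply: bmeasB => //; exact: bmeas_cst.
Qed.

(** This cut-off vanishes to second order at d, so that no boundary term arises
    there, and its derivative vanishes at 0, so that multiplying by it keeps the
    value and the slope of the exponential at the pole. *)
Definition cutoff d t : R := (1 - d ^- 2 * t ^+ 2) ^+ 2.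
Definition cutoff1 d t : R := - 4 * d ^- 2 * t * (1 - d ^- 2 * t ^+ 2).
Definition cutoff2 d t : R := - 4 * d ^- 2 * (1 - 3 * d ^- 2 * t ^+ 2).

Lemma is_derive_cutoff_base (c : R) t : is_derive t 1 (fun y : R => 1 - c * y ^+ 2) (- (2 * c * t)).
Proof.
have d2 : is_derive t 1 (fun y : R => y * y) (t * 1 + t * 1).
  exact: (is_deriveM (is_derive_id t 1) (is_derive_id t 1)).
have dB := is_deriveB (is_derive_cst (1 : R) t (1 : R)) (is_deriveZ c d2).
have -> : (fun y : R => 1 - c * y ^+ 2) = cst 1 - (c *: (fun y : R => y * y)).
  by apply/funext => y; rewrite expr2.
by apply: is_derive_eq dB _; rewrite /GRing.scale/=; ring.
Qed.

Lemma is_derive_cutoff d t : is_derive t 1 (cutoff d) (cutoff1 d t).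
Proof.
have := is_deriveM (is_derive_cutoff_base (d ^- 2) t) (is_derive_cutoff_base (d ^- 2) t).
move=> H; have -> : cutoff d = (fun y : R => 1 - d ^- 2 * y ^+ 2) * (fun y => 1 - d ^- 2 * y ^+ 2).
  by apply/funext => y; rewrite /cutoff expr2.
by apply: is_derive_eq H _; rewrite /GRing.scale/= /cutoff1; ring.
Qed.

Lemma is_derive_cutoff1 d t : is_derive t 1 (cutoff1 d) (cutoff2 d t).
Proof.
have := is_deriveM (is_derive_affine (- 4 * d ^- 2) 0 t) (is_derive_cutoff_base (d ^- 2) t).
move=> H; have -> : cutoff1 d =
  (fun y : R => - 4 * d ^- 2 * y + 0) * (fun y => 1 - d ^- 2 * y ^+ 2).
  by apply/funext => y; rewrite /cutoff1 [in RHS]/GRing.mul /= addr0.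
by apply: is_derive_eq H _; rewrite /GRing.scale/= /cutoff2; ring.
Qed.

Definition decay k t : R := expR (- k * t).

Lemma is_derive_decay k t : is_derive t 1 (decay k) (- k * decay k t).
Proof.
have := @is_derive1_comp R expR (fun y : R => - k * y + 0) t _ _ (is_derive_expR (- k * t + 0)) (is_derive_affine (- k) 0 t).
have -> : expR \o (fun y : R => - k * y + 0) = decay k.
  by apply/funext => y; rewrite /= addr0.
by rewrite addr0 mulrC.
Qed.

Definition profile k d t : R := decay k t * cutoff d t.
Definition profile1 k d t : R := decay k t * (cutoff1 d t - k * cutoff d t).
Definition profile2 k d t : R :=
  decay k t * (cutoff2 d t - 2 * k * cutoff1 d t + k ^+ 2 * cutoff d t).

Lemma is_derive_profile k d t : is_derive t 1 (profile k d) (profile1 k d t).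
Proof.
have H := is_deriveM (is_derive_decay k t) (is_derive_cutoff d t).
by apply: is_derive_eq H _; rewrite /GRing.scale/= /profile1; ring.
Qed.

Lemma is_derive_profile1 k d t : is_derive t 1 (profile1 k d) (profile2 k d t).
Proof.
have H1 : is_derive t 1 (fun y : R => cutoff1 d y - k * cutoff d y)
    (cutoff2 d t - k * cutoff1 d t).
  exact: (is_deriveB (is_derive_cutoff1 d t) (is_deriveZ k (is_derive_cutoff d t))).
have H := is_deriveM (is_derive_decay k t) H1.
by apply: is_derive_eq H _; rewrite /GRing.scale/= /profile2; ring.
Qed.

Lemma profile2_continuous k d t : {for t, continuous (profile2 k d)}.
Proof.
have d2 : is_derive t 1 (cutoff2 d) (- 4 * d ^- 2 * - (2 * (3 * d ^- 2) * t)).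
  exact: (is_deriveZ (- 4 * d ^- 2) (is_derive_cutoff_base (3 * d ^- 2) t)).
apply: cvgM; first exact: is_derive_continuous (is_derive_decay k t).
apply: cvgD; last first.
  by apply: cvgMl_tmp; exact: is_derive_continuous (is_derive_cutoff d t).
apply: cvgB; first exact: is_derive_continuous d2.
by apply: cvgMl_tmp; exact: is_derive_continuous (is_derive_cutoff1 d t).
Qed.

Implicit Types (bs : bool).
(** A half kernel with pole x lives on one side of x: to the left if bs is true,
    to the right otherwise.  On its support the distance to the pole is
    [dist]. *)
Definition sgnb bs : R := if bs then -1 else 1.
Definition hlo d x bs : R := if bs then x - d else x.
Definition hhi d x bs : R := if bs then x else x + d.
Definition dist x bs y : R := sgnb bs * (y - x).

Lemma sgnb2 bs : sgnb bs * sgnb bs = 1.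
Proof. by case: bs; rewrite /sgnb ?mulr1// mulrNN mulr1. Qed.

Lemma hlo_lt_hhi d x bs : 0 < d -> hlo d x bs < hhi d x bs.
Proof. by case: bs => d0; rewrite /hlo /hhi; lra. Qed.

Lemma dist_itv d x bs y : hlo d x bs < y < hhi d x bs -> 0 < dist x bs y < d.
Proof.
rewrite /hlo /hhi /dist /sgnb; case: bs => /andP[? ?]; apply/andP; split; lra.
Qed.

Lemma is_derive_dist f (df : R) x bs y :
  is_derive (dist x bs y) 1 f df ->
  is_derive y 1 (fun z => f (dist x bs z)) (df * sgnb bs).
Proof.
move=> dfy; apply: (@is_derive1_comp _ f (fun z => dist x bs z)) => //.
have := is_derive_affine (sgnb bs) (- sgnb bs * x) y.
have -> // : (fun z : R => sgnb bs * z + - sgnb bs * x) = dist x bs.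
by apply/funext => z; rewrite /dist; ring.
Qed.

Lemma oint_decay d x bs c : 0 < d -> 0 < c ->
  oint (hlo d x bs) (hhi d x bs) (fun y => decay c (dist x bs y)) =
  (1 - decay c d) / c.
Proof.
move=> d0 c0; have cn0 : c != 0 by rewrite gt_eqF.
have dd y : is_derive y 1 (fun z => decay c (dist x bs z))
   (- c * decay c (dist x bs y) * sgnb bs).
  by apply: is_derive_dist; exact: is_derive_decay.
have cd y : {for y, continuous (fun z => decay c (dist x bs z))}.
  exact: is_derive_continuous (dd y).
pose Phi y := - (sgnb bs / c) * decay c (dist x bs y).
transitivity (Phi (hhi d x bs) - Phi (hlo d x bs)); last first.
  rewrite /Phi /hlo /hhi /dist /sgnb /decay; case: bs {dd cd Phi}.
    rewrite subrr !mulr0 expR0 (_ : -1 * (x - d - x) = d); last by ring.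
    by field.
  rewrite subrr !mulr0 expR0 (_ : 1 * (x + d - x) = d); last by ring.
  by field.
apply: oint_ftc.
- exact: hlo_lt_hhi.
- apply: bmeas_within; apply: continuous_subspaceT => y; exact: cd.
- by move=> y _; exact: cd.
- apply: continuous_subspaceT => y; apply: cvgMl_tmp; exact: cd.
- move=> y _; have H := is_deriveZ (- (sgnb bs / c)) (dd y).
  apply: is_derive_eq H _; rewrite /GRing.scale/=.
  transitivity ((sgnb bs * sgnb bs) * decay c (dist x bs y)); first by field.
  by rewrite sgnb2 mul1r.
Qed.

Lemma bmeas_decay a b x bs c : bmeas a b (fun y => decay c (dist x bs y)).
Proof.
apply: bmeas_within; apply: continuous_subspaceT => y.
by apply: is_derive_continuous; apply: is_derive_dist; exact: is_derive_decay.
Qed.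

(** The kernel exp (- k t) solves w'' = k^2 w, and the cut-off spoils this only
    through its own derivatives; [hres] collects the remainder
    - w'' + (q + k^2) w of the kernel off the pole. *)
Definition hker k d x bs : R -> R :=
  restr (hlo d x bs) (hhi d x bs) (fun y => profile k d (dist x bs y)).

Definition hres q k d x bs : R -> R :=
  restr (hlo d x bs) (hhi d x bs) (fun y => decay k (dist x bs y) *
    (q y * cutoff d (dist x bs y) + 2 * k * cutoff1 d (dist x bs y) - cutoff2 d (dist x bs y))).

Lemma bmeas_comp_dist a b x bs f (df : R -> R) :
  (forall t, is_derive t 1 f (df t)) -> bmeas a b (fun y => f (dist x bs y)).
Proof.
move=> dfx; apply: bmeas_within; apply: continuous_subspaceT => y.
by apply: is_derive_continuous; apply: is_derive_dist; exact: dfx.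
Qed.

Section Estimates.
Variables (l M d x k : R) (bs : bool) (q : R -> R).
Hypotheses (d0 : 0 < d) (k1 : 1 <= k) (lo0 : 0 <= hlo d x bs) (hil : hhi d x bs <= l).
Hypothesis pq : potential l M q.

Let k0 : 0 < k. Proof. exact: lt_le_trans k1. Qed.
Let lohi := hlo_lt_hhi x bs d0.

Lemma bmeas_hker a b : bmeas a b (hker k d x bs).
Proof.
apply: bmeas_restr; apply: bmeas_comp_dist; exact: is_derive_profile.
Qed.

Lemma bmeas_cutoff2 a b : bmeas a b (fun y => cutoff2 d (dist x bs y)).
Proof.
apply: (@bmeas_comp_dist _ _ _ _ _ (fun t => - 4 * d ^- 2 * - (2 * (3 * d ^- 2) * t))) => t.
exact: (is_deriveZ (- 4 * d ^- 2) (is_derive_cutoff_base (3 * d ^- 2) t)).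
Qed.

Lemma bmeas_hres a b : bmeas a b (hres q k d x bs).
Proof.
apply: bmeas_restr; apply: bmeasM; first exact: bmeas_decay.
apply: bmeasB; last exact: bmeas_cutoff2.
have [bq _ _] := pq; apply: bmeasD.
  apply: bmeasM; first exact: bmeas_sub bq.
  by apply: bmeas_comp_dist; exact: is_derive_cutoff.
by apply: bmeasZ; apply: bmeas_comp_dist; exact: is_derive_cutoff1.
Qed.

Lemma oint_mul_restr u v : oint 0 l (fun y => u y * restr (hlo d x bs) (hhi d x bs) v y) =
  oint (hlo d x bs) (hhi d x bs) (fun y => u y * v y).
Proof.
rewrite -[RHS](@oint_restr _ 0 l)//; apply: eq_oint => y _.
by rewrite /restr; case: ifP => //; rewrite mulr0.
Qed.

(** Green's identity on the support.  At the far end both the kernel and its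
    slope vanish; at the pole they are 1 and - k in the direction of the
    support, which leaves the term k u(x) and the slope of u. *)
Lemma hker_identity la u u1 : solves l q la u u1 ->
  (la + k ^+ 2) * oint 0 l (fun y => u y * hker k d x bs y) =
  oint 0 l (fun y => u y * hres q k d x bs y) + (k * u x + sgnb bs * u1 x).
Proof.
move=> su; rewrite /hker /hres !oint_mul_restr.
pose w y := profile k d (dist x bs y).
pose w1 y := profile1 k d (dist x bs y) * sgnb bs.
pose w2 y := profile2 k d (dist x bs y).
have dw y : is_derive y 1 w (w1 y).
  by apply: is_derive_dist; exact: is_derive_profile.
have dw1 y : is_derive y 1 w1 (w2 y).
  have H := is_deriveZ (sgnb bs) (is_derive_dist (is_derive_profile1 k d (dist x bs y))).
  have -> : w1 = sgnb bs *: (fun z => profile1 k d (dist x bs z)).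
    by apply/funext => z; rewrite /w1 mulrC.
  apply: is_derive_eq H _; rewrite /GRing.scale/= mulrCA sgnb2 mulr1//.
have cw2 y : {for y, continuous w2}.
  apply: (@continuous_comp _ _ _ (dist x bs) (profile2 k d)); last exact: profile2_continuous.
  have := @is_derive_dist id 1 x bs y (is_derive_id _ _).
  exact: is_derive_continuous.
rewrite (green (k ^+ 2) pq su lo0 lohi hil dw dw1 cw2); congr (_ + _).
  apply: eq_oint => y _; congr (_ * _).
  by rewrite /w /w2 /profile /profile2; ring.
have dn0 : d != 0 by rewrite gt_eqF.
have p0 : profile k d 0 = 1.
  by rewrite /profile /decay /cutoff mulr0 expR0 expr0n/= mulr0 subr0 expr1n mulr1.
have p10 : profile1 k d 0 = - k.
  rewrite /profile1 /decay /cutoff1 /cutoff mulr0 expR0 expr0n/= !mulr0 subr0 expr1n.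
  by rewrite mul0r sub0r mulr1 mul1r.
have cd : 1 - d ^- 2 * d ^+ 2 = 0 by rewrite mulVf ?subrr// expf_neq0.
have pd : profile k d d = 0 by rewrite /profile /cutoff cd expr0n/= mulr0.
have p1d : profile1 k d d = 0.
  by rewrite /profile1 /cutoff1 /cutoff cd expr0n/= !mulr0 subr0 mulr0.
have e0 : dist x bs x = 0 by rewrite /dist subrr mulr0.
rewrite /w /w1 /hlo /hhi; case: bs e0 => e0; rewrite e0.
  have -> : dist x true (x - d) = d by rewrite /dist /sgnb; ring.
  by rewrite p0 p10 pd p1d /sgnb; ring.
have -> : dist x false (x + d) = d by rewrite /dist /sgnb; ring.
by rewrite p0 p10 pd p1d /sgnb; ring.
Qed.

Lemma restr_sqr a b v y : restr a b v y ^+ 2 = restr a b (fun z => v z ^+ 2) y.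
Proof. by rewrite /restr; case: ifP => //; rewrite expr0n. Qed.

Lemma oint_restr_sqr v : oint 0 l (fun y => restr (hlo d x bs) (hhi d x bs) v y ^+ 2) =
  oint (hlo d x bs) (hhi d x bs) (fun y => v y ^+ 2).
Proof.
by rewrite -[RHS](@oint_restr _ 0 l)//; apply: eq_oint => y _; rewrite restr_sqr.
Qed.

Lemma decay_sqr c t : decay c t ^+ 2 = decay (2 * c) t.
Proof. by rewrite /decay -expRM_natl; congr expR; ring. Qed.

Lemma cutoff_tau t : 0 < t < d -> 0 <= d ^- 2 * t ^+ 2 <= 1.
Proof.
move=> /andP[t0 td]; rewrite mulr_ge0 ?sqr_ge0 ?invr_ge0 ?sqr_ge0//=.
rewrite mulrC ler_pdivrMr ?exprn_gt0// mul1r lerXn2r ?nnegrE ?ltW//.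
Qed.

Lemma oint_hker_sqr_le : oint 0 l (fun y => hker k d x bs y ^+ 2) <= (2 * k)^-1.
Proof.
rewrite oint_restr_sqr; apply: (@le_trans _ _
   (oint (hlo d x bs) (hhi d x bs) (fun y => decay (2 * k) (dist x bs y)))).
  apply: le_oint; first by apply: bmeasX; apply: bmeas_comp_dist; exact: is_derive_profile.
    exact: bmeas_decay.
  move=> y /dist_itv /cutoff_tau; set t := dist x bs y => /andP[h0 h1].
  rewrite /profile exprMn decay_sqr -[leRHS]mulr1 ler_wpM2l ?expR_ge0//.
  rewrite /cutoff; set p := 1 - _; rewrite -exprM exprn_ile1 /p ?subr_ge0//; lra.
rewrite oint_decay ?mulr_gt0// ler_pdivrMr ?mulr_gt0// mulVf ?gt_eqF ?mulr_gt0//.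
by rewrite gerBl expR_ge0.
Qed.

Lemma expR_ge_sqr t : 0 <= t -> t ^+ 2 <= 2 * expR t.
Proof.
move=> t0; have := expR_ge1Dxn 1 t0; rewrite (_ : 2`!%:R = 2 :> R)//.
by move=> h; lra.
Qed.

Lemma decayD c c' t : decay (c + c') t = decay c t * decay c' t.
Proof. by rewrite /decay -expRD; congr expR; ring. Qed.

Lemma decay_sqr_bound t : 0 < t -> t ^+ 2 * decay (2 * k) t <= 2 / k ^+ 2 * decay k t.
Proof.
move=> t0; have kt : 0 <= k * t by rewrite mulr_ge0// ltW.
rewrite mulr_natl mulr2n decayD mulrA ler_wpM2r ?expR_ge0//.
have := expR_ge_sqr kt; rewrite exprMn => h.
rewrite ler_pdivlMr ?exprn_gt0//.
have -> : t ^+ 2 * decay k t * k ^+ 2 = (k ^+ 2 * t ^+ 2) * decay k t by ring.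
by rewrite /decay mulNr expRN ler_pdivrMr ?expR_gt0.
Qed.

(** The cut-off satisfies cutoff^2 >= 1 - 4 t^2 / d^2, and the loss
    t^2 exp (- 2 k t) is at most (2 / k^2) exp (- k t), which integrates to
    order k^-3. *)
Lemma oint_hker_sqr_ge :
  (2 * k)^-1 - ((4 * d)^-1 + 8 / d ^+ 2) / k ^+ 2 <= oint 0 l (fun y => hker k d x bs y ^+ 2).
Proof.
rewrite oint_restr_sqr; apply: (@le_trans _ _
   (oint (hlo d x bs) (hhi d x bs) (fun y => decay (2 * k) (dist x bs y) -
     8 / (d ^+ 2 * k ^+ 2) * decay k (dist x bs y)))); last first.
  apply: le_oint.
  - by apply: bmeasB; [exact: bmeas_decay|apply: bmeasZ; exact: bmeas_decay].
  - by apply: bmeasX; apply: bmeas_comp_dist; exact: is_derive_profile.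
  move=> y /dist_itv ty; have := cutoff_tau ty; have /andP[t0 _] := ty.
  have := decay_sqr_bound t0; set t := dist x bs y => hb.
  set p := _ * t ^+ 2 => /andP[p0 p1].
  rewrite /profile exprMn decay_sqr /cutoff -/p -exprM.
  have hp : 1 - 4 * p <= (1 - p) ^+ (2 * 2).
    rewrite -subr_ge0 (_ : _ - _ = p ^+ 2 * (6 - 4 * p + p ^+ 2)); last by ring.
    by rewrite mulr_ge0 ?sqr_ge0// addr_ge0 ?sqr_ge0//; lra.
  apply: (@le_trans _ _ (decay (2 * k) t * (1 - 4 * p))); last first.
    by rewrite ler_wpM2l ?expR_ge0.
  rewrite mulrBr mulr1 lerD2l lerN2.
  have -> : decay (2 * k) t * (4 * p) = 4 / d ^+ 2 * (t ^+ 2 * decay (2 * k) t).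
    by rewrite /p; ring.
  have -> : 8 / (d ^+ 2 * k ^+ 2) * decay k t = 4 / d ^+ 2 * (2 / k ^+ 2 * decay k t).
    by field; rewrite !gt_eqF.
  by rewrite ler_wpM2l// divr_ge0// sqr_ge0.
rewrite ointB; [|exact: bmeas_decay|by apply: bmeasZ; exact: bmeas_decay].
rewrite ointZ; last exact: bmeas_decay.
rewrite !oint_decay ?mulr_gt0//.
have h1 : decay (2 * k) d <= (2 * k * d)^-1.
  have kd : 0 < 2 * k * d by rewrite !mulr_gt0.
  rewrite /decay mulNr expRN lef_pV2 ?posrE ?expR_gt0//.
  by apply: le_trans (expR_ge1Dx _); rewrite lerDr.
have h2 : 0 <= decay k d by exact: expR_ge0.
have kk : (k ^+ 3)^-1 <= (k ^+ 2)^-1.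
  by rewrite lef_pV2 ?posrE ?exprn_gt0// ler_weXn2l.
have h3 : (1 - decay (2 * k) d) / (2 * k) >= (2 * k)^-1 - (4 * d)^-1 / k ^+ 2.
  have -> : (4 * d)^-1 / k ^+ 2 = (2 * k * d)^-1 / (2 * k).
    by field; rewrite !gt_eqF.
  rewrite -[X in X - _]mul1r -mulrBl ler_wpM2r ?invr_ge0 ?mulr_ge0 ?(ltW k0)//.
  by rewrite lerD2l lerN2.
have h4 : 8 / (d ^+ 2 * k ^+ 2) * ((1 - decay k d) / k) <= 8 / d ^+ 2 / k ^+ 2.
  have -> : 8 / (d ^+ 2 * k ^+ 2) * ((1 - decay k d) / k) =
      8 / d ^+ 2 * ((1 - decay k d) / k ^+ 3).
    by field; rewrite !gt_eqF.
  rewrite ler_wpM2l ?divr_ge0 ?sqr_ge0// -[leRHS]mul1r ler_pM//.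
  - rewrite subr_ge0 /decay -[leRHS]expR0 ler_expR mulNr oppr_le0.
    by rewrite mulr_ge0 ?ltW.
  - by rewrite invr_ge0 exprn_ge0// ltW.
  - by rewrite gerBl.
have -> : ((4 * d)^-1 + 8 / d ^+ 2) / k ^+ 2 = (4 * d)^-1 / k ^+ 2 + 8 / d ^+ 2 / k ^+ 2.
  by rewrite mulrDl.
by rewrite opprD addrA; exact: lerB h3 h4.
Qed.

(** The residual contains the large factor k only in the product
    k * cutoff1 t, and cutoff1 supplies a factor t; k t is absorbed by half of
    the exponential.  So the residual is at most a constant times
    exp (- k t / 2), whatever k is. *)
Lemma hres_bound : oint 0 l (fun y => hres q k d x bs y ^+ 2) <= (24 / d ^+ 2 + M) ^+ 2 / k.
Proof.
have [bq _ qM] := pq.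
set K := 24 / d ^+ 2 + M.
have bh := @bmeas_hres (hlo d x bs) (hhi d x bs).
have -> : oint 0 l (fun y => hres q k d x bs y ^+ 2) =
   oint (hlo d x bs) (hhi d x bs) (fun y => hres q k d x bs y ^+ 2).
  rewrite oint_restr_sqr; apply: eq_oint => y yy.
  by rewrite /hres /restr yy.
apply: (@le_trans _ _ (oint (hlo d x bs) (hhi d x bs) (fun y => K ^+ 2 * decay k (dist x bs y)))).
  apply: le_oint; [exact: bmeasX|by apply: bmeasZ; exact: bmeas_decay|].
  move=> y yy; rewrite /hres /restr yy; have ty := dist_itv yy.
  have := cutoff_tau ty; have /andP[t0 td] := ty; set t := dist x bs y in t0 td *.
  clearbody t; set p := _ * t ^+ 2 => /andP[p0 p1].
  have yl : 0 < y < l.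
    by case/andP: yy => h1 h2; rewrite (le_lt_trans lo0)//= (lt_le_trans h2).
  have qy := qM y yl.
  have hk : 2 * (k / 2) = k by rewrite mulrCA divff ?mulr1// pnatr_eq0.
  have -> : decay k t = decay (k / 2) t ^+ 2 by rewrite decay_sqr hk.
  rewrite -exprMn -ler_sqrt; last by rewrite sqr_ge0.
  rewrite !sqrtr_sqr; apply: le_trans (ler_norm _).
  set D := decay (k / 2) t; have D0 : 0 < D by exact: expR_gt0.
  rewrite expr2 -mulrA mulrC normrM (ger0_norm (ltW D0)) ler_wpM2r ?(ltW D0)//.
  have D1 : D <= 1.
    by rewrite /D /decay -expR0 ler_expR mulNr oppr_le0 mulr_ge0 ?divr_ge0 ?ltW.
  have Dkt : D * (k * t) <= 2.
    rewrite /D /decay mulNr expRN ler_pdivrMl ?expR_gt0//.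
    have := expR_ge1Dx (k / 2 * t) => h; lra.
  have c1 : `|cutoff d t| <= 1.
    by rewrite /cutoff -/p ger0_norm ?sqr_ge0// exprn_ile1 ?subr_ge0//; lra.
  have i0 : 0 < d ^- 2 by rewrite invr_gt0 exprn_gt0.
  have i0' := ltW i0; have t0' := ltW t0; have k0' := ltW k0.
  have c2 : `|cutoff1 d t| <= 4 * d ^- 2 * t.
    rewrite /cutoff1 -/p !mulNr normrN normrM ger0_norm; last by rewrite !mulr_ge0//.
    rewrite -[leRHS]mulr1 ler_wpM2l//; first by rewrite !mulr_ge0//.
    by rewrite ler_norml; apply/andP; split; lra.
  have c3 : `|cutoff2 d t| <= 8 * d ^- 2.
    have -> : cutoff2 d t = - (4 * d ^- 2) * (1 - 3 * p) by rewrite /cutoff2 /p; ring.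
    have -> : 8 * d ^- 2 = 4 * d ^- 2 * 2 by ring.
    have h4 : 0 <= 4 * d ^- 2 by rewrite mulr_ge0.
    rewrite normrM normrN (ger0_norm h4) ler_wpM2l//.
    by rewrite ler_norml; apply/andP; split; lra.
  have M0 : 0 <= M by apply: le_trans qy.
  have t1 : `|D * (q y * cutoff d t)| <= M.
    rewrite normrM (ger0_norm (ltW D0)) -[leRHS]mul1r ler_pM ?(ltW D0)//.
    by rewrite normrM -[leRHS]mulr1 ler_pM.
  have t2 : `|D * (2 * k * cutoff1 d t)| <= 16 / d ^+ 2.
    have h2k : 0 <= 2 * k by rewrite mulr_ge0.
    rewrite normrM (ger0_norm (ltW D0)) normrM (ger0_norm h2k).
    apply: (@le_trans _ _ (D * (2 * k * (4 * d ^- 2 * t)))).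
      by rewrite ler_wpM2l ?(ltW D0)// ler_wpM2l.
    have -> : D * (2 * k * (4 * d ^- 2 * t)) = 8 * d ^- 2 * (D * (k * t)) by ring.
    have -> : 16 / d ^+ 2 = 8 * d ^- 2 * 2 :> R by ring.
    by rewrite ler_wpM2l// mulr_ge0.
  have t3 : `|D * cutoff2 d t| <= 8 / d ^+ 2.
    by rewrite normrM (ger0_norm (ltW D0)) -[leRHS]mul1r ler_pM ?(ltW D0).
  have -> : D * (q y * cutoff d t + 2 * k * cutoff1 d t - cutoff2 d t) =
    D * (q y * cutoff d t) + D * (2 * k * cutoff1 d t) - D * cutoff2 d t by ring.
  apply: le_trans (ler_normB _ _) _; apply: le_trans (lerD (ler_normD _ _) (lexx _)) _.
  have -> : K = M + 16 / d ^+ 2 + 8 / d ^+ 2 by rewrite /K; field; rewrite gt_eqF.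
  by rewrite !lerD.
rewrite ointZ; last exact: bmeas_decay.
rewrite oint_decay//; rewrite mulrA ler_wpM2r ?invr_ge0 ?(ltW k0)//.
by rewrite -[leRHS]mulr1 ler_wpM2l ?sqr_ge0// gerBl expR_ge0.
Qed.

End Estimates.
End HalfKernel.

(** * Eigenfunctions are classical solutions *)

Section Regularity.
Variable R : realType.
Implicit Types (u q : R -> R) (l a b x M : R) (f : R -> R[i]).
Local Notation mu := (@lebesgue_measure R).
Local Open Scope complex_scope.

Lemma complex_ReM (z w : R[i]) :
  complex.Re (z * w) = complex.Re z * complex.Re w - complex.Im z * complex.Im w.
Proof. by case: z w => [? ?] [? ?]. Qed.

Lemma complex_ImM (z w : R[i]) :
  complex.Im (z * w) = complex.Re z * complex.Im w + complex.Im z * complex.Re w.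
Proof. by case: z w => [? ?] [? ?]. Qed.

Lemma complex_ReD (z w : R[i]) : complex.Re (z + w) = complex.Re z + complex.Re w.
Proof. by case: z w => [? ?] [? ?]. Qed.

Lemma complex_ImD (z w : R[i]) : complex.Im (z + w) = complex.Im z + complex.Im w.
Proof. by case: z w => [? ?] [? ?]. Qed.

Lemma complex_ReN (z : R[i]) : complex.Re (- z) = - complex.Re z.
Proof. by case: z. Qed.

Lemma complex_ImN (z : R[i]) : complex.Im (- z) = - complex.Im z.
Proof. by case: z. Qed.

Lemma complex_ReMr (z : R[i]) (r : R) : complex.Re (z * r%:C) = complex.Re z * r.
Proof. by rewrite complex_ReM /= mulr0 subr0. Qed.

Lemma complex_ImMr (z : R[i]) (r : R) : complex.Im (z * r%:C) = complex.Im z * r.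
Proof. by rewrite complex_ImM /= mulr0 add0r. Qed.

Lemma ae_weaken (P Q : R -> Prop) : (forall x, P x -> Q x) ->
  {ae mu, forall x, P x} -> {ae mu, forall x, Q x}.
Proof. by move=> PQ; apply: filterS; first exact: (ae_filter_ringOfSetsType mu). Qed.

(** A continuous function exceeding the essential bound at one point would do so
    on a whole interval, which is not negligible; so the bound holds at every
    point. *)
Lemma smooth_bounded_potential l q : smooth_bounded l q -> exists M, potential l M q.
Proof.
move=> [sq /andP[]]; rewrite !inE /= => mq fq.
have cq x : 0 < x < l -> {for x, continuous q}.
  rewrite -in_oo => xl; apply: differentiable_continuous.
  by apply/derivable1_diffP; exact: (sq 0).
have mq' : measurable_fun `]0, l[%classic q.
  by apply: open_continuous_measurable_fun => // x; rewrite inE in_oo => /cq.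
have [M M0 hM] : exists2 M, 0 <= M & {ae mu, forall x, `|(q \_ `]0, l[) x| <= M}.
  move: fq; rewrite /finite_norm unlock /Lnorm ifT; last first.
    have h01 : lebesgue_measure (`]0, 1[%classic : set R) = 1%E.
      by rewrite lebesgue_measure_itv/= lte_fin ltr01 oppr0 adde0.
    apply: (@lt_le_trans _ _ (lebesgue_measure (`]0, 1[%classic : set R))).
      by rewrite h01 lte_fin.
    by apply: le_measure; rewrite ?inE.
  set s := ess_sup _ _ => sfin.
  pose qr := q \_ `]0, l[.
  have hs : {ae mu, forall x, ((abse \o (EFin \o qr)) x <= s)%E} by exact: ess_sup_ge.
  move: sfin hs; case: s => [r| |] //.
  - move=> _ hs; exists `|r| => //; apply: ae_weaken hs => x /=.
    by rewrite lee_fin => /le_trans; apply; exact: ler_norm.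
  - by move=> _ hs; exists 0 => //; apply: ae_weaken hs => x /=.
have hq x : 0 < x < l -> `|q x| <= M.
  move=> xl; rewrite leNgt; apply/negP => Mq.
  have cn : {for x, continuous (fun y => `|q y|)} by apply: cvg_norm; exact: cq.
  have [e /= e0 he] : nbhs_ball x [set y | M < `|q y|].
    by have /= := cn _ (lt_nbhsr Mq); rewrite nbhs_ballE.
  have /andP[x0 xl'] := xl.
  pose d := Num.min e (Num.min x (l - x)).
  have d0 : 0 < d by rewrite !lt_min e0 x0 subr_gt0.
  have sub : `]x - d, x + d[%classic `<=` [set y | ~ `|(q \_ `]0, l[) y| <= M].
    move=> y; rewrite in_oo => /andP[y1 y2] /=.
    have := d0; rewrite /d !lt_min => /andP[_ /andP[_ _]].
    have de : d <= e by rewrite /d ge_min lexx.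
    have dx : d <= x by rewrite /d !ge_min lexx orbT.
    have dl : d <= l - x by rewrite /d !ge_min lexx !orbT.
    rewrite -restrE /restr ifT; last by apply/andP; split; lra.
    apply/negP; rewrite -ltNge; apply: he; rewrite /ball/= ltr_norml.
    by apply/andP; split; lra.
  have [N [mN N0 sN]] := hM.
  pose J : set R := `]x - d, x + d[%classic.
  have : (lebesgue_measure J <= lebesgue_measure N)%E.
    by apply: le_measure; rewrite ?inE; [exact: measurable_itv|exact: mN|exact: subset_trans sN].
  rewrite [X in (_ <= X)%E]N0 lebesgue_measure_itv/= lte_fin ifT; last by lra.
  by rewrite -EFinD lee_fin; lra.
exists M; split => //; exact: (bmeas_continuous cq hq).
Qed.

(** Adding a constant to the operator moves the spectrum and keeps the
    solutions; this is how all eigenvalues are made nonnegative. *)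
Lemma solves_shift l q (la c : R) u u1 : solves l q la u u1 ->
  solves l (fun x => q x - c) (la - c) u u1.
Proof.
move=> [cu cu1 du du1]; split => // x xl.
by rewrite (_ : q x - c - (la - c) = q x - la); [exact: du1 | ring].
Qed.

Lemma potential_shift l M q (c : R) : potential l M q ->
  potential l (M + `|c|) (fun x => q x - c).
Proof.
move=> [bq cq qM]; split.
- by apply: bmeasB => //; exact: bmeas_cst.
- by move=> x xl; apply: cvgB; [exact: cq|exact: cvg_cst].
- by move=> x xl; rewrite (le_trans (ler_normB _ _))// lerD2r qM.
Qed.

(** The second weak derivative may be replaced by the almost everywhere equal
    function (q - la) u, which is continuous in the open interval, so
    [weak_is_derive] applies to u and to u1. *)
Lemma weak_solves l M q (la : R) (u u1 u2 : R -> R) :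
  potential l M q ->
  (forall phi, test_function l phi ->
    oint 0 l (fun x => u x * derive1 phi x) = - oint 0 l (fun x => u1 x * phi x)) ->
  (forall phi, test_function l phi ->
    oint 0 l (fun x => u1 x * derive1 phi x) = - oint 0 l (fun x => u2 x * phi x)) ->
  {within `[0, l], continuous u} -> {within `[0, l], continuous u1} ->
  u2 \_ `]0, l[ \in Lfun mu 2%:E ->
  {ae mu, forall x, `]0, l[%classic x -> u2 x = (q x - la) * u x} ->
  solves l q la u u1.
Proof.
move=> [bq cq _] w1 w2 cu cu1 /andP[+ _] hu2; rewrite inE /= => mu2.
have bu := bmeas_within cu; have bu1 := bmeas_within cu1.
have inner (v : R -> R) : {within `[0, l], continuous v} -> forall x, 0 < x < l -> {for x, continuous v}.
  move=> cv x xl; have /andP[x0 xl'] := xl.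
  by apply: (within_continuous_continuous (lt_trans x0 xl') cv); rewrite in_itv.
have cux := inner _ cu; have cu1x := inner _ cu1.
split => //; first exact: (weak_is_derive w1).
apply: (@weak_is_derive _ l u1 (fun x => (q x - la) * u x)) => //.
- move=> phi tphi; rewrite w2//; congr (- _).
  have mphi : measurable_fun `]0, l[%classic phi.
    apply: open_continuous_measurable_fun => // x _.
    apply: differentiable_continuous; apply/derivable1_diffP.
    by have [sphi _] := tphi; exact: (sphi 0).
  rewrite /oint /Rintegral; congr fine; apply: ae_eq_integral => //.
  + apply/measurable_EFinP; apply: measurable_funM => //.
    by apply/(measurable_restrictT _ _).2.
  + apply/measurable_EFinP; apply: measurable_funM => //.
    apply: measurable_funM; last exact: bu.1.
    by apply: measurable_funB; [exact: bq.1 | exact: measurable_cst].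
  + by apply: ae_weaken hu2 => x /= + xl => ->.
- by apply: bmeasM => //; apply: bmeasB => //; exact: bmeas_cst.
- move=> x xl; apply: cvgM; last exact: cux.
  by apply: cvgB; [exact: cq|exact: cvg_cst].
Qed.

Lemma sobolev_solves l M q (la : R) f f1 f2 :
  potential l M q -> sobolev2 l f f1 f2 ->
  {ae mu, forall x, `]0, l[%classic x -> la%:C * f x = - f2 x + (q x)%:C * f x} ->
  solves l q la (fun x => complex.Re (f x)) (fun x => complex.Re (f1 x)) /\
  solves l q la (fun x => complex.Im (f x)) (fun x => complex.Im (f1 x)).
Proof.
move=> pq [[_ _ [L2r L2i]] w1 w2 [cr ci] [c1r c1i]] hf.
have wr (g h : R -> R[i]) (phi : R -> R) : cintegral l (fun x => g x * (derive1 phi x)%:C) =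
    - cintegral l (fun x => h x * (phi x)%:C) ->
    oint 0 l (fun x => complex.Re (g x) * derive1 phi x) =
    - oint 0 l (fun x => complex.Re (h x) * phi x).
  move=> /(congr1 (@complex.Re R)); rewrite complex_ReN /=.
  by under eq_Rintegral do rewrite complex_ReMr;
     under [in X in - X]eq_Rintegral do rewrite complex_ReMr.
have wi (g h : R -> R[i]) (phi : R -> R) : cintegral l (fun x => g x * (derive1 phi x)%:C) =
    - cintegral l (fun x => h x * (phi x)%:C) ->
    oint 0 l (fun x => complex.Im (g x) * derive1 phi x) =
    - oint 0 l (fun x => complex.Im (h x) * phi x).
  move=> /(congr1 (@complex.Im R)); rewrite complex_ImN /=.
  by under eq_Rintegral do rewrite complex_ImMr;
     under [in X in - X]eq_Rintegral do rewrite complex_ImMr.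
split.
- apply: (@weak_solves _ M _ _ _ _ (fun x => complex.Re (f2 x))) => //.
  + by move=> phi /w1/wr.
  + by move=> phi /w2/wr.
  + apply: ae_weaken hf => x hx /hx /(congr1 (@complex.Re R)).
    rewrite complex_ReD complex_ReN mulrC complex_ReMr mulrC [_%:C * _]mulrC complex_ReMr.
    by move=> e; lra.
- apply: (@weak_solves _ M _ _ _ _ (fun x => complex.Im (f2 x))) => //.
  + by move=> phi /w1/wi.
  + by move=> phi /w2/wi.
  + apply: ae_weaken hf => x hx /hx /(congr1 (@complex.Im R)).
    rewrite complex_ImD complex_ImN mulrC complex_ImMr mulrC [_%:C * _]mulrC complex_ImMr.
    by move=> e; lra.
Qed.

Lemma bmeas_Lfun2 l u : bmeas 0 l u -> u \_ `]0, l[ \in Lfun mu 2%:E.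
Proof.
move=> bu; have br : bmeas 0 l (fun x => u x ^+ 2) by exact: bmeasX.
apply/andP; split; rewrite inE /=.
  by apply/(measurable_restrictT _ _).1 => //; exact: bu.1.
rewrite /finite_norm unlock /Lnorm poweR_lty//.
have : mu.-integrable setT (EFin \o ((fun x => u x ^+ 2) \_ `]0, l[)).
  by rewrite -restrict_EFin -integrable_mkcond//; exact: bmeas_integrable.
move=> /integrableP[_]; apply: le_lt_trans; rewrite le_eqVlt; apply/orP; left; apply/eqP.
apply: eq_integral => x _ /=; rewrite /patch; case: ifP => _.
  by rewrite powR_mulrn// normrX.
by rewrite !normr0 powR0.
Qed.

End Regularity.

(** * Parseval's identity for real functions *)

Section Parseval.
Variables (R : realType) (G : metric_graph R).
Local Open Scope complex_scope.
Local Notation rfun := (edge G -> R -> R).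
Implicit Types (g h u v : rfun).

Definition gbmeas g : Prop := forall e, bmeas 0 (elen e) (g e).

Definition ginner g h : R := \sum_(e : edge G) oint 0 (elen e) (fun x => g e x * h e x).

Lemma ginnerC g h : ginner g h = ginner h g.
Proof. by apply: eq_bigr => e _; apply: eq_oint => x _; rewrite mulrC. Qed.

Lemma ginner_ge0 g : 0 <= ginner g g.
Proof. by apply: sumr_ge0 => e _; apply: oint_ge0 => x _; rewrite -expr2 sqr_ge0. Qed.

Lemma gbmeas_comb u g h (a b : R) : gbmeas u -> gbmeas g -> gbmeas h ->
  gbmeas (fun e x => u e x + a * g e x + b * h e x).
Proof.
move=> bu bg bh e; apply: bmeasD; last exact: bmeasZ.
by apply: bmeasD => //; exact: bmeasZ.
Qed.

Lemma ginner_comb u g h v (a b : R) : gbmeas u -> gbmeas g -> gbmeas h -> gbmeas v ->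
  ginner (fun e x => u e x + a * g e x + b * h e x) v =
  ginner u v + a * ginner g v + b * ginner h v.
Proof.
move=> bu bg bh bv; rewrite /ginner 2!mulr_sumr -2!big_split/=.
apply: eq_bigr => e _.
have b1 : bmeas 0 (elen e) (fun x => u e x * v e x) by exact: bmeasM.
have b2 : bmeas 0 (elen e) (fun x => g e x * v e x) by exact: bmeasM.
have b3 : bmeas 0 (elen e) (fun x => h e x * v e x) by exact: bmeasM.
rewrite -!ointZ// -!ointD//.
- by apply: eq_oint => x _; ring.
- by apply: bmeasD => //; exact: bmeasZ.
- exact: bmeasZ.
- exact: bmeasZ.
Qed.

Lemma ginner_comb2 u g h (a b : R) : gbmeas u -> gbmeas g -> gbmeas h ->
  ginner (fun e x => u e x + a * g e x + b * h e x) (fun e x => u e x + a * g e x + b * h e x) =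
  ginner u u + a ^+ 2 * ginner g g + b ^+ 2 * ginner h h +
  2 * a * ginner u g + 2 * b * ginner u h + 2 * a * b * ginner g h.
Proof.
move=> bu bg bh; pose w : rfun := fun e x => u e x + a * g e x + b * h e x.
have bw : gbmeas w by exact: gbmeas_comb.
rewrite -/w {1}/w ginner_comb//.
rewrite (ginnerC u w) (ginnerC g w) (ginnerC h w) {1 2 3}/w !ginner_comb//.
by rewrite (ginnerC g u) (ginnerC h u) (ginnerC h g); ring.
Qed.

Definition gre (f : gfun G) : rfun := fun e x => complex.Re (f e x).
Definition gim (f : gfun G) : rfun := fun e x => complex.Im (f e x).
Definition gC g : gfun G := fun e x => (g e x)%:C.

Lemma Re_sum (I : Type) (r : seq I) (F : I -> R[i]) :
  complex.Re (\sum_(i <- r) F i) = \sum_(i <- r) complex.Re (F i).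
Proof. by apply: (big_morph (@complex.Re R)) => //; exact: complex_ReD. Qed.

Lemma Im_sum (I : Type) (r : seq I) (F : I -> R[i]) :
  complex.Im (\sum_(i <- r) F i) = \sum_(i <- r) complex.Im (F i).
Proof. by apply: (big_morph (@complex.Im R)) => //; exact: complex_ImD. Qed.

Lemma complex_Re_conj (z : R[i]) : complex.Re (conjc z) = complex.Re z.
Proof. by case: z. Qed.

Lemma complex_Im_conj (z : R[i]) : complex.Im (conjc z) = - complex.Im z.
Proof. by case: z. Qed.

Lemma Re_inner (f k : gfun G) : gbmeas (gre f) -> gbmeas (gim f) ->
  gbmeas (gre k) -> gbmeas (gim k) ->
  complex.Re (inner f k) = ginner (gre f) (gre k) + ginner (gim f) (gim k).
Proof.
move=> b1 b2 b3 b4; rewrite /inner Re_sum /ginner -big_split/=.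
apply: eq_bigr => e _; rewrite -ointD; [|exact: bmeasM..].
apply: eq_oint => x _; rewrite complex_ReM complex_Re_conj complex_Im_conj.
by rewrite mulrN opprK.
Qed.

Lemma Im_inner (f k : gfun G) : gbmeas (gre f) -> gbmeas (gim f) ->
  gbmeas (gre k) -> gbmeas (gim k) ->
  complex.Im (inner f k) = ginner (gim f) (gre k) - ginner (gre f) (gim k).
Proof.
move=> b1 b2 b3 b4; rewrite /inner Im_sum /ginner -sumrB/=.
apply: eq_bigr => e _; rewrite -ointB; [|exact: bmeasM..].
apply: eq_oint => x _; rewrite complex_ImM complex_Re_conj complex_Im_conj.
by rewrite mulrN addrC.
Qed.

Lemma L2graph_gC g : gbmeas g -> L2graph (gC g).
Proof.
move=> bg e; split; first exact: bmeas_Lfun2.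
by apply: (@bmeas_Lfun2 _ _ (cst 0)); exact: bmeas_cst.
Qed.

Section Basis.
Variable f : nat -> gfun G.
Hypothesis hf : orthonormal_basis f.
Hypothesis br : forall n, gbmeas (gre (f n)).
Hypothesis bi : forall n, gbmeas (gim (f n)).

(** The Fourier coefficient <g, f n> of a real function g is
    coefr g n - i * coefi g n. *)
Definition coefr g n : R := ginner g (gre (f n)).
Definition coefi g n : R := ginner g (gim (f n)).

Lemma orthonormalr n m : ginner (gre (f n)) (gre (f m)) +
  ginner (gim (f n)) (gim (f m)) = (n == m)%:R.
Proof.
have [_ + _] := hf => /(_ n m)/(congr1 (@complex.Re R)).
by rewrite Re_inner// => ->; case: (n == m).
Qed.

Lemma orthonormali n m :
  ginner (gim (f n)) (gre (f m)) = ginner (gre (f n)) (gim (f m)).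
Proof.
have [_ + _] := hf => /(_ n m)/(congr1 (@complex.Im R)).
rewrite Im_inner// => e; apply/eqP; rewrite -subr_eq0 e.
by case: (n == m).
Qed.

(** Real and imaginary part of g minus its N-th Fourier sum
    ([rem_fourier]). *)
Fixpoint remr g N : rfun := if N is n.+1 then
  fun e x => remr g n e x + (- coefr g n) * gre (f n) e x + (- coefi g n) * gim (f n) e x
  else g.
Fixpoint remi g N : rfun := if N is n.+1 then
  fun e x => remi g n e x + (- coefr g n) * gim (f n) e x + coefi g n * gre (f n) e x
  else fun=> cst 0.

Lemma gbmeas_remr g N : gbmeas g -> gbmeas (remr g N).
Proof. by move=> bg; elim: N => //= n IH; exact: gbmeas_comb. Qed.

Lemma gbmeas_remi g N : gbmeas (remi g N).
Proof.
by elim: N => [e|/= n IH]; [exact: bmeas_cst|exact: gbmeas_comb].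
Qed.

Lemma ginner0 v : ginner (fun=> cst 0) v = 0.
Proof.
rewrite /ginner big1// => e _; rewrite -[RHS](oint0 0 (elen e)).
by apply: eq_oint => x _; rewrite mul0r.
Qed.

(** Subtracting the component along f n does not change the coefficients along
    the later basis functions. *)
Lemma rem_coef g N m : gbmeas g -> (N <= m)%N ->
  ginner (remr g N) (gre (f m)) + ginner (remi g N) (gim (f m)) = coefr g m /\
  ginner (remi g N) (gre (f m)) - ginner (remr g N) (gim (f m)) = - coefi g m.
Proof.
move=> bg; elim: N => [_|n IH nm].
  by rewrite /= !ginner0 addr0 sub0r.
have [IHr IHi] := IH (ltnW nm).
have bre := gbmeas_remr n bg; have bim := gbmeas_remi g n.
rewrite /= !ginner_comb//.
have := orthonormalr n m; rewrite ltn_eqF// => o1.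
have o2 := orthonormali n m.
set p := coefr g n; set r := coefi g n; split.
- rewrite -IHr -[RHS]addr0 -[X in _ = _ + X](mulr0 (- p)) -[X in _ = _ + _ * X]o1.
  by rewrite o2; ring.
- rewrite -IHi -[RHS]addr0 -[X in _ = _ + X](mulr0 r) -[X in _ = _ + _ * X]o1.
  by rewrite o2; ring.
Qed.

(** Each step removes the square of one coefficient (Pythagoras). *)
Lemma rem_norm g N : gbmeas g ->
  ginner (remr g N) (remr g N) + ginner (remi g N) (remi g N) =
  ginner g g - \sum_(n < N) (coefr g n ^+ 2 + coefi g n ^+ 2).
Proof.
move=> bg; elim: N => [|n IH]; first by rewrite /= big_ord0 ginner0 subr0 addr0.
have bre := gbmeas_remr n bg; have bim := gbmeas_remi g n.
have [cr ci] := rem_coef bg (leqnn n).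
rewrite big_ord_recr/= !ginner_comb2//.
have := orthonormalr n n; rewrite eqxx => o1.
rewrite (ginnerC (gim (f n)) (gre (f n))).
move: IH cr ci o1; set p := coefr g n; set r := coefi g n.
set X := ginner (remr g n) (remr g n); set Y := ginner (remi g n) (remi g n).
set A := ginner (gre (f n)) (gre (f n)); set B := ginner (gim (f n)) (gim (f n)).
set c1 := ginner (remr g n) (gre (f n)); set c2 := ginner (remi g n) (gim (f n)).
set c3 := ginner (remi g n) (gre (f n)); set c4 := ginner (remr g n) (gim (f n)).
move=> IH cr ci o1.
have -> : ginner g g = X + Y + \sum_(n0 < n) (coefr g n0 ^+ 2 + coefi g n0 ^+ 2).
  by rewrite IH; ring.
have -> : B = 1 - A by have : A + B = 1 := o1; lra.
have -> : c1 = p - c2 by lra.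
have -> : c3 = c4 - r by lra.
by ring.
Qed.

Lemma rem_fourier g N : gbmeas g ->
  (fun e x => gC g e x - \sum_(n < N) inner (gC g) (f n) * f n e x) =
  (fun e x => remr g N e x +i* remi g N e x).
Proof.
move=> bg; apply/funext => e; apply/funext => x.
have b0 : gbmeas (gim (gC g)) by move=> e'; exact: bmeas_cst.
have cE n : inner (gC g) (f n) = coefr g n -i* coefi g n.
  apply/eqP; rewrite eq_complex Re_inner// Im_inner//= !ginner0 addr0 sub0r.
  by rewrite !eqxx.
elim: N => [|n IH]; first by rewrite big_ord0 subr0.
rewrite big_ord_recr/= opprD addrA IH cE.
apply/eqP; rewrite eq_complex; apply/andP; split; apply/eqP => /=.
  by rewrite complex_ReD complex_ReN complex_ReM/= /gre /gim; ring.
by rewrite complex_ImD complex_ImN complex_ImM/= /gre /gim; ring.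
Qed.

Lemma parseval g : gbmeas g ->
  \sum_(n < N) (coefr g n ^+ 2 + coefi g n ^+ 2) @[N --> \oo] --> ginner g g.
Proof.
move=> bg; have [_ _ /(_ _ (L2graph_gC bg)) h] := hf.
have -> : (fun N => \sum_(n < N) (coefr g n ^+ 2 + coefi g n ^+ 2)) =
  (fun N => ginner g g - normsq (fun e x => gC g e x - \sum_(n < N) inner (gC g) (f n) * f n e x)).
  apply/funext => N; rewrite rem_fourier// /normsq Re_inner//=.
  - by rewrite -/(ginner _ _) rem_norm//; ring.
  - exact: gbmeas_remr.
  - exact: gbmeas_remi.
  - exact: gbmeas_remr.
  - exact: gbmeas_remi.
rewrite -[X in _ --> X]subr0; apply: cvgB; first exact: cvg_cst.
exact: h.
Qed.

Lemma bessel g N : gbmeas g ->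
  \sum_(n < N) (coefr g n ^+ 2 + coefi g n ^+ 2) <= ginner g g.
Proof.
move=> bg; rewrite -subr_ge0 -rem_norm//.
by rewrite addr_ge0// ginner_ge0.
Qed.

End Basis.
End Parseval.

(** * From approximate Green functions to resolvent sums *)

Section ResolventSums.
Variable R : realType.
Implicit Types (a la : nat -> R) (s : R).

Definition rsum a la s (N : nat) : R := \sum_(n < N) a n / (la n + s) ^+ 2.

Lemma rsum_nondecreasing a la s : (forall n, 0 <= a n) ->
  nondecreasing_seq (rsum a la s).
Proof.
move=> a0; apply/nondecreasing_seqP => N; rewrite /rsum big_ord_recr/= lerDl.
by rewrite divr_ge0// sqr_ge0.
Qed.

Lemma rsum_cvg a la s (C : R) : (forall n, 0 <= a n) ->
  (forall N, rsum a la s N <= C) -> cvgn (rsum a la s).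
Proof.
move=> a0 aC; apply: nondecreasing_is_cvgn; first exact: rsum_nondecreasing.
by exists C => _ [N _ <-].
Qed.

Lemma rsum_lim_le a la s (C : R) : (forall n, 0 <= a n) ->
  (forall N, rsum a la s N <= C) -> limn (rsum a la s) <= C.
Proof.
move=> a0 aC; apply: limr_le; first exact: rsum_cvg aC.
exact: nearW.
Qed.

Lemma young (h x y : R) : 0 < h -> (x - y) ^+ 2 <= (1 + h) * x ^+ 2 + (1 + h^-1) * y ^+ 2.
Proof.
move=> h0; rewrite -subr_ge0.
have -> : (1 + h) * x ^+ 2 + (1 + h^-1) * y ^+ 2 - (x - y) ^+ 2 = h^-1 * (h * x + y) ^+ 2.
  by field; rewrite gt_eqF.
by rewrite mulr_ge0 ?sqr_ge0// invr_ge0 ltW.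
Qed.

End ResolventSums.

Section LocalLaw.
Variables (R : realType) (G : metric_graph R).
Variables (f f1 : nat -> gfun G) (la : nat -> R) (q : edge G -> R -> R) (M : R).
Hypothesis hf : orthonormal_basis f.
Hypothesis la0 : forall n, 0 <= la n.
Hypothesis pq : forall e, potential (elen e) M (q e).
Hypothesis sr : forall n e, solves (elen e) (q e) (la n) (gre (f n) e) (gre (f1 n) e).
Hypothesis si : forall n e, solves (elen e) (q e) (la n) (gim (f n) e) (gim (f1 n) e).
Implicit Types (Psi Rho : edge G -> R -> R) (k s h d x : R).

Lemma gbmeas_fr n : gbmeas (gre (f n)).
Proof. by move=> e; have [c _ _ _] := sr n e; exact: bmeas_within. Qed.

Lemma gbmeas_fi n : gbmeas (gim (f n)).
Proof. by move=> e; have [c _ _ _] := si n e; exact: bmeas_within. Qed.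

(** Psi is an approximate Green function with residual Rho for the functional
    whose values on the n-th eigenfunction are Ar n + i * Ai n. *)
Section QuasiResolvent.
Variables (Psi Rho : edge G -> R -> R) (s : R) (Ar Ai : nat -> R).
Hypotheses (bP : gbmeas Psi) (bR : gbmeas Rho) (s0 : 0 < s).
Hypothesis hAr : forall n, Ar n = (la n + s) * coefr f Psi n - coefr f Rho n.
Hypothesis hAi : forall n, Ai n = (la n + s) * coefi f Psi n - coefi f Rho n.

Let D0 n : la n + s != 0. Proof. by rewrite gt_eqF// ltr_wpDl. Qed.

Let ts n (x : R) : x ^+ 2 / (la n + s) ^+ 2 <= x ^+ 2 / s ^+ 2.
Proof.
rewrite ler_wpM2l ?sqr_ge0// lef_pV2 ?posrE ?exprn_gt0 ?ltr_wpDl//.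
by rewrite lerXn2r ?nnegrE ?lerDr// ltW// ltr_wpDl.
Qed.

(** After division by la n + s the hypothesis reads
    <f n, Psi> = A n / (la n + s) + <f n, Rho> / (la n + s), where the last
    factor 1 / (la n + s) is at most 1 / s.  The inequality [young] separates the
    two terms and Bessel's inequality bounds their sums. *)
Lemma l2_upper h N : 0 < h ->
  rsum (fun n => Ar n ^+ 2 + Ai n ^+ 2) la s N <=
  (1 + h) * ginner Psi Psi + (1 + h^-1) * (ginner Rho Rho / s ^+ 2).
Proof.
move=> h0.
have h1 : 0 <= 1 + h by rewrite addr_ge0// ltW.
have h2 : 0 <= 1 + h^-1 by rewrite addr_ge0// invr_ge0 ltW.
have s2 : 0 <= s ^- 2 by rewrite invr_ge0 sqr_ge0.
apply: (@le_trans _ _ ((1 + h) * (\sum_(n < N) (coefr f Psi n ^+ 2 + coefi f Psi n ^+ 2)) +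
  (1 + h^-1) * ((\sum_(n < N) (coefr f Rho n ^+ 2 + coefi f Rho n ^+ 2)) / s ^+ 2))); last first.
  apply: lerD; rewrite ler_wpM2l//; first by apply: bessel => //; [exact: gbmeas_fr|exact: gbmeas_fi].
  by rewrite ler_wpM2r//; apply: bessel => //; [exact: gbmeas_fr|exact: gbmeas_fi].
rewrite mulr_suml 2!mulr_sumr -big_split/= /rsum; apply: ler_sum => n _.
have t p r : ((la n + s) * p - r) ^+ 2 / (la n + s) ^+ 2 <=
    (1 + h) * p ^+ 2 + (1 + h^-1) * (r ^+ 2 / s ^+ 2).
  have -> : ((la n + s) * p - r) ^+ 2 / (la n + s) ^+ 2 = (p - r / (la n + s)) ^+ 2.
    by field.
  apply: le_trans (young _ _ h0) _; rewrite lerD2l ler_wpM2l//.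
  by rewrite expr_div_n ts.
rewrite hAr hAi mulrDl; apply: le_trans (lerD (t _ _) (t _ _)) _.
by rewrite le_eqVlt; apply/orP; left; apply/eqP; ring.
Qed.

Lemma l2_cvg : cvgn (rsum (fun n => Ar n ^+ 2 + Ai n ^+ 2) la s).
Proof.
apply: rsum_cvg; first by move=> n; rewrite addr_ge0 ?sqr_ge0.
by move=> N; exact: (l2_upper N ltr01).
Qed.

(** The converse of [l2_upper], with Parseval's identity for Psi in place of
    Bessel's inequality. *)
Lemma l2_lower h : 0 < h ->
  ginner Psi Psi <= (1 + h) * limn (rsum (fun n => Ar n ^+ 2 + Ai n ^+ 2) la s) +
   (1 + h^-1) * (ginner Rho Rho / s ^+ 2).
Proof.
move=> h0.
have h1 : 0 <= 1 + h by rewrite addr_ge0// ltW.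
have h2 : 0 <= 1 + h^-1 by rewrite addr_ge0// invr_ge0 ltW.
have s2 : 0 <= s ^- 2 by rewrite invr_ge0 sqr_ge0.
have P := parseval hf gbmeas_fr gbmeas_fi bP.
rewrite -(cvg_lim (@Rhausdorff R) P); apply: limr_le; first by apply/cvg_ex; exists (ginner Psi Psi).
apply: nearW => N.
apply: (@le_trans _ _ ((1 + h) * rsum (fun n => Ar n ^+ 2 + Ai n ^+ 2) la s N +
  (1 + h^-1) * ((\sum_(n < N) (coefr f Rho n ^+ 2 + coefi f Rho n ^+ 2)) / s ^+ 2))); last first.
  apply: lerD; rewrite ler_wpM2l//.
    apply: nondecreasing_cvgn_le; last exact: l2_cvg.
    by apply: rsum_nondecreasing => n; rewrite addr_ge0 ?sqr_ge0.
  by rewrite ler_wpM2r//; apply: bessel => //; [exact: gbmeas_fr|exact: gbmeas_fi].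
rewrite mulr_suml 2!mulr_sumr -big_split/=; apply: ler_sum => n _.
have t p r : p ^+ 2 <= (1 + h) * (((la n + s) * p - r) ^+ 2 / (la n + s) ^+ 2) +
   (1 + h^-1) * (r ^+ 2 / s ^+ 2).
  have -> : ((la n + s) * p - r) ^+ 2 / (la n + s) ^+ 2 = (p - r / (la n + s)) ^+ 2.
    by field.
  have {1}-> : p = (p - r / (la n + s)) - (- (r / (la n + s))) by ring.
  apply: le_trans (young _ _ h0) _; rewrite lerD2l ler_wpM2l//.
  by rewrite sqrrN expr_div_n ts.
rewrite hAr hAi; apply: le_trans (lerD (t _ (coefr f Rho n)) (t _ (coefi f Rho n))) _.
by rewrite le_eqVlt; apply/orP; left; apply/eqP; rewrite !mulrDl; ring.
Qed.

End QuasiResolvent.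

(** Several half kernels with disjoint supports are superposed.  Disjointness
    makes the squared norms add up, and both the interior points (two kernels)
    and the vertices (one kernel for each edge end) are instances. *)
Section Family.
Variables (I : finType) (he : I -> edge G) (hb : I -> bool) (hx : I -> R) (d : R).
Hypothesis d0 : 0 < d.
Hypothesis lo0 : forall i, 0 <= hlo d (hx i) (hb i).
Hypothesis hil : forall i, hhi d (hx i) (hb i) <= elen (he i).
Hypothesis disj : forall i j y, i != j -> he i = he j ->
  hlo d (hx i) (hb i) < y < hhi d (hx i) (hb i) ->
  hlo d (hx j) (hb j) < y < hhi d (hx j) (hb j) -> False.

Definition fam (w : I -> R -> R) : edge G -> R -> R :=
  fun e y => \sum_(i : I) (if he i == e then w i y else 0).

Lemma gbmeas_fam w : (forall i, bmeas 0 (elen (he i)) (w i)) -> gbmeas (fam w).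
Proof.
move=> bw e; apply: (@bmeas_sum _ _ _ (fun i y => if he i == e then w i y else 0)) => i.
case: eqP => [<-|_]; [exact: bw | exact: bmeas_cst].
Qed.

Lemma ginner_fam w (g : edge G -> R -> R) :
  (forall i, bmeas 0 (elen (he i)) (w i)) -> gbmeas g ->
  ginner (fam w) g = \sum_(i : I) oint 0 (elen (he i)) (fun y => g (he i) y * w i y).
Proof.
move=> bw bg.
transitivity (\sum_(e : edge G) \sum_(i : I)
   (if he i == e then oint 0 (elen (he i)) (fun y => g (he i) y * w i y) else 0)).
  apply: eq_bigr => e _.
  transitivity (oint 0 (elen e) (fun y => \sum_(i : I) (if he i == e then g e y * w i y else 0))).
    apply: eq_oint => y _; rewrite /fam mulr_suml; apply: eq_bigr => i _.
    by case: ifP => _; rewrite ?mul0r// mulrC.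
  rewrite (@oint_sum _ _ _ (fun i y => if he i == e then g e y * w i y else 0)).
    by apply: eq_bigr => i _; case: eqP => [<-//|_]; exact: oint0.
  by move=> i; case: eqP => [<-|_]; [exact: bmeasM | exact: bmeas_cst].
rewrite exchange_big/=; apply: eq_bigr => i _.
rewrite (bigD1 (he i))//= eqxx big1 ?addr0// => e ne.
by rewrite eq_sym (negbTE ne).
Qed.

Lemma ginner_fam_diag (v : I -> R -> R) :
  (forall i, bmeas (hlo d (hx i) (hb i)) (hhi d (hx i) (hb i)) (v i)) ->
  let w i := restr (hlo d (hx i) (hb i)) (hhi d (hx i) (hb i)) (v i) in
  ginner (fam w) (fam w) = \sum_(i : I) oint 0 (elen (he i)) (fun y => w i y ^+ 2).
Proof.
move=> bv w; have bw i a b : bmeas a b (w i) by exact: bmeas_restr.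
rewrite ginner_fam//; last exact: gbmeas_fam.
apply: eq_bigr => i _; apply: eq_oint => y _.
rewrite /fam (bigD1 i)//= eqxx mulrDl -expr2 mulr_suml big1 ?addr0// => j ji.
case: eqP => [eji|_]; last by rewrite mul0r.
rewrite /w /restr; case: ifP => [yj|_]; last by rewrite mul0r.
case: ifP => [yi|_]; last by rewrite mulr0.
by case: (disj ji eji yj yi).
Qed.

Definition kernel_sum k : edge G -> R -> R := fam (fun i => hker k d (hx i) (hb i)).
Definition residual_sum k : edge G -> R -> R := fam (fun i => hres (q (he i)) k d (hx i) (hb i)).

Lemma gbmeas_kernel_sum k : gbmeas (kernel_sum k).
Proof. by apply: gbmeas_fam => i; exact: bmeas_hker. Qed.

Lemma bmeas_fam_hres k i a b : bmeas a b (hres (q (he i)) k d (hx i) (hb i)).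
Proof. exact: (bmeas_hres _ (lo0 i) (hil i) (pq (he i))). Qed.

Lemma gbmeas_residual_sum k : gbmeas (residual_sum k).
Proof. by apply: gbmeas_fam => i; exact: bmeas_fam_hres. Qed.

(** The functional that the superposed kernels represent. *)
Definition kvalue k (g g1 : edge G -> R -> R) : R :=
  \sum_(i : I) (k * g (he i) (hx i) + sgnb R (hb i) * g1 (he i) (hx i)).

Lemma fam_identity k (l : R) (g g1 : edge G -> R -> R) : gbmeas g ->
  (forall e, solves (elen e) (q e) l (g e) (g1 e)) ->
  kvalue k g g1 = (l + k ^+ 2) * ginner (kernel_sum k) g - ginner (residual_sum k) g.
Proof.
move=> bg sg; rewrite ginner_fam//; last by move=> i; exact: bmeas_hker.
rewrite ginner_fam//; last by move=> i; exact: bmeas_fam_hres.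
rewrite mulr_sumr -sumrB/=; apply: eq_bigr => i _.
rewrite (hker_identity _ d0 (lo0 i) (hil i) (pq (he i)) (sg (he i))).
by ring.
Qed.

Let Kc : R := (24 / d ^+ 2 + M) ^+ 2.
Let Kd : R := (4 * d)^-1 + 8 / d ^+ 2.

Lemma kernel_sum_norm_le k : 1 <= k -> ginner (kernel_sum k) (kernel_sum k) <= #|I|%:R * (2 * k)^-1.
Proof.
move=> k1; rewrite /kernel_sum ginner_fam_diag => [|i].
  rewrite -sum1_card natr_sum mulr_suml; apply: ler_sum => i _; rewrite mul1r.
  exact: oint_hker_sqr_le.
by apply: bmeas_comp_dist; exact: is_derive_profile.
Qed.

Lemma kernel_sum_norm_ge k : 1 <= k -> #|I|%:R * ((2 * k)^-1 - Kd / k ^+ 2) <= ginner (kernel_sum k) (kernel_sum k).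
Proof.
move=> k1; rewrite /kernel_sum ginner_fam_diag => [|i].
  rewrite -sum1_card natr_sum mulr_suml; apply: ler_sum => i _; rewrite mul1r.
  exact: oint_hker_sqr_ge.
by apply: bmeas_comp_dist; exact: is_derive_profile.
Qed.

Lemma residual_sum_norm_le k : 1 <= k -> ginner (residual_sum k) (residual_sum k) <= #|I|%:R * (Kc / k).
Proof.
move=> k1; rewrite /residual_sum ginner_fam_diag => [|i].
  rewrite -sum1_card natr_sum mulr_suml; apply: ler_sum => i _; rewrite mul1r.
  exact: hres_bound.
have [bq _ _] := pq (he i); apply: bmeasM; first exact: bmeas_decay.
apply: bmeasB; last exact: bmeas_cutoff2.
apply: bmeasD.
  apply: bmeasM; first exact: bmeas_sub bq.
  by apply: bmeas_comp_dist; exact: is_derive_cutoff.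
by apply: bmeasZ; apply: bmeas_comp_dist; exact: is_derive_cutoff1.
Qed.

Definition kvalue2 k n : R :=
  kvalue k (gre (f n)) (gre (f1 n)) ^+ 2 + kvalue k (gim (f n)) (gim (f1 n)) ^+ 2.

Let Cl : R := Kd + 2 * Kc + 1.

(** The squared norm of the kernels is about #|I| / (2 k), and that of the
    residual divided by k^4 is of order k^-5.  In [l2_upper] and [l2_lower] the
    choice h = 1/k makes both errors at most of order k^-2. *)
Lemma local_law k : 1 <= k ->
  [/\ cvgn (rsum (kvalue2 k) la (k ^+ 2)),
      limn (rsum (kvalue2 k) la (k ^+ 2)) <= #|I|%:R * ((2 * k)^-1 + Cl / k ^+ 2) &
      #|I|%:R * ((2 * k)^-1 - Cl / k ^+ 2) <= limn (rsum (kvalue2 k) la (k ^+ 2))].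
Proof.
move=> k1; have k0 : 0 < k by exact: lt_le_trans k1.
have s0 : 0 < k ^+ 2 by rewrite exprn_gt0.
have hr n := fam_identity k (gbmeas_fr n) (sr n).
have hi n := fam_identity k (gbmeas_fi n) (si n).
have bP := gbmeas_kernel_sum k; have bR := gbmeas_residual_sum k.
have h0 : 0 < k^-1 by rewrite invr_gt0.
have Kc0 : 0 <= Kc by exact: sqr_ge0.
have d0' := ltW d0.
have Kd0 : 0 <= Kd.
  by rewrite /Kd addr_ge0 ?divr_ge0 ?sqr_ge0// invr_ge0 mulr_ge0.
have I0 : 0 <= #|I|%:R :> R by [].
have rn : ginner (residual_sum k) (residual_sum k) / (k ^+ 2) ^+ 2 <= #|I|%:R * (Kc / k ^+ 5).
  have -> : #|I|%:R * (Kc / k ^+ 5) = #|I|%:R * (Kc / k) / (k ^+ 2) ^+ 2.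
    by field; rewrite gt_eqF.
  by rewrite ler_wpM2r ?invr_ge0 ?sqr_ge0//; exact: residual_sum_norm_le.
have E : (1 + (k^-1)^-1) * (#|I|%:R * (Kc / k ^+ 5)) <= #|I|%:R * (2 * Kc / k ^+ 2).
  rewrite invrK mulrCA ler_wpM2l//.
  have -> : (1 + k) * (Kc / k ^+ 5) = Kc / k ^+ 2 * ((1 + k) / k ^+ 3).
    by field; rewrite gt_eqF.
  have -> : 2 * Kc / k ^+ 2 = Kc / k ^+ 2 * 2 by field; rewrite gt_eqF.
  rewrite ler_wpM2l ?divr_ge0 ?sqr_ge0// ler_pdivrMr ?exprn_gt0//.
  have k3 : 1 <= k ^+ 3 by rewrite exprn_ege1.
  have k3' : k <= k ^+ 3 by rewrite -{1}(expr1 k) ler_weXn2l.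
  lra.
have kk0 : 0 <= 1 + (k^-1)^-1 by rewrite invrK addr_ge0// ltW.
have E' := le_trans (ler_wpM2l kk0 rn) E.
split.
- exact: (l2_cvg bP bR s0 hr hi).
- apply: rsum_lim_le; first by move=> n; rewrite addr_ge0 ?sqr_ge0.
  move=> N; apply: le_trans (l2_upper bP bR s0 hr hi N h0) _.
  have kk1 : 0 <= 1 + k^-1 by rewrite addr_ge0// ltW.
  apply: le_trans (lerD (ler_wpM2l kk1 (kernel_sum_norm_le k1)) E') _.
  rewrite -subr_ge0.
  have -> : #|I|%:R * ((2 * k)^-1 + Cl / k ^+ 2) -
     ((1 + k^-1) * (#|I|%:R / (2 * k)) + #|I|%:R * (2 * Kc / k ^+ 2)) =
     #|I|%:R * ((Kd + 1 / 2) / k ^+ 2) by rewrite /Cl; field; rewrite gt_eqF.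
  by rewrite mulr_ge0// divr_ge0 ?sqr_ge0// addr_ge0.
- have L := l2_lower bP bR s0 hr hi h0.
  have := le_trans (kernel_sum_norm_ge k1) (le_trans L (lerD (lexx _) E')).
  set X := limn _ => H.
  rewrite leNgt; apply/negP => XX.
  have : (1 + k^-1) * X < (1 + k^-1) * (#|I|%:R * ((2 * k)^-1 - Cl / k ^+ 2)).
    by rewrite ltr_pM2l// addr_gt0.
  suff : (1 + k^-1) * (#|I|%:R * ((2 * k)^-1 - Cl / k ^+ 2)) <=
    #|I|%:R * ((2 * k)^-1 - Kd / k ^+ 2) - #|I|%:R * (2 * Kc / k ^+ 2) by move: H; lra.
  rewrite -subr_ge0.
  have -> : #|I|%:R * ((2 * k)^-1 - Kd / k ^+ 2) - #|I|%:R * (2 * Kc / k ^+ 2) -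
    (1 + k^-1) * (#|I|%:R * ((2 * k)^-1 - Cl / k ^+ 2)) =
    #|I|%:R * ((1 / 2 + Cl / k) / k ^+ 2) by rewrite /Cl; field; rewrite gt_eqF.
  have Cl0 : 0 <= Cl by rewrite /Cl addr_ge0// addr_ge0// mulr_ge0.
  have k0' := ltW k0; have Clk : 0 <= Cl / k by rewrite divr_ge0.
  by rewrite mulr_ge0// divr_ge0 ?sqr_ge0// addr_ge0.
Qed.

End Family.
End LocalLaw.

(** * Resolvent sums at points of the edges *)

Section PointwiseLaws.
Variables (R : realType) (G : metric_graph R).
Variables (f f1 : nat -> gfun G) (la : nat -> R) (q : edge G -> R -> R) (M : R).
Hypothesis hf : orthonormal_basis f.
Hypothesis la0 : forall n, 0 <= la n.
Hypothesis pq : forall e, potential (elen e) M (q e).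
Hypothesis sr : forall n e, solves (elen e) (q e) (la n) (gre (f n) e) (gre (f1 n) e).
Hypothesis si : forall n e, solves (elen e) (q e) (la n) (gim (f n) e) (gim (f1 n) e).
Implicit Types (k d x : R) (e : edge G).

Lemma rsumZ (a l : nat -> R) (c s : R) N :
  rsum (fun n => c * a n) l s N = c * rsum a l s N.
Proof. by rewrite /rsum mulr_sumr; apply: eq_bigr => n _; rewrite mulrA. Qed.

Lemma rsumZ_cvg (a l : nat -> R) (c s : R) : c != 0 ->
  cvgn (rsum (fun n => c * a n) l s) ->
  cvgn (rsum a l s) /\ limn (rsum (fun n => c * a n) l s) = c * limn (rsum a l s).
Proof.
move=> c0 cv; have e : rsum a l s = (fun N => c^-1 * rsum (fun n => c * a n) l s N).
  by apply/funext => N; rewrite rsumZ mulKf.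
have cv' : rsum a l s @ \oo --> c^-1 * limn (rsum (fun n => c * a n) l s).
  by rewrite {1}e; apply: cvgMl_tmp.
split; first by apply/cvg_ex; eexists; exact: cv'.
by rewrite (cvg_lim (@Rhausdorff R) cv') mulVKf.
Qed.

Definition dens n e x : R := gre (f n) e x ^+ 2 + gim (f n) e x ^+ 2.

Lemma dens_ge0 n e x : 0 <= dens n e x.
Proof. by rewrite addr_ge0 ?sqr_ge0. Qed.

Definition residual_const d : R := (24 / d ^+ 2 + M) ^+ 2.
Definition law_const d : R := (4 * d)^-1 + 8 / d ^+ 2 + 2 * residual_const d + 1.

Lemma law_const_ge0 d : 0 < d -> 0 <= law_const d.
Proof.
move=> d0; have h1 : 0 <= (4 * d)^-1 by rewrite invr_ge0 mulr_ge0// ltW.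
have h2 : 0 <= 8 / d ^+ 2 by rewrite divr_ge0 ?sqr_ge0.
have h3 : 0 <= 2 * residual_const d by rewrite mulr_ge0 ?sqr_ge0.
by rewrite /law_const; lra.
Qed.

(** Two half kernels back to back: the slopes cancel and the functional is
    2 k u(x), so 4 k^2 times the resolvent sum is about 2 / (2 k). *)
Lemma interior_law d e x k : 0 < d -> 0 <= x - d -> x + d <= elen e -> 1 <= k ->
  [/\ cvgn (rsum (fun n => dens n e x) la (k ^+ 2)),
      k ^+ 3 * limn (rsum (fun n => dens n e x) la (k ^+ 2)) <= 1 / 4 + law_const d / k &
      1 / 4 - law_const d / k <= k ^+ 3 * limn (rsum (fun n => dens n e x) la (k ^+ 2))].
Proof.
move=> d0 xd dx k1; have k0 : 0 < k by exact: lt_le_trans k1.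
pose he (b : bool) := e; pose hx (b : bool) := x.
have lo0 b : 0 <= hlo d (hx b) (idfun b) by rewrite /hlo; case: b => //=; rewrite /hx; lra.
have hil b : hhi d (hx b) (idfun b) <= elen (he b) by rewrite /hhi; case: b => //=; rewrite /hx /he; lra.
have disj i j y : i != j -> he i = he j -> hlo d (hx i) (idfun i) < y < hhi d (hx i) (idfun i) ->
    hlo d (hx j) (idfun j) < y < hhi d (hx j) (idfun j) -> False.
  by rewrite /hlo /hhi /hx; case: i; case: j => //= _ _ /andP[? ?] /andP[? ?]; lra.
have [cv up lo] := local_law hf la0 pq sr si d0 lo0 hil disj k1.
have kv n : kvalue2 f f1 he idfun hx k n = (4 * k ^+ 2) * dens n e x.
  by rewrite /kvalue2 /kvalue !big_bool /= /sgnb /he /hx /dens; ring.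
have eq : kvalue2 f f1 he idfun hx k = fun n => (4 * k ^+ 2) * dens n e x.
  by apply/funext.
rewrite eq card_bool in cv up lo.
have c0 : 4 * k ^+ 2 != 0 by rewrite mulf_neq0// expf_neq0// gt_eqF.
have [cv' E] := rsumZ_cvg c0 cv.
split => //; rewrite E in up lo; move: up lo; set L := limn _ => up lo.
- have := ler_wpM2r (ltW k0) up; rewrite -/(residual_const d) -/(law_const d).
  have -> : 2 * ((2 * k)^-1 + law_const d / k ^+ 2) * k = 1 + 2 * (law_const d / k).
    by field; rewrite gt_eqF.
  have -> : 4 * k ^+ 2 * L * k = 4 * (k ^+ 3 * L) by ring.
  have : 0 <= law_const d / k by rewrite divr_ge0 ?law_const_ge0// ltW.
  by lra.
- have := ler_wpM2r (ltW k0) lo; rewrite -/(residual_const d) -/(law_const d).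
  have -> : 2 * ((2 * k)^-1 - law_const d / k ^+ 2) * k = 1 - 2 * (law_const d / k).
    by field; rewrite gt_eqF.
  have -> : 4 * k ^+ 2 * L * k = 4 * (k ^+ 3 * L) by ring.
  have : 0 <= law_const d / k by rewrite divr_ge0 ?law_const_ge0// ltW.
  by lra.
Qed.

Lemma ginner_comb_le (u g h : edge G -> R -> R) (a b : R) :
  gbmeas u -> gbmeas g -> gbmeas h ->
  ginner (fun e x => u e x + a * g e x + b * h e x) (fun e x => u e x + a * g e x + b * h e x) <=
  3 * (ginner u u + a ^+ 2 * ginner g g + b ^+ 2 * ginner h h).
Proof.
move=> bu bg bh.
have b1 : gbmeas (fun e x => u e x * u e x) by move=> e; exact: bmeasM.
have b2 : gbmeas (fun e x => g e x * g e x) by move=> e; exact: bmeasM.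
have b3 : gbmeas (fun e x => h e x * h e x) by move=> e; exact: bmeasM.
have bc : gbmeas (fun e x => u e x + a * g e x + b * h e x) by exact: gbmeas_comb.
rewrite /ginner 2!mulr_sumr -2!big_split/= mulr_sumr; apply: ler_sum => e _.
have b2' : bmeas 0 (elen e) (fun x => a ^+ 2 * (g e x * g e x)) by exact: bmeasZ.
have b3' : bmeas 0 (elen e) (fun x => b ^+ 2 * (h e x * h e x)) by exact: bmeasZ.
have b12 : bmeas 0 (elen e) (fun x => u e x * u e x + a ^+ 2 * (g e x * g e x)).
  exact: bmeasD.
have b123 : bmeas 0 (elen e)
    (fun x => u e x * u e x + a ^+ 2 * (g e x * g e x) + b ^+ 2 * (h e x * h e x)).
  exact: bmeasD.
rewrite -(ointZ (a ^+ 2) (b2 e)) -(ointZ (b ^+ 2) (b3 e)).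
rewrite -(ointD (b1 e) b2') -(ointD b12 b3') -(ointZ 3 b123).
apply: le_oint; [exact: bmeasM | exact: bmeasZ |].
move=> x _; set X := u e x; set Y := g e x; set Z := h e x.
rewrite -subr_ge0 (_ : _ - _ = (X - a * Y) ^+ 2 + (X - b * Z) ^+ 2 + (a * Y - b * Z) ^+ 2).
  by rewrite !addr_ge0 ?sqr_ge0.
by ring.
Qed.

(** Near a vertex there is room for kernels on one side only, and a single half
    kernel also produces the slope of u.  The difference of the kernels with
    parameters 2 k and k has no slope term and represents k u(x).  Relative to
    the spectral parameter k^2, the kernel with parameter 2 k has the additional
    residual - 3 k^2 * kernel, which is still small enough for an upper bound. *)
Lemma uniform_bound d e x (b : bool) k N : 0 < d ->
  0 <= hlo d x b -> hhi d x b <= elen e -> 1 <= k ->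
  k ^+ 3 * rsum (fun n => dens n e x) la (k ^+ 2) N <= 18 + 9 * residual_const d.
Proof.
move=> d0 lo hi k1; have k0 : 0 < k by exact: lt_le_trans k1.
have k21 : 1 <= 2 * k by lra.
pose he (_ : unit) := e; pose hx (_ : unit) := x; pose hb (_ : unit) := b.
have lo0 i : 0 <= hlo d (hx i) (hb i) by [].
have hil i : hhi d (hx i) (hb i) <= elen (he i) by [].
have disj (i j : unit) y : i != j -> he i = he j -> hlo d (hx i) (hb i) < y < hhi d (hx i) (hb i) ->
    hlo d (hx j) (hb j) < y < hhi d (hx j) (hb j) -> False by case: i; case: j.
pose ps k' := kernel_sum he hb hx d k'; pose rh k' := residual_sum q he hb hx d k'.
have bps k' : gbmeas (ps k') by exact: gbmeas_kernel_sum.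
have brh k' : gbmeas (rh k') by exact: (gbmeas_residual_sum pq lo0 hil).
(* [gbmeas_comb] has three terms; the third one is void here. *)
pose Psi : edge G -> R -> R := fun e x => ps (2 * k) e x + (-1) * ps k e x + 0 * ps k e x.
pose Rho : edge G -> R -> R := fun e x => rh (2 * k) e x + (-1) * rh k e x + (- 3 * k ^+ 2) * ps (2 * k) e x.
have bP : gbmeas Psi by exact: gbmeas_comb.
have bR : gbmeas Rho by exact: gbmeas_comb.
have s0 : 0 < k ^+ 2 by rewrite exprn_gt0.
have id l g g1 : gbmeas g -> (forall e, solves (elen e) (q e) l (g e) (g1 e)) ->
    k * g e x = (l + k ^+ 2) * ginner Psi g - ginner Rho g.
  move=> bg sg.
  have h2 := fam_identity pq d0 lo0 hil (2 * k) bg sg.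
  have h1 := fam_identity pq d0 lo0 hil k bg sg.
  rewrite /Psi /Rho !ginner_comb//.
  have E : k * g e x = kvalue he hb hx (2 * k) g g1 - kvalue he hb hx k g g1.
    by rewrite /kvalue !(big_pred1 tt)//=; rewrite /hx /he; ring.
  rewrite E h1 h2 -/(ps k) -/(ps (2 * k)) -/(rh k) -/(rh (2 * k)).
  move: (ginner (ps k) g) (ginner (ps (2 * k)) g) (ginner (rh k) g) (ginner (rh (2 * k)) g).
  by move=> ? ? ? ?; ring.
have br n : gbmeas (gre (f n)) by exact: (gbmeas_fr sr).
have bi n : gbmeas (gim (f n)) by exact: (gbmeas_fi si).
have hAr n := id _ _ _ (br n) (sr n).
have hAi n := id _ _ _ (bi n) (si n).
have := l2_upper hf la0 sr si bP bR s0 hAr hAi N ltr01.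
rewrite (_ : (fun n => _) = fun n => k ^+ 2 * dens n e x); last first.
  by apply/funext => n; rewrite /dens; ring.
rewrite rsumZ invr1; set S := rsum _ _ _ _ => h.
have p1 := kernel_sum_norm_le d0 lo0 hil disj k1.
have p2 := kernel_sum_norm_le d0 lo0 hil disj k21.
have r1 := residual_sum_norm_le pq d0 lo0 hil disj k1.
have r2 := residual_sum_norm_le pq d0 lo0 hil disj k21.
rewrite -/(residual_const d) card_unit -/(ps k) -/(ps (2 * k)) -/(rh k) -/(rh (2 * k)) !mul1r in p1 p2 r1 r2.
have nP : ginner Psi Psi <= 9 / 4 / k.
  apply: le_trans (ginner_comb_le _ _ _ _ _) _ => //.
  rewrite sqrrN expr1n mul1r expr0n/= mul0r addr0.
  have e2 : (2 * (2 * k))^-1 = 1 / 4 / k by field; rewrite gt_eqF.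
  have e1 : (2 * k)^-1 = 1 / 2 / k by field; rewrite gt_eqF.
  rewrite e2 in p2; rewrite e1 in p1; move: p1 p2.
  by move: (ginner (ps k) (ps k)) (ginner _ _) => ? ? ? ?; lra.
have kc : 0 <= residual_const d by exact: sqr_ge0.
have nR : ginner Rho Rho <= 9 / 2 * residual_const d / k + 27 / 4 * k ^+ 3.
  apply: le_trans (ginner_comb_le _ _ _ _ _) _ => //.
  rewrite sqrrN expr1n mul1r.
  have -> : (- 3 * k ^+ 2) ^+ 2 = 9 * k ^+ 4 by ring.
  have p2' : k ^+ 4 * ginner (ps (2 * k)) (ps (2 * k)) <= k ^+ 3 / 4.
    have -> : k ^+ 3 / 4 = k ^+ 4 * (2 * (2 * k))^-1 by field; rewrite gt_eqF.
    by rewrite ler_wpM2l// exprn_ge0// ltW.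
  have e2 : residual_const d / (2 * k) = 1 / 2 * (residual_const d / k) by field; rewrite gt_eqF.
  rewrite e2 in r2.
  have -> : 9 / 2 * residual_const d / k = 9 / 2 * (residual_const d / k) by rewrite -mulrA.
  rewrite -[9 * k ^+ 4 * _]mulrA; move: r1 r2 p2'.
  move: (_ * ginner _ _) (ginner (rh k) (rh k)) (ginner _ _) (residual_const d / k).
  by move=> ? ? ? ? ? ? ?; lra.
have k3 : 0 < k ^+ 3 by rewrite exprn_gt0.
have k4 : (k ^+ 2) ^+ 2 = k ^+ 4 by rewrite -exprM.
have nR' : ginner Rho Rho / (k ^+ 2) ^+ 2 <= (9 / 2 * residual_const d + 27 / 4) / k.
  rewrite k4 ler_pdivrMr ?exprn_gt0//; apply: le_trans nR _.
  have -> : (9 / 2 * residual_const d + 27 / 4) / k * k ^+ 4 = 9 / 2 * residual_const d * k ^+ 3 + 27 / 4 * k ^+ 3.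
    by field; rewrite gt_eqF.
  rewrite lerD2r ler_wpM2l//; first by rewrite mulr_ge0.
  by rewrite (@le_trans _ _ 1)// ?invf_le1 ?exprn_ege1.
have : k ^+ 2 * S <= (18 + 9 * residual_const d) / k.
  apply: le_trans h _.
  have -> : (18 + 9 * residual_const d) / k = 2 * (9 / 4 / k) + 2 * ((9 / 2 * residual_const d + 27 / 4) / k).
    by field; rewrite gt_eqF.
  move: nP nR'; move: (_ / (k ^+ 2) ^+ 2) (ginner Psi Psi) (9 / 4 / k) (_ / k).
  by move=> ? ? ? ? ? ?; lra.
rewrite ler_pdivlMr// => h'.
by apply: le_trans h'; rewrite le_eqVlt; apply/orP; left; apply/eqP; ring.
Qed.

End PointwiseLaws.

(** * The trace of the squared resolvent *)

Section TraceLaw.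
Variables (R : realType).
Local Notation mu := (@lebesgue_measure R).

Lemma cvg_rate (F : R -> R) (A C K : R) :
  (forall k, 1 <= k -> K <= k -> `|F k - A| <= C / k) -> F k @[k --> +oo] --> A.
Proof.
move=> h; apply/cvgrPdist_le => e e0; near=> k.
have k1 : 1 <= k by near: k; apply: nbhs_pinfty_ge; exact: num_real.
have kK : K <= k by near: k; apply: nbhs_pinfty_ge; exact: num_real.
have kC : C / e <= k by near: k; apply: nbhs_pinfty_ge; exact: num_real.
rewrite distrC (le_trans (h k k1 kK))// ler_pdivrMr ?(lt_le_trans ltr01)//.
by move: kC; rewrite ler_pdivrMr// mulrC.
Unshelve. all: by end_near. Qed.

Lemma cvgn_sum (I : finType) (u : I -> nat -> R) (l : I -> R) :
  (forall i, u i @ \oo --> l i) ->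
  \sum_(i : I) u i n @[n --> \oo] --> \sum_(i : I) l i.
Proof.
move=> h; elim: (index_enum I) => [|i r IH].
  rewrite big_nil (_ : (fun n => _) = cst 0); first exact: cvg_cst.
  by apply/funext => n; rewrite big_nil.
rewrite big_cons (_ : (fun n => _) = fun n => u i n + \sum_(j <- r) u j n).
  exact: cvgD.
by apply/funext => n; rewrite big_cons.
Qed.

Lemma oint_EFin (a b : R) (g : R -> R) : bmeas a b g ->
  (\int[mu]_(x in `]a, b[) (g x)%:E)%E = (oint a b g)%:E.
Proof.
move=> /bmeas_integrable ig; rewrite /oint /Rintegral fineK//.
exact: integrable_fin_num.
Qed.

(** Monotone convergence: lower bounds for the pointwise limits of an increasing
    sequence pass to its integrals. *)
Lemma oint_limn_ge (a b c B : R) (g : nat -> R -> R) : a <= b -> 0 <= c ->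
  (forall N, bmeas a b (g N)) -> (forall N x, a < x < b -> 0 <= g N x) ->
  (forall x, a < x < b -> nondecreasing_seq (g^~ x)) ->
  (forall x, a < x < b -> cvgn (g^~ x) /\ c <= limn (g^~ x)) ->
  (forall N, oint a b (g N) <= B) -> c * (b - a) <= B.
Proof.
move=> ab c0 bg g0 ndg lg oB.
pose g' N x := (g N x)%:E.
have mI : measurable `]a, b[%classic by [].
have mg N : measurable_fun `]a, b[ (g' N) by apply/measurable_EFinP; exact: (bg N).1.
have g'0 N x : `]a, b[%classic x -> (0 <= g' N x)%E by rewrite in_oo lee_fin => /g0.
have nd x : `]a, b[%classic x -> {homo g'^~ x : n m / (n <= m)%N >-> (n <= m)%E}.
  by rewrite in_oo => xab n m nm; rewrite lee_fin; exact: ndg.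
have mct : (\int[mu]_(x in `]a, b[) g' n x)%E @[n --> \oo] -->
    (\int[mu]_(x in `]a, b[) limn (g'^~ x))%E.
  exact: cvg_monotone_convergence.
have lim_g x : a < x < b -> limn (g'^~ x) = (limn (g^~ x))%:E.
  move=> xab; have [cv _] := lg x xab; apply: cvg_lim => //.
  by apply: cvg_EFin; [exact: nearW | exact: cv].
have le1 : ((c * (b - a))%:E <= \int[mu]_(x in `]a, b[) limn (g'^~ x))%E.
  have -> : (c * (b - a))%:E = (\int[mu]_(x in `]a, b[) (cst c x)%:E)%E.
    by rewrite -oint_cst// oint_EFin//; exact: bmeas_cst.
  apply: ge0_le_integral => //.
  - by apply/measurable_EFinP; exact: measurable_cst.
  - apply: (emeasurable_fun_cvg g') => // x; rewrite in_oo => xab.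
    rewrite lim_g//; have [cv _] := lg x xab.
    by apply: cvg_EFin; [exact: nearW | exact: cv].
  - by move=> x; rewrite in_oo => xab; rewrite lim_g// lee_fin; have [] := lg x xab.
have le2 : (\int[mu]_(x in `]a, b[) limn (g'^~ x) <= B%:E)%E.
  rewrite -(cvg_lim (@ereal_hausdorff R) mct); apply: lime_le.
    by apply/cvg_ex; eexists; exact: mct.
  by apply: nearW => N; rewrite oint_EFin// lee_fin.
by have := le_trans le1 le2; rewrite lee_fin.
Qed.

Variable (G : metric_graph R).
Variables (f f1 : nat -> gfun G) (la : nat -> R) (q : edge G -> R -> R) (M : R).
Hypothesis hf : orthonormal_basis f.
Hypothesis la0 : forall n, 0 <= la n.
Hypothesis pq : forall e, potential (elen e) M (q e).
Hypothesis sr : forall n e, solves (elen e) (q e) (la n) (gre (f n) e) (gre (f1 n) e).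
Hypothesis si : forall n e, solves (elen e) (q e) (la n) (gim (f n) e) (gim (f1 n) e).
Implicit Types (k d x : R) (e : edge G).

Lemma edge_scale : exists2 d : R, 0 < d & forall e, 2 * d <= elen e.
Proof.
exists (\big[Num.min/1]_(e : edge G) (elen e / 2)).
  by apply: (big_ind (fun z : R => 0 < z)) => // [x y x0 y0|e _]; rewrite ?lt_min ?x0// divr_gt0// elen_gt0.
move=> e; rewrite mulrC -ler_pdivlMr//; exact: bigmin_le.
Qed.

Lemma bmeas_dens n e : bmeas 0 (elen e) (dens f n e).
Proof.
by apply: bmeasD; apply: bmeasX; [exact: (gbmeas_fr sr) | exact: (gbmeas_fi si)].
Qed.

Lemma bmeas_rsum_dens s N e : bmeas 0 (elen e) (fun x => rsum (fun n => dens f n e x) la s N).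
Proof.
apply: (@bmeas_sum _ _ _ (fun (n : 'I_N) x => dens f n e x / (la n + s) ^+ 2)) => n.
by apply: bmeasM; [exact: bmeas_dens | exact: bmeas_cst].
Qed.

(** Each basis function has norm 1, so the trace is the integral over the graph
    of the resolvent sums at points. *)
Lemma rsum1E s N : rsum (fun=> 1) la s N =
  \sum_(e : edge G) oint 0 (elen e) (fun x => rsum (fun n => dens f n e x) la s N).
Proof.
have one n : \sum_(e : edge G) oint 0 (elen e) (dens f n e) = 1.
  have := orthonormalr hf (gbmeas_fr sr) (gbmeas_fi si) n n.
  rewrite eqxx => /(etrans _); apply.
  rewrite /ginner -big_split/=; apply: eq_bigr => e _.
  have br := gbmeas_fr sr n e; have bi := gbmeas_fi si n e.
  rewrite -ointD; [|exact: bmeasM..].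
  by apply: eq_oint => x _; rewrite /dens !expr2.
rewrite /rsum; transitivity (\sum_(n < N) \sum_(e : edge G)
    ((la n + s) ^- 2 * oint 0 (elen e) (dens f n e))).
  by apply: eq_bigr => n _; rewrite -mulr_sumr one mulr1 mul1r.
rewrite exchange_big/=; apply: eq_bigr => e _.
rewrite (@oint_sum _ _ _ (fun (n : 'I_N) x => dens f n e x / (la n + s) ^+ 2)).
  apply: eq_bigr => n _; rewrite -ointZ; last exact: bmeas_dens.
  by apply: eq_oint => x _; rewrite mulrC.
by move=> n; apply: bmeasM; [exact: bmeas_dens | exact: bmeas_cst].
Qed.

Let L := total_length G.

(** The interior law holds outside the strips of width d along the ends of the
    edges; on the strips [uniform_bound] is used, with a length d0 that stays
    fixed when d becomes small. *)
Lemma trace_upper (d0 d k : R) N : 0 < d0 -> (forall e, 2 * d0 <= elen e) ->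
  0 < d -> (forall e, 2 * d <= elen e) -> 1 <= k ->
  k ^+ 3 * rsum (fun=> 1) la (k ^+ 2) N <=
    L / 4 + L * (law_const M d / k) + 2 * d * (18 + 9 * residual_const M d0) * #|edge G|%:R.
Proof.
move=> d00 hd0 dp hd k1; have k0 : 0 < k by exact: lt_le_trans k1.
have k3 : 0 <= k ^+ 3 by rewrite exprn_ge0// ltW.
set Cu := 18 + 9 * residual_const M d0.
rewrite rsum1E mulr_sumr.
apply: (@le_trans _ _ (\sum_(e : edge G) (elen e * (1 / 4 + law_const M d / k) + 2 * d * Cu))); last first.
  rewrite big_split/= -mulr_suml sumr_const mulr_natr /L /total_length.
  by rewrite le_eqVlt; apply/orP; left; apply/eqP; ring.
apply: ler_sum => e _.
pose g x := k ^+ 3 * rsum (fun n => dens f n e x) la (k ^+ 2) N.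
have br := bmeas_rsum_dens (k ^+ 2) N e.
have bg : bmeas 0 (elen e) g by exact: bmeasZ.
have gu x : 0 < x < elen e -> g x <= Cu.
  move=> /andP[x0 xl]; have de := hd0 e.
  have [xh|xh] := leP x (elen e / 2).
    by apply: (@uniform_bound _ _ _ _ _ _ _ hf la0 pq sr si d0 e x false) => //; rewrite /hlo /hhi; lra.
  by apply: (@uniform_bound _ _ _ _ _ _ _ hf la0 pq sr si d0 e x true) => //; rewrite /hlo /hhi; lra.
have gi x : d < x < elen e - d -> g x <= 1 / 4 + law_const M d / k.
  move=> /andP[xd xl].
  have [cv up _] : [/\ cvgn (rsum (fun n => dens f n e x) la (k ^+ 2)),
      k ^+ 3 * limn (rsum (fun n => dens f n e x) la (k ^+ 2)) <= 1 / 4 + law_const M d / k &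
      1 / 4 - law_const M d / k <= k ^+ 3 * limn (rsum (fun n => dens f n e x) la (k ^+ 2))].
    by apply: (interior_law hf la0 pq sr si) => //; lra.
  apply: le_trans up; rewrite ler_wpM2l//; apply: nondecreasing_cvgn_le => //.
  by apply: rsum_nondecreasing => n; exact: dens_ge0.
have de := hd e.
rewrite -ointZ// -/g (@oint_split _ 0 d)//; last by apply/andP; split; lra.
rewrite (@oint_split _ d (elen e - d) (elen e)); last 2 first.
- by apply/andP; split; lra.
- by apply: bmeas_sub bg => //; exact: ltW.
have sub a b : 0 <= a -> b <= elen e -> bmeas a b g by move=> ? ?; exact: bmeas_sub bg.
have b1 : oint 0 d g <= Cu * (d - 0).
  rewrite -oint_cst; last exact: ltW.
  apply: le_oint; [by apply: sub => //; lra | exact: bmeas_cst |].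
  by move=> x /andP[x0 xd]; apply: gu; apply/andP; split; lra.
have b2 : oint d (elen e - d) g <= (1 / 4 + law_const M d / k) * (elen e - d - d).
  rewrite -oint_cst; last by lra.
  by apply: le_oint; [by apply: sub; lra | exact: bmeas_cst |].
have b3 : oint (elen e - d) (elen e) g <= Cu * (elen e - (elen e - d)).
  rewrite -oint_cst; last by lra.
  apply: le_oint; [by apply: sub => //; lra | exact: bmeas_cst |].
  by move=> x /andP[x0 xd]; apply: gu; apply/andP; split; lra.
have cl : 0 <= law_const M d / k by rewrite divr_ge0 ?law_const_ge0// ltW.
have cd : 0 <= law_const M d / k * d by rewrite mulr_ge0// ltW.
by move: b1 b2 b3; set c := law_const M d / k in cl cd *; lra.
Qed.

Lemma trace_cvg k : 1 <= k -> cvgn (rsum (fun=> 1) la (k ^+ 2)).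
Proof.
move=> k1; have [d d0 hd] := edge_scale.
have k3 : 0 < k ^+ 3 by rewrite exprn_gt0// (lt_le_trans ltr01).
apply: (@rsum_cvg _ _ _ _ ((L / 4 + L * (law_const M d / k) + 2 * d * (18 + 9 * residual_const M d) * #|edge G|%:R) / k ^+ 3)).
  by move=> _.
by move=> N; rewrite ler_pdivlMr// mulrC; exact: trace_upper.
Qed.

(** The strips are dropped.  The interior law concerns the full resolvent sums,
    not the partial ones, hence the passage to the limit under the integral. *)
Lemma trace_lower (d k : R) : 0 < d -> (forall e, 2 * d <= elen e) ->
  1 <= k -> 4 * law_const M d <= k ->
  (1 / 4 - law_const M d / k) * (L - 2 * d * #|edge G|%:R) <=
  k ^+ 3 * limn (rsum (fun=> 1) la (k ^+ 2)).
Proof.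
move=> dp hd k1 kc; have k0 : 0 < k by exact: lt_le_trans k1.
have k3 : 0 <= k ^+ 3 by rewrite exprn_ge0// ltW.
set c := _ - _.
have c0 : 0 <= c by rewrite /c subr_ge0 ler_pdivrMr//; lra.
pose g e N x := k ^+ 3 * rsum (fun n => dens f n e x) la (k ^+ 2) N.
have bg e N : bmeas 0 (elen e) (g e N) by apply: bmeasZ; exact: bmeas_rsum_dens.
have g0 e N x : 0 <= g e N x.
  rewrite mulr_ge0//; apply: sumr_ge0 => n _.
  by rewrite divr_ge0 ?dens_ge0 ?sqr_ge0.
have ndg e x : nondecreasing_seq (fun N => g e N x).
  move=> n m nm; rewrite ler_wpM2l//.
  by apply: rsum_nondecreasing => // i; exact: dens_ge0.
pose J e N := oint d (elen e - d) (g e N).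
have bgJ e N : bmeas d (elen e - d) (g e N).
  by apply: bmeas_sub (bg e N); [exact: ltW | lra].
have Jle e N : J e N <= oint 0 (elen e) (g e N).
  have de := hd e.
  rewrite (@oint_split _ 0 d)//; last by apply/andP; split; lra.
  rewrite (@oint_split _ d (elen e - d) (elen e)); last 2 first.
  - by apply/andP; split; lra.
  - by apply: bmeas_sub (bg e N) => //; exact: ltW.
  rewrite addrCA lerDl addr_ge0//; exact: oint_ge0.
have sumE N : \sum_(e : edge G) oint 0 (elen e) (g e N) = k ^+ 3 * rsum (fun=> 1) la (k ^+ 2) N.
  rewrite rsum1E mulr_sumr; apply: eq_bigr => e _.
  by rewrite -ointZ//; exact: bmeas_rsum_dens.
have cT := trace_cvg k1; set T := limn _.
have sumle N : \sum_(e : edge G) oint 0 (elen e) (g e N) <= k ^+ 3 * T.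
  rewrite sumE ler_wpM2l//; apply: nondecreasing_cvgn_le => //.
  exact: rsum_nondecreasing.
have ndJ e : nondecreasing_seq (J e).
  by move=> n m nm; apply: le_oint => // x _; exact: ndg.
have cJ e : cvgn (J e).
  apply: nondecreasing_is_cvgn => //; exists (k ^+ 3 * T) => _ [N _ <-].
  apply: le_trans (Jle e N) _; apply: le_trans (sumle N).
  rewrite (bigD1 e)//= lerDl; apply: sumr_ge0 => e' _.
  by apply: oint_ge0.
have lJ e : c * (elen e - 2 * d) <= limn (J e).
  have -> : elen e - 2 * d = elen e - d - d by ring.
  have de := hd e.
  apply: (@oint_limn_ge _ _ _ _ (g e)) => //.
  - by lra.
  - move=> x /andP[xd xl].
    have [cv _ lo] : [/\ cvgn (rsum (fun n => dens f n e x) la (k ^+ 2)),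
        k ^+ 3 * limn (rsum (fun n => dens f n e x) la (k ^+ 2)) <= 1 / 4 + law_const M d / k &
        1 / 4 - law_const M d / k <= k ^+ 3 * limn (rsum (fun n => dens f n e x) la (k ^+ 2))].
      by apply: (interior_law hf la0 pq sr si) => //; lra.
    have cv' : (fun N => g e N x) @ \oo --> k ^+ 3 * limn (rsum (fun n => dens f n e x) la (k ^+ 2)).
      exact: cvgMl_tmp.
    split; first by apply/cvg_ex; eexists; exact: cv'.
    by rewrite (cvg_lim (@Rhausdorff R) cv').
  - by move=> N; apply: nondecreasing_cvgn_le.
apply: (@le_trans _ _ (\sum_(e : edge G) limn (J e))).
  apply: (@le_trans _ _ (\sum_(e : edge G) c * (elen e - 2 * d))).
    rewrite -mulr_sumr sumrB sumr_const mulr_natr /L /total_length//.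
  by apply: ler_sum => e _; exact: lJ.
have cs := cvgn_sum cJ.
rewrite -(cvg_lim (@Rhausdorff R) cs); apply: limr_le.
  by apply/cvg_ex; eexists; exact: cs.
apply: nearW => N; apply: le_trans (sumle N); apply: ler_sum => e _; exact: Jle.
Qed.

Lemma trace_law : k ^+ 3 * limn (rsum (fun=> 1) la (k ^+ 2)) @[k --> +oo] --> L / 4.
Proof.
have [d0 d00 hd0] := edge_scale.
set E : R := #|edge G|%:R.
have E0 : 0 <= E by [].
have L0 : 0 <= L by apply: sumr_ge0 => e _; rewrite ltW// elen_gt0.
set Cu := 18 + 9 * residual_const M d0.
have Cu0 : 0 <= Cu by rewrite /Cu addr_ge0// mulr_ge0// sqr_ge0.
apply/cvgrPdist_le => eps eps0.
pose d := Num.min d0 (eps / 2 / (2 * Cu * E + E + 1)).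
have den0 : 0 < 2 * Cu * E + E + 1.
  by rewrite ltr_wpDl// addr_ge0// !mulr_ge0.
have dp : 0 < d by rewrite /d lt_min d00/= !divr_gt0.
have hd e : 2 * d <= elen e.
  by apply: le_trans (hd0 e); rewrite ler_pM2l// /d ge_min lexx.
have dE : 2 * d * Cu * E <= eps / 2 /\ d * E <= eps / 2.
  have dd : d * (2 * Cu * E + E + 1) <= eps / 2.
    by rewrite -ler_pdivlMr// /d ge_min lexx orbT.
  have h1 : 0 <= d * Cu * E by rewrite !mulr_ge0// ltW.
  have h2 : 0 <= d * E by rewrite mulr_ge0// ltW.
  by split; lra.
have [dE1 dE2] := dE.
have cl0 : 0 <= law_const M d by exact: law_const_ge0.
near=> k.
have k1 : 1 <= k by near: k; apply: nbhs_pinfty_ge; exact: num_real.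
have k0 : 0 < k by exact: lt_le_trans k1.
have kc : 4 * law_const M d <= k by near: k; apply: nbhs_pinfty_ge; exact: num_real.
have ke : (L * law_const M d) / (eps / 2) <= k by near: k; apply: nbhs_pinfty_ge; exact: num_real.
have Lc : L * (law_const M d / k) <= eps / 2.
  rewrite mulrA ler_pdivrMr// mulrC; move: ke; rewrite ler_pdivrMr ?divr_gt0// => ke.
  by rewrite mulrC [_ * k]mulrC.
have k3 : 0 < k ^+ 3 by rewrite exprn_gt0.
have lo := trace_lower dp hd k1 kc.
have up : k ^+ 3 * limn (rsum (fun=> 1) la (k ^+ 2)) <=
    L / 4 + L * (law_const M d / k) + 2 * d * Cu * E.
  rewrite mulrC -ler_pdivlMr//; apply: rsum_lim_le; first by move=> _.
  by move=> N; rewrite ler_pdivlMr// mulrC; exact: trace_upper.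
have c0 : 0 <= law_const M d / k * (d * E) by rewrite !mulr_ge0 ?invr_ge0// ltW.
rewrite distrC ler_norml; apply/andP; split; last by lra.
move: lo; rewrite -/E; set c := law_const M d / k in Lc c0 *.
by lra.
Unshelve. all: by end_near. Qed.

End TraceLaw.

(** * Resolvent sums at a vertex *)

Section VertexLaw.
Variables (R : realType) (G : metric_graph R).
Variables (f f1 : nat -> gfun G) (la : nat -> R) (q : edge G -> R -> R) (M : R).
Hypothesis hf : orthonormal_basis f.
Hypothesis la0 : forall n, 0 <= la n.
Hypothesis pq : forall e, potential (elen e) M (q e).
Hypothesis sr : forall n e, solves (elen e) (q e) (la n) (gre (f n) e) (gre (f1 n) e).
Hypothesis si : forall n e, solves (elen e) (q e) (la n) (gim (f n) e) (gim (f1 n) e).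
Variables (beta : vertex G -> R) (v : vertex G).
Hypothesis bv : beta v != 0.
Hypothesis hv : forall n, delta_prime_conditions beta (f n) (f1 n).
Implicit Types (k d x : R) (e : edge G).
Local Open Scope complex_scope.

Lemma normc_sqr (z : R[i]) : Normc.normc z ^+ 2 = complex.Re z ^+ 2 + complex.Im z ^+ 2.
Proof. by case: z => a b /=; rewrite sqr_sqrtr// addr_ge0 ?sqr_ge0. Qed.

Let c : R := (deg v)%:R / beta v.
Let ends := ends_at v.
Let ev (i : 'I_#|ends|) : edge G * bool := @enum_val _ (mem ends) i.
Let he (i : 'I_#|ends|) := (ev i).1.
Let hb (i : 'I_#|ends|) := (ev i).2.
Let hx (i : 'I_#|ends|) : R := if (ev i).2 then elen (ev i).1 else 0.

(** One half kernel on every edge end at v.  The slopes into the edges have a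
    common value, which the vertex condition expresses by the sum of the end
    values; here beta v must not vanish. *)
Lemma vertex_kvalue k n :
  kvalue he hb hx k (gre (f n)) (gre (f1 n)) = (k + c) * complex.Re (vertex_sum (f n) v) /\
  kvalue he hb hx k (gim (f n)) (gim (f1 n)) = (k + c) * complex.Im (vertex_sum (f n) v).
Proof.
have [w [hw hs]] := hv n v.
have degE : deg v = #|ends| by [].
have wE i : end_slope (f1 n) (ev i) = w.
  by apply: hw; exact: (@enum_valP _ (mem ends) i).
have sumE : vertex_sum (f n) v = \sum_(i < #|ends|) end_value (f n) (ev i).
  by exact: (@big_enum_val _ _ _ _ (mem ends)).
have hs' := hs; rewrite mulrC in hs'.
have wr : complex.Re w = complex.Re (vertex_sum (f n) v) / beta v.
  by rewrite hs' complex_ReMr mulfK.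
have wi : complex.Im w = complex.Im (vertex_sum (f n) v) / beta v.
  by rewrite hs' complex_ImMr mulfK.
split.
- transitivity (\sum_(i < #|ends|) (k * complex.Re (end_value (f n) (ev i)) + complex.Re w)).
    apply: eq_bigr => i _; congr (_ + _).
    rewrite -(wE i) /end_slope /end_value /gre /sgnb /he /hb /hx.
    by case: (ev i).2; rewrite ?complex_ReN ?mulN1r ?mul1r.
  rewrite big_split/= -mulr_sumr -Re_sum -sumE sumr_const card_ord wr /c degE.
  by rewrite -mulr_natl; ring.
- transitivity (\sum_(i < #|ends|) (k * complex.Im (end_value (f n) (ev i)) + complex.Im w)).
    apply: eq_bigr => i _; congr (_ + _).
    rewrite -(wE i) /end_slope /end_value /gim /sgnb /he /hb /hx.
    by case: (ev i).2; rewrite ?complex_ImN ?mulN1r ?mul1r.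
  rewrite big_split/= -mulr_sumr -Im_sum -sumE sumr_const card_ord wi /c degE.
  by rewrite -mulr_natl; ring.
Qed.

Let a n := Normc.normc (vertex_sum (f n) v) ^+ 2.

(** By [local_law] (k + c)^2 times the resolvent sum is about deg(v) / (2 k),
    and (k / (k + c))^2 tends to 1.  The supports are disjoint because d is at
    most half of every edge length, also for the two ends of a loop. *)
Lemma vertex_law : exists2 K : R, 1 <= K &
  (forall k, K <= k -> cvgn (rsum a la (k ^+ 2))) /\
  (k ^+ 3 * limn (rsum a la (k ^+ 2)) @[k --> +oo] --> ((deg v)%:R / 2 : R)).
Proof.
have [d d0 hd] := edge_scale G.
have lo0 i : 0 <= hlo d (hx i) (hb i).
  by have := hd (he i); rewrite /hlo /hx /hb /he; case: (ev i).2; lra.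
have hil i : hhi d (hx i) (hb i) <= elen (he i).
  by have := hd (he i); rewrite /hhi /hx /hb /he; case: (ev i).2; lra.
have disj i j y : i != j -> he i = he j -> hlo d (hx i) (hb i) < y < hhi d (hx i) (hb i) ->
    hlo d (hx j) (hb j) < y < hhi d (hx j) (hb j) -> False.
  move=> ij eij; have nb : hb i != hb j.
    apply: contra ij => /eqP bij; apply/eqP/enum_val_inj.
    by rewrite [LHS]surjective_pairing [RHS]surjective_pairing; congr (_, _).
  have := hd (he i); move: nb eij; rewrite /hlo /hhi /hx /hb /he.
  by case: (ev i).2; case: (ev j).2 => // _ -> ? /andP[? ?] /andP[? ?]; lra.
set C := (4 * d)^-1 + 8 / d ^+ 2 + 2 * (24 / d ^+ 2 + M) ^+ 2 + 1.
have law k : 1 <= k -> k + c != 0 ->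
  [/\ cvgn (rsum a la (k ^+ 2)),
   (k + c) ^+ 2 * limn (rsum a la (k ^+ 2)) <= (deg v)%:R * ((2 * k)^-1 + C / k ^+ 2) &
   (deg v)%:R * ((2 * k)^-1 - C / k ^+ 2) <= (k + c) ^+ 2 * limn (rsum a la (k ^+ 2))].
  move=> k1 kc0.
  have [cv up lo] := local_law hf la0 pq sr si d0 lo0 hil disj k1.
  have eq : kvalue2 f f1 he hb hx k = fun n => (k + c) ^+ 2 * a n.
    apply/funext => n; rewrite /kvalue2; have [-> ->] := vertex_kvalue k n.
    by rewrite /a normc_sqr; ring.
  rewrite eq card_ord in cv up lo.
  have kc2 : (k + c) ^+ 2 != 0 by rewrite expf_neq0.
  have [cv' E] := rsumZ_cvg kc2 cv.
  by rewrite E in up lo; split.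
have knz k : 2 * `|c| + 1 <= k -> k / 2 <= k + c /\ 0 < k + c.
  move=> kc; have := ler_norm (- c); rewrite normrN => ?.
  by have := normr_ge0 c => ?; split; lra.
exists (2 * `|c| + 1); first by rewrite lerDr mulr_ge0.
have K1 k : 2 * `|c| + 1 <= k -> 1 <= k.
  by move=> h; apply: le_trans h; rewrite lerDr mulr_ge0.
split.
  move=> k kK; have [_ kc] := knz k kK.
  by have [] := law k (K1 k kK); rewrite ?gt_eqF.
pose F k := k * ((k + c) ^+ 2 * limn (rsum a la (k ^+ 2))).
pose H k := k / (k + c).
have cF : F k @[k --> +oo] --> ((deg v)%:R / 2 : R).
  apply: (@cvg_rate _ _ _ ((deg v)%:R * C) (2 * `|c| + 1)) => k k1 kK.
  have [_ kc] := knz k kK; have k0 : 0 < k by exact: lt_le_trans k1.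
  have [|_ up lo] := law k k1; first by rewrite gt_eqF.
  move: up lo; rewrite /F; set X : R := (k + c) ^+ 2 * limn (rsum a la (k ^+ 2)) => up lo.
  have up' := ler_wpM2l (ltW k0) up; have lo' := ler_wpM2l (ltW k0) lo.
  have e1 : k * ((deg v)%:R * ((2 * k)^-1 + C / k ^+ 2)) = (deg v)%:R / 2 + (deg v)%:R * C / k.
    by field; rewrite gt_eqF.
  have e2 : k * ((deg v)%:R * ((2 * k)^-1 - C / k ^+ 2)) = (deg v)%:R / 2 - (deg v)%:R * C / k.
    by field; rewrite gt_eqF.
  by rewrite e1 in up'; rewrite e2 in lo'; rewrite ler_norml; apply/andP; split; lra.
have cH : H k @[k --> +oo] --> (1 : R).
  apply: (@cvg_rate _ _ _ (2 * `|c|) (2 * `|c| + 1)) => k k1 kK.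
  have [kh kc] := knz k kK; have k0 : 0 < k by exact: lt_le_trans k1.
  have -> : H k - 1 = - c / (k + c) by rewrite /H; field; rewrite gt_eqF.
  rewrite normrM normrN normfV (gtr0_norm kc) ler_pdivrMr// mulrAC ler_pdivlMr//.
  by rewrite [2 * _]mulrC -mulrA ler_wpM2l//; lra.
have cFH : F k * (H k * H k) @[k --> +oo] --> ((deg v)%:R / 2 * (1 * 1) : R).
  by apply: cvgM => //; apply: cvgM.
rewrite !mulr1 in cFH; apply: cvg_trans cFH; apply: near_eq_cvg.
near=> k.
have kK : 2 * `|c| + 1 <= k by near: k; apply: nbhs_pinfty_ge; exact: num_real.
have [_ kc] := knz k kK.
by rewrite /F /H; field; rewrite gt_eqF.
Unshelve. all: by end_near. Qed.

End VertexLaw.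

(** * Powers and polynomial approximations of a threshold *)

Section PowerBounds.
Variable R : realType.
Implicit Types (u w x y p r t : R) (n m j : nat).

Lemma bernoulli_ge w n : 0 <= w -> 1 + n%:R * w <= (1 + w) ^+ n.
Proof.
move=> w0; elim: n => [|n IH]; first by rewrite mul0r addr0 expr0.
rewrite exprS; apply: le_trans (ler_wpM2l _ IH); last by rewrite addr_ge0.
have nw : 0 <= n%:R * w * w by rewrite !mulr_ge0.
rewrite -natr1; lra.
Qed.

Lemma bernoulli_le w n : 0 <= w <= 1 -> 1 - n%:R * w <= (1 - w) ^+ n.
Proof.
move=> /andP[w0 w1]; elim: n => [|n IH]; first by rewrite mul0r subr0 expr0.
rewrite exprS; apply: le_trans (ler_wpM2l _ IH); last by rewrite subr_ge0.
have nw : 0 <= n%:R * w * w by rewrite !mulr_ge0.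
rewrite -natr1; lra.
Qed.

(** On [0, 1] these polynomials approximate the indicator function of
    u >= 1/2: the power (1 - w)^m with w = u^j and m = 2^j is close to 1 if
    m w = (2 u)^j is small, and close to 0 if it is large. *)
Definition step j u : R := 1 - (1 - u ^+ j) ^+ (2 ^ j).

Lemma expr01 u j : 0 <= u <= 1 -> 0 <= u ^+ j <= 1.
Proof. by move=> /andP[u0 u1]; rewrite exprn_ge0// exprn_ile1. Qed.

Lemma step_itv j u : 0 <= u <= 1 -> 0 <= step j u <= 1.
Proof.
move=> /(expr01 j)/andP[w0 w1]; rewrite /step subr_ge0 gerBl.
by rewrite exprn_ge0 ?subr_ge0// exprn_ile1 ?subr_ge0// gerBl.
Qed.

Lemma step_le j u : 0 <= u <= 1 -> step j u <= (2 * u) ^+ j.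
Proof.
move=> /(expr01 j) h; have := bernoulli_le (2 ^ j) h.
by rewrite /step exprMn natrX; lra.
Qed.

(** Bernoulli's inequality for (1 + w)^m, combined with (1 - w) (1 + w) <= 1. *)
Lemma step_ge j u : (0 < j)%N -> 0 <= u <= 1 -> 0 < u -> 1 - ((2 * u) ^+ j)^-1 <= step j u.
Proof.
move=> j0 h u0; have /andP[w0 w1] := expr01 j h.
rewrite /step lerD2l lerN2.
have wp : 0 < u ^+ j by rewrite exprn_gt0.
have a0 : 0 < (2 * u) ^+ j by rewrite exprn_gt0// mulr_gt0.
rewrite -[leRHS]mul1r ler_pdivlMr//.
apply: (@le_trans _ _ ((1 - u ^+ j) ^+ (2 ^ j) * (1 + u ^+ j) ^+ (2 ^ j))).
  rewrite ler_wpM2l ?exprn_ge0 ?subr_ge0//.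
  by apply: le_trans (bernoulli_ge (2 ^ j) w0); rewrite exprMn natrX lerDr.
rewrite -exprMn; apply: exprn_ile1.
  by rewrite mulr_ge0 ?subr_ge0 ?addr_ge0.
have := sqr_ge0 (u ^+ j); rewrite expr2; lra.
Qed.

Lemma step_le_sqr j u : (1 < j)%N -> 0 <= u <= 1 -> step j u <= 4 * u ^+ 2.
Proof.
move=> j1 h; have /andP[u0 u1] := h.
have -> : 4 * u ^+ 2 = (2 * u) ^+ 2 by ring.
have [h2|h2] := leP (2 * u) 1.
  apply: le_trans (step_le j h) _.
  by rewrite ler_wiXn2l// mulr_ge0.
have /andP[_ s1] := step_itv j h; apply: le_trans s1 _.
by rewrite exprn_ege1// ltW.
Qed.

(** Below the threshold, a small multiple of u^2 dominates; sums of u^2 are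
    controlled by hypothesis, which bounds the infinite tail of a weighted
    sum. *)
Lemma step_le_tail j u t : (1 < j)%N -> 0 <= u <= 1 -> 2 * u <= t ->
  step j u <= 4 * t ^+ (j - 2) * u ^+ 2.
Proof.
move=> j1 h ut; have /andP[u0 u1] := h.
apply: le_trans (step_le j h) _; rewrite -{1}(subnK j1) exprD.
have -> : 4 * t ^+ (j - 2) * u ^+ 2 = t ^+ (j - 2) * (2 * u) ^+ 2 by ring.
rewrite ler_wpM2r ?sqr_ge0// lerXn2r ?nnegrE ?mulr_ge0//.
by apply: le_trans ut; rewrite mulr_ge0.
Qed.

(** For the weights of one index at two scales, suitably normalised
    ([weight_scale]), the difference of the inverses does not depend on the
    index.  So a difference of m-th powers is
    comparable with the (m+1)-st power. *)
Lemma power_diff p r t m : 0 < r -> r <= p -> r^-1 - p^-1 = t -> 0 <= t ->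
  m%:R * t * r ^+ m.+1 <= p ^+ m - r ^+ m /\ p ^+ m - r ^+ m <= m%:R * t * p ^+ m.+1.
Proof.
move=> r0 rp et t0; have p0 : 0 < p by exact: lt_le_trans rp.
have e : p - r = t * (p * r) by rewrite -et; field; rewrite !gt_eqF.
case: m => [|m]; first by rewrite !mul0r !expr0 subrr.
rewrite subrXX e.
have s1 : \sum_(i < m.+1) p ^+ (m.+1.-1 - i) * r ^+ i <= m.+1%:R * p ^+ m.
  apply: (@le_trans _ _ (\sum_(i < m.+1) p ^+ m)); last first.
    by rewrite sumr_const card_ord mulr_natl.
  apply: ler_sum => i _; have im : (i <= m)%N by rewrite -ltnS.
  have -> : p ^+ m = p ^+ (m - i) * p ^+ i by rewrite -exprD subnK.
  rewrite /= ler_wpM2l ?exprn_ge0 ?(ltW p0)//.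
  by rewrite lerXn2r ?nnegrE ?(ltW r0) ?(ltW p0).
have s2 : m.+1%:R * r ^+ m <= \sum_(i < m.+1) p ^+ (m.+1.-1 - i) * r ^+ i.
  apply: (@le_trans _ _ (\sum_(i < m.+1) r ^+ m)).
    by rewrite sumr_const card_ord mulr_natl.
  apply: ler_sum => i _; have im : (i <= m)%N by rewrite -ltnS.
  have -> : r ^+ m = r ^+ (m - i) * r ^+ i by rewrite -exprD subnK.
  rewrite /= ler_wpM2r ?exprn_ge0 ?(ltW r0)//.
  by rewrite lerXn2r ?nnegrE ?(ltW r0) ?(ltW p0).
have p0' := ltW p0; have r0' := ltW r0.
have tpr : 0 <= t * (p * r) by rewrite !mulr_ge0.
split.
- apply: (@le_trans _ _ (t * (p * r) * (m.+1%:R * r ^+ m))); last by rewrite ler_wpM2l.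
  have -> : m.+1%:R * t * r ^+ m.+2 = (m.+1%:R * t * r ^+ m.+1) * r by rewrite (exprSr r m.+1); ring.
  have -> : t * (p * r) * (m.+1%:R * r ^+ m) = (m.+1%:R * t * r ^+ m.+1) * p by rewrite exprS; ring.
  by rewrite ler_wpM2l// !mulr_ge0 ?exprn_ge0.
- apply: (@le_trans _ _ (t * (p * r) * (m.+1%:R * p ^+ m))); first by rewrite ler_wpM2l.
  have -> : m.+1%:R * t * p ^+ m.+2 = (m.+1%:R * t * p ^+ m.+1) * p by rewrite (exprSr p m.+1); ring.
  have -> : t * (p * r) * (m.+1%:R * p ^+ m) = (m.+1%:R * t * p ^+ m.+1) * r by rewrite exprS; ring.
  by rewrite ler_wpM2l// !mulr_ge0 ?exprn_ge0.
Qed.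

End PowerBounds.

(** * Asymptotics of weighted sums *)

Section Tauberian.
Variables (R : realType) (la : nat -> R).
Hypothesis la0 : forall n, 0 <= la n.
Implicit Types (a : nat -> R) (k A g u : R) (h : R -> R) (m j : nat).

Definition admissible a A : Prop :=
  [/\ forall n, 0 <= a n, 0 <= A,
      exists2 K, 0 < K & forall k, K <= k -> cvgn (rsum a la (k ^+ 2)) &
      k ^+ 3 * limn (rsum a la (k ^+ 2)) @[k --> +oo] --> A].

Definition weight k n : R := k ^+ 2 / (la n + k ^+ 2).

Definition wsum a h k (N : nat) : R := \sum_(n < N) a n * h (weight k n).

(** The constant g depends on the weight function h alone and not on the
    sequence a.  This is what makes ratios of averages independent of h. *)
Definition averages_to h g : Prop := forall a A, admissible a A ->
  (exists2 K, 0 < K & forall k, K <= k -> cvgn (wsum a h k)) /\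
  (k^-1 * limn (wsum a h k) @[k --> +oo] --> A * g).

Lemma weight_gt0 k n : 0 < k -> 0 < weight k n.
Proof. by move=> k0; rewrite divr_gt0 ?exprn_gt0// ltr_wpDl// exprn_gt0. Qed.

Lemma weight_itv k n : 0 < k -> 0 <= weight k n <= 1.
Proof.
move=> k0; rewrite ltW ?weight_gt0//= ler_pdivrMr ?mul1r ?lerDr//.
by rewrite ltr_wpDl// exprn_gt0.
Qed.

Lemma wsum_sqrE a k N : wsum a (fun u => u ^+ 2) k N = k ^+ 4 * rsum a la (k ^+ 2) N.
Proof.
rewrite /wsum /rsum mulr_sumr; apply: eq_bigr => n _.
by rewrite /weight expr_div_n -exprM mulrCA.
Qed.

Lemma averages_sqr : averages_to (fun u => u ^+ 2) 1.
Proof.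
move=> a A [a0 A0 [K K0 cK] cA].
have cv k : cvgn (rsum a la (k ^+ 2)) ->
    wsum a (fun u => u ^+ 2) k @ \oo --> k ^+ 4 * limn (rsum a la (k ^+ 2)).
  move=> c; rewrite (_ : wsum _ _ _ = fun N => k ^+ 4 * rsum a la (k ^+ 2) N).
    exact: cvgMl_tmp.
  by apply/funext => N; exact: wsum_sqrE.
split.
  by exists K => // k /cK/cv c; apply/cvg_ex; eexists; exact: c.
rewrite mulr1; apply: cvg_trans cA; apply: near_eq_cvg; near=> k.
have kK : K <= k by near: k; apply: nbhs_pinfty_ge; exact: num_real.
rewrite (cvg_lim (@Rhausdorff R) (cv k (cK k kK))).
by field; rewrite gt_eqF// (lt_le_trans K0).
Unshelve. all: by end_near. Qed.

Lemma averages_add h1 h2 g1 g2 : averages_to h1 g1 -> averages_to h2 g2 ->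
  averages_to (fun u => h1 u + h2 u) (g1 + g2).
Proof.
move=> l1 l2 a A aA; have [[K1 K10 c1] v1] := l1 _ _ aA; have [[K2 K20 c2] v2] := l2 _ _ aA.
have e k : wsum a (fun u => h1 u + h2 u) k = wsum a h1 k \+ wsum a h2 k.
  apply/funext => N; rewrite /wsum /= -big_split/=; apply: eq_bigr => n _.
  by rewrite mulrDr.
have cv k : K1 <= k -> K2 <= k ->
    wsum a (fun u => h1 u + h2 u) k @ \oo --> limn (wsum a h1 k) + limn (wsum a h2 k).
  by move=> k1 k2; rewrite e; apply: cvgD; [exact: c1|exact: c2].
split.
  exists (Num.max K1 K2); first by rewrite lt_max K10.
  move=> k; rewrite ge_max => /andP[k1 k2].
  by apply/cvg_ex; eexists; exact: (cv k k1 k2).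
rewrite mulrDr; apply: cvg_trans (cvgD v1 v2); apply: near_eq_cvg; near=> k.
have k1 : K1 <= k by near: k; apply: nbhs_pinfty_ge; exact: num_real.
have k2 : K2 <= k by near: k; apply: nbhs_pinfty_ge; exact: num_real.
by rewrite (cvg_lim (@Rhausdorff R) (cv k k1 k2)) mulrDr.
Unshelve. all: by end_near. Qed.

Lemma averages_scale h g (c : R) : averages_to h g -> averages_to (fun u => c * h u) (c * g).
Proof.
move=> l a A aA; have [[K K0 cK] v] := l _ _ aA.
have cv k : K <= k -> wsum a (fun u => c * h u) k @ \oo --> c * limn (wsum a h k).
  move=> kK; rewrite (_ : wsum _ _ _ = fun N => c * wsum a h k N).
    by apply: cvgMl_tmp; exact: cK.
  by apply/funext => N; rewrite /wsum mulr_sumr; apply: eq_bigr => n _; rewrite mulrCA.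
split.
  by exists K => // k kK; apply/cvg_ex; eexists; exact: (cv k kK).
have v' : c * (k^-1 * limn (wsum a h k)) @[k --> +oo] --> c * (A * g) by exact: cvgMl_tmp.
rewrite mulrCA; apply: cvg_trans v'; apply: near_eq_cvg; near=> k.
have kK : K <= k by near: k; apply: nbhs_pinfty_ge; exact: num_real.
by rewrite (cvg_lim (@Rhausdorff R) (cv k kK)) mulrCA.
Unshelve. all: by end_near. Qed.

Lemma wsum_nondecreasing a h k : (forall n, 0 <= a n) -> 0 < k ->
  (forall u, 0 <= u <= 1 -> 0 <= h u) -> nondecreasing_seq (wsum a h k).
Proof.
move=> a0 k0 h0; apply/nondecreasing_seqP => N; rewrite /wsum big_ord_recr/= lerDl.
by rewrite mulr_ge0// h0// weight_itv.
Qed.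

(** The inverse of the weight is la n / k^2 + 1, and that of the rescaled weight
    at th * k is la n / k^2 + th^2. *)
Lemma weight_scale (th k : R) n : 1 < th -> 0 < k ->
  0 < th ^- 2 * weight (th * k) n /\ th ^- 2 * weight (th * k) n <= weight k n /\
  (th ^- 2 * weight (th * k) n)^-1 - (weight k n)^-1 = th ^+ 2 - 1.
Proof.
move=> th1 k0; have th0 : 0 < th by exact: lt_trans th1.
have D1 : 0 < la n + k ^+ 2 by rewrite ltr_wpDl// exprn_gt0.
have D2 : 0 < la n + (th * k) ^+ 2 by rewrite ltr_wpDl// exprn_gt0// mulr_gt0.
have e : th ^- 2 * weight (th * k) n = k ^+ 2 / (la n + (th * k) ^+ 2).
  by rewrite /weight; field; rewrite !gt_eqF.
rewrite e; split; first by rewrite divr_gt0// exprn_gt0.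
split.
  rewrite /weight ler_wpM2l ?sqr_ge0// lef_pV2 ?posrE//.
  rewrite lerD2l lerXn2r ?nnegrE ?ler_peMl ?mulr_ge0 ?ltW//.
by rewrite /weight; field; rewrite !gt_eqF.
Qed.

(** Consecutive moments control each other: the difference quotient in the scale
    of the m-th moment lies between two values of the (m+1)-st. *)
Lemma wsum_step a m (th k : R) : (forall n, 0 <= a n) -> 1 < th -> 0 < k ->
  cvgn (wsum a (fun u => u ^+ m) k) -> cvgn (wsum a (fun u => u ^+ m) (th * k)) ->
  cvgn (wsum a (fun u => u ^+ m.+1) k) -> cvgn (wsum a (fun u => u ^+ m.+1) (th * k)) ->
  let S i x := limn (wsum a (fun u => u ^+ i) x) in
  m%:R * (th ^+ 2 - 1) * (th ^- 2 ^+ m.+1 * S m.+1 (th * k)) <=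
    S m k - th ^- 2 ^+ m * S m (th * k) /\
  S m k - th ^- 2 ^+ m * S m (th * k) <= m%:R * (th ^+ 2 - 1) * S m.+1 k.
Proof.
move=> a0 th1 k0 c1 c2 c3 c4 S.
have t0 : 0 <= th ^+ 2 - 1 by rewrite subr_ge0 exprn_ege1// ltW.
have pd n := power_diff m (weight_scale n th1 k0).1 (weight_scale n th1 k0).2.1
   (weight_scale n th1 k0).2.2 t0.
have cm i (c x : R) : cvgn (wsum a (fun u => u ^+ i) x) ->
    c * wsum a (fun u => u ^+ i) x N @[N --> \oo] --> c * S i x.
  by move=> ci; apply: cvgMl_tmp.
have cD : wsum a (fun u => u ^+ m) k N - th ^- 2 ^+ m * wsum a (fun u => u ^+ m) (th * k) N
    @[N --> \oo] --> S m k - th ^- 2 ^+ m * S m (th * k).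
  by apply: cvgB; [exact: c1 | exact: cm].
split.
- rewrite mulrA.
  have H1 := cm m.+1 (m%:R * (th ^+ 2 - 1) * th ^- 2 ^+ m.+1) (th * k) c4.
  refine (ler_cvg_to H1 cD _).
  apply: nearW => N; rewrite /wsum !mulr_sumr -sumrB; apply: ler_sum => n _.
  have [h _] := pd n; have := ler_wpM2l (a0 n) h.
  rewrite !exprMn => h'; apply: le_trans (le_trans h' _); rewrite le_eqVlt;
    apply/orP; left; apply/eqP; ring.
- refine (ler_cvg_to cD (cm m.+1 (m%:R * (th ^+ 2 - 1)) k c3) _).
  apply: nearW => N; rewrite /wsum !mulr_sumr -sumrB; apply: ler_sum => n _.
  have [_ h] := pd n; have := ler_wpM2l (a0 n) h.
  rewrite !exprMn => h'; apply: le_trans (le_trans _ h') _; rewrite le_eqVlt;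
    apply/orP; left; apply/eqP; ring.
Qed.

Lemma cvg_scale (F : R -> R) (l c : R) : 0 < c ->
  F k @[k --> +oo] --> l -> F (c * k) @[k --> +oo] --> l.
Proof.
move=> c0 Fl; have h : c * k @[k --> +oo] --> +oo by apply: gt0_cvgMry => //; exact: cvg_id.
exact: cvg_comp h Fl.
Qed.

(** The m-th moment grows like G k.  In [wsum_step] the difference is then
    about G k (1 - th^(1 - 2 m)), which has to be divided by m (th^2 - 1); the
    quotient tends to G (2 m - 1) / (2 m) as th tends to 1.  Fixing th close to 1
    before k tends to infinity gives the limit of the next moment. *)
Lemma averages_succ m g : (0 < m)%N -> 0 <= g -> averages_to (fun u => u ^+ m) g ->
  averages_to (fun u => u ^+ m.+1) (g * ((2 * m).-1%:R / (2 * m)%:R)).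
Proof.
move=> m0 g0 l a A aA; have [a0 A0 _ _] := aA; have [[K K0 cK] v] := l _ _ aA.
(* The exponent j = 2 m - 1 combines th^(- 2 m) with the factor th from k^-1. *)
set j := (2 * m).-1; have j1 : j.+1 = (2 * m)%N by rewrite /j prednK// muln_gt0.
set r : R := j%:R / (2 * m)%:R.
have r0 : 0 <= r by rewrite divr_ge0.
have mp : 0 < m%:R :> R by rewrite ltr0n.
have c' k : K <= k -> cvgn (wsum a (fun u => u ^+ m.+1) k).
  move=> kK; have k0 : 0 < k by exact: lt_le_trans kK.
  apply: nondecreasing_is_cvgn.
    by apply: wsum_nondecreasing => // u /andP[u0 _]; rewrite exprn_ge0.
  exists (limn (wsum a (fun u => u ^+ m) k)) => _ [N _ <-].
  have nd : nondecreasing_seq (wsum a (fun u => u ^+ m) k).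
    by apply: wsum_nondecreasing => // u /andP[u0 _]; rewrite exprn_ge0.
  apply: le_trans (nondecreasing_cvgn_le nd (cK k kK) N).
  apply: ler_sum => n _; rewrite ler_wpM2l//.
  have /andP[w0 w1] := weight_itv n k0.
  by rewrite ler_wiXn2l.
split; first by exists K.
set X := fun i k => k^-1 * limn (wsum a (fun u => u ^+ i) k).
rewrite -/(X m.+1).
have vX : X m k @[k --> +oo] --> A * g by exact: v.
set G := A * g in vX.
have G0 : 0 <= G by rewrite mulr_ge0.
rewrite mulrA -/G; clearbody G.
(* The upper bound comes from the scales k / th and k, the lower from k and th * k. *)
have sand th k : 1 < th -> K * th <= k ->
    (X m k - th ^- j * X m (th * k)) / (m%:R * (th ^+ 2 - 1)) <= X m.+1 k /\
    X m.+1 k <= th ^+ (j + 2) * (X m (th^-1 * k) - th ^- j * X m k) / (m%:R * (th ^+ 2 - 1)).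
  move=> th1 kK; have th0 : 0 < th by exact: lt_trans th1.
  have k0 : 0 < k by apply: lt_le_trans kK; rewrite mulr_gt0.
  have t0 : 0 < th ^+ 2 - 1 by rewrite subr_gt0 exprn_egt1.
  have D0 : 0 < m%:R * (th ^+ 2 - 1) by rewrite mulr_gt0.
  have kK' : K <= k by apply: le_trans kK; rewrite ler_peMr ?ltW.
  have kK2 : K <= th^-1 * k by rewrite mulrC ler_pdivlMr.
  have k20 : 0 < th^-1 * k by rewrite mulr_gt0 ?invr_gt0.
  have thk : K <= th * k by apply: le_trans kK' _; rewrite ler_peMl ?ltW.
  have e2 : th * (th^-1 * k) = k by rewrite mulVKf ?gt_eqF.
  have thj : th ^+ (2 * m) = th ^+ j * th by rewrite -j1 exprSr.
  split.
  - have [_ h] := wsum_step a0 th1 k0 (cK _ kK') (cK _ thk) (c' _ kK') (c' _ thk).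
    rewrite ler_pdivrMr// /X.
    have := ler_wpM2l (ltW (_ : 0 < k^-1)) h; rewrite invr_gt0 => /(_ k0).
    set S1 : R := limn (wsum a (fun u => u ^+ m) k).
    set S2 : R := limn (wsum a (fun u => u ^+ m) (th * k)).
    set S3 : R := limn (wsum a (fun u => u ^+ m.+1) k).
    have -> : k^-1 * (S1 - th ^- 2 ^+ m * S2) = k^-1 * S1 - th ^- j * ((th * k)^-1 * S2).
      by rewrite exprVn -exprM thj; field; rewrite !gt_eqF// exprn_gt0.
    by move=> /le_trans; apply; rewrite le_eqVlt; apply/orP; left; apply/eqP; ring.
  - have := wsum_step a0 th1 k20 (cK _ kK2) _ (c' _ kK2) _.
    rewrite e2 => /(_ (cK _ kK') (c' _ kK'))[h _].
    rewrite ler_pdivlMr// /X.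
    set S1 : R := limn (wsum a (fun u => u ^+ m) (th^-1 * k)) in h *.
    set S2 : R := limn (wsum a (fun u => u ^+ m) k) in h *.
    set S3 : R := limn (wsum a (fun u => u ^+ m.+1) k) in h *.
    have p0 : 0 <= th ^+ (j + 3) * k^-1 by rewrite mulr_ge0 ?exprn_ge0 ?invr_ge0 ?ltW.
    have := ler_wpM2l p0 h.
    have -> : th ^+ (j + 3) * k^-1 * (m%:R * (th ^+ 2 - 1) * (th ^- 2 ^+ m.+1 * S3)) =
        k^-1 * S3 * (m%:R * (th ^+ 2 - 1)).
      rewrite exprVn -exprM mulnS (exprD th 2 (2 * m)) thj (exprD th j 3).
      by field; rewrite !gt_eqF// exprn_gt0.
    move=> /le_trans; apply; rewrite le_eqVlt; apply/orP; left; apply/eqP.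
    rewrite exprVn -exprM thj (exprD th j 3) (exprD th j 2).
    by field; rewrite ?mulf_neq0 ?invr_neq0 ?gt_eqF// exprn_gt0.
have lo th : 1 < th -> G * r * th ^- (j + 1) <= (G - th ^- j * G) / (m%:R * (th ^+ 2 - 1)).
  move=> th1; have th0 : 0 < th by exact: lt_trans th1.
  have t0 : 0 < th ^+ 2 - 1 by rewrite subr_gt0 exprn_egt1.
  have D0 : 0 < m%:R * (th ^+ 2 - 1) by rewrite mulr_gt0.
  have tj : 0 < th ^+ j by rewrite exprn_gt0.
  have s : j%:R * (th - 1) <= th ^+ j - 1.
    rewrite subrX1 mulrC ler_wpM2l ?subr_ge0 ?(ltW th1)//.
    have -> : j%:R = \sum_(i < j) (1 : R) by rewrite sumr_const card_ord.
    apply: ler_sum => i _.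
    by rewrite exprn_ege1// ltW.
  rewrite ler_pdivlMr// /r natrM.
  have -> : G - th ^- j * G = G * (th ^- j) * (th ^+ j - 1) by field; rewrite gt_eqF.
  rewrite -!mulrA ler_wpM2l// exprD expr1.
  have -> : j%:R * ((2 * m%:R)^-1 * ((th ^+ j * th)^-1 * (m%:R * (th ^+ 2 - 1)))) =
      th ^- j * (j%:R * (th - 1) * ((th + 1) / (2 * th))).
    by field; rewrite !gt_eqF.
  have tji : 0 <= th ^- j by rewrite invr_ge0 ltW.
  apply: (ler_wpM2l tji).
  apply: (le_trans _ s).
  rewrite ler_piMr ?mulr_ge0 ?subr_ge0 ?(ltW th1)//.
  by rewrite ler_pdivrMr ?mulr_gt0// mul1r; lra.
have up th : 1 < th ->
    th ^+ (j + 2) * (G - th ^- j * G) / (m%:R * (th ^+ 2 - 1)) <= G * r * th ^+ (j + 2).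
  move=> th1; have th0 : 0 < th by exact: lt_trans th1.
  have t0 : 0 < th ^+ 2 - 1 by rewrite subr_gt0 exprn_egt1.
  have D0 : 0 < m%:R * (th ^+ 2 - 1) by rewrite mulr_gt0.
  have tj : 0 < th ^+ j by rewrite exprn_gt0.
  have s : th ^+ j - 1 <= j%:R * th ^+ j * (th - 1).
    rewrite subrX1 mulrC ler_wpM2r ?subr_ge0 ?(ltW th1)//.
    have -> : j%:R * th ^+ j = \sum_(i < j) th ^+ j by rewrite sumr_const card_ord mulr_natl.
    apply: ler_sum => i _.
    by rewrite ler_weXn2l ?(ltW th1)// ltnW.
  rewrite ler_pdivrMr// /r natrM.
  have -> : th ^+ (j + 2) * (G - th ^- j * G) = G * (th ^+ 2 * (th ^+ j - 1)).
    by rewrite exprD; field; rewrite gt_eqF.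
  have -> : G * (j%:R / (2 * m%:R)) * th ^+ (j + 2) * (m%:R * (th ^+ 2 - 1)) =
      G * (th ^+ 2 * (j%:R * th ^+ j * (th - 1) * ((th + 1) / 2))).
    by rewrite exprD; field; rewrite !gt_eqF.
  apply: (ler_wpM2l G0).
  apply: (ler_wpM2l (sqr_ge0 th)).
  apply: le_trans s _.
  rewrite ler_peMr ?mulr_ge0 ?subr_ge0 ?(ltW th1)//; first by rewrite ltW.
  by rewrite ler_pdivlMr// mul1r; lra.
apply/cvgrPdist_le => e e0.
have [th th1 [thl thu]] : exists2 th, 1 < th &
    G * r - e / 2 <= G * r * th ^- (j + 1) /\ G * r * th ^+ (j + 2) <= G * r + e / 2.
  have e20 : 0 < e / 2 by rewrite divr_gt0.
  have cX i : G * r * th ^+ i @[th --> (1 : R)] --> G * r * 1 ^+ i.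
    by apply: cvgMl_tmp; exact: exprn_continuous.
  have cV i : G * r * th ^- i @[th --> (1 : R)] --> G * r * (1 ^+ i)^-1.
    apply: cvgMl_tmp; apply: cvgV; first by rewrite expr1n oner_eq0.
    exact: exprn_continuous.
  have /cvgrPdist_le/(_ _ e20) n1 := cV (j + 1)%N.
  have /cvgrPdist_le/(_ _ e20) n2 := cX (j + 2)%N.
  have : \forall th \near (1 : R)^'+, 1 < th /\
     (G * r - e / 2 <= G * r * th ^- (j + 1) /\ G * r * th ^+ (j + 2) <= G * r + e / 2).
    near=> th; split; first by near: th; exact: nbhs_right_gt.
    have h1 : `|G * r * (1 ^+ (j + 1))^-1 - G * r * th ^- (j + 1)| <= e / 2.
      by near: th; apply: cvg_within; exact: n1.
    have h2 : `|G * r * 1 ^+ (j + 2) - G * r * th ^+ (j + 2)| <= e / 2.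
      by near: th; apply: cvg_within; exact: n2.
    move: h1 h2; rewrite !expr1n invr1 !mulr1 !ler_norml => /andP[? ?] /andP[? ?].
    by split; lra.
  by move=> /filter_ex[th [h1 h2]]; exists th.
have th0 : 0 < th by exact: lt_trans th1.
have e20 : 0 < e / 2 by rewrite divr_gt0.
have thi0 : 0 < th^-1 by rewrite invr_gt0.
have cl : (X m k - th ^- j * X m (th * k)) / (m%:R * (th ^+ 2 - 1)) @[k --> +oo] -->
    (G - th ^- j * G) / (m%:R * (th ^+ 2 - 1)).
  apply: cvgMr_tmp; apply: cvgB => //; apply: cvgMl_tmp; exact: cvg_scale.
have cu : th ^+ (j + 2) * (X m (th^-1 * k) - th ^- j * X m k) / (m%:R * (th ^+ 2 - 1)) @[k --> +oo] -->
    th ^+ (j + 2) * (G - th ^- j * G) / (m%:R * (th ^+ 2 - 1)).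
  apply: cvgMr_tmp; apply: cvgMl_tmp; apply: cvgB; last by apply: cvgMl_tmp.
  exact: cvg_scale.
have /cvgrPdist_le/(_ _ e20) n1 := cl.
have /cvgrPdist_le/(_ _ e20) n2 := cu.
have lo1 := lo th th1; have up1 := up th th1.
near=> k.
have kK : K * th <= k by near: k; apply: nbhs_pinfty_ge; exact: num_real.
have [s1 s2] := sand th k th1 kK.
have h1 : `|(G - th ^- j * G) / (m%:R * (th ^+ 2 - 1)) -
   (X m k - th ^- j * X m (th * k)) / (m%:R * (th ^+ 2 - 1))| <= e / 2 by near: k.
have h2 : `|th ^+ (j + 2) * (G - th ^- j * G) / (m%:R * (th ^+ 2 - 1)) -
   th ^+ (j + 2) * (X m (th^-1 * k) - th ^- j * X m k) / (m%:R * (th ^+ 2 - 1))| <= e / 2 by near: k.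
move: h1 h2 s1 s2 lo1 up1; rewrite -/(X m.+1 k).
set y1 := _ / _; set y2 := _ / (m%:R * _); set y3 := (th ^+ (j + 2) * _) / _.
set y4 := _ * _ / _ => h1 h2 s1 s2 lo1 up1.
move: h1 h2; rewrite !ler_norml => /andP[? ?] /andP[? ?].
by apply/andP; split; lra.
Unshelve. all: by end_near. Qed.

End Tauberian.

(** * The Tauberian theorem *)

Section TauberianTheorem.
Variables (R : realType) (la : nat -> R).
Hypothesis la0 : forall n, 0 <= la n.
Hypothesis la_sorted : forall m n, (m <= n)%N -> la m <= la n.
Variable B : R.
Hypothesis B0 : 0 < B.
Hypothesis adm1 : admissible la (fun=> 1) B.
Implicit Types (a : nat -> R) (k A g u : R) (h : R -> R) (m j : nat).

Lemma averages_ext h1 h2 g1 g2 : h1 =1 h2 -> g1 = g2 -> averages_to la h1 g1 -> averages_to la h2 g2.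
Proof. by move=> /funext -> ->. Qed.

Lemma averages0 : averages_to la (fun=> 0) 0.
Proof.
apply: (@averages_ext (fun u => 0 * u ^+ 2) _ (0 * 1)); first by move=> u; rewrite mul0r.
  by rewrite mul0r.
exact: (averages_scale 0 (@averages_sqr R la)).
Qed.

Lemma averages_pow m : exists2 g, 0 <= g & averages_to la (fun u => u ^+ m.+2) g.
Proof.
elim: m => [|m [g g0 lg]]; first by exists 1 => //; exact: (@averages_sqr R la).
exists (g * ((2 * m.+2).-1%:R / (2 * m.+2)%:R)); first by rewrite mulr_ge0// divr_ge0.
exact: (averages_succ la0 _ g0 lg).
Qed.

Lemma averages_poly (p : {poly R}) : p`_0 = 0 -> p`_1 = 0 -> exists g, averages_to la (fun u => p.[u]) g.
Proof.
move=> p0 p1.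
suff [g lg] : exists g, averages_to la (fun u => \sum_(i < size p) p`_i * u ^+ i) g.
  by exists g; apply: averages_ext lg => // u; rewrite horner_coef.
elim: (size p) => [|n [g lg]].
  by exists 0; apply: averages_ext averages0 => // u; rewrite big_ord0.
have [g' lg'] : exists g, averages_to la (fun u => p`_n * u ^+ n) g.
  case: n {lg} => [|[|n]].
  - by exists 0; apply: averages_ext averages0 => // u; rewrite p0 mul0r.
  - by exists 0; apply: averages_ext averages0 => // u; rewrite p1 mul0r.
  - by have [g' _ lg'] := averages_pow n; exists (p`_n.+2 * g'); exact: (averages_scale _ lg').
exists (g + g'); apply: averages_ext (averages_add lg lg') => // u.
by rewrite big_ord_recr.
Qed.

(** The polynomial [step] starts with the power j > 1, so its constant exists by
    [averages_poly]; comparison with 0 and 4 u^2 for the sequence 1 bounds this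
    constant independently of j. *)
Lemma averages_step j : (1 < j)%N -> exists g, [/\ 0 <= g, g <= 4 & averages_to la (step j) g].
Proof.
move=> j1; pose p : {poly R} := 1 - (1 - 'X^j) ^+ (2 ^ j).
have pE u : p.[u] = step j u by rewrite /p /step !hornerE.
have pX : p = 'X^j * \sum_(i < 2 ^ j) (1 - 'X^j) ^+ i.
  rewrite /p -opprB subrX1; set S := \sum_(_ < _) _.
  by ring.
have pc i : (i < 2)%N -> p`_i = 0.
  by move=> i2; rewrite pX coefXnM (leq_trans i2 j1).
have [g lg] := averages_poly (pc 0%N isT) (pc 1%N isT).
have {}lg : averages_to la (step j) g by apply: averages_ext lg.
exists g; have [[K K0 cK] v] := lg _ _ adm1.
have [[K' K'0 cK'] v'] := averages_sqr adm1.
have one0 : forall n : nat, 0 <= (fun=> 1 : R) n by move=> _.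
split => //.
- rewrite -(pmulr_rge0 _ B0); apply: (@ler_cvg_to _ _ _ _ (cst 0)) v _; first exact: cvg_cst.
  near=> k; have kK : K <= k by near: k; apply: nbhs_pinfty_ge; exact: num_real.
  have k0 : 0 < k by exact: lt_le_trans kK.
  rewrite /cst mulr_ge0 ?invr_ge0 ?(ltW k0)//; apply: limr_ge; first exact: cK.
  apply: nearW => N; apply: sumr_ge0 => n _; rewrite mul1r.
  by have /andP[] := step_itv j (weight_itv la0 n k0).
- rewrite -(ler_pM2l B0) -[leRHS]mulr1 -mulrA; rewrite [4 * 1]mulrC mulrA.
  have v4 : k^-1 * limn (wsum la (fun=> 1) (fun u => u ^+ 2) k) * 4 @[k --> +oo] --> B * 1 * 4.
    exact: cvgMr_tmp.
  refine (ler_cvg_to v v4 _).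
  near=> k; have kK : K <= k by near: k; apply: nbhs_pinfty_ge; exact: num_real.
  have kK' : K' <= k by near: k; apply: nbhs_pinfty_ge; exact: num_real.
  have k0 : 0 < k by exact: lt_le_trans kK.
  rewrite -mulrA ler_wpM2l ?invr_ge0 ?(ltW k0)//.
  have c4 : wsum la (fun=> 1) (fun u => u ^+ 2) k N * 4 @[N --> \oo] -->
      limn (wsum la (fun=> 1) (fun u => u ^+ 2) k) * 4 by apply: cvgMr_tmp; exact: cK'.
  refine (ler_cvg_to (cK k kK) c4 _).
  apply: nearW => N; rewrite /wsum mulr_suml; apply: ler_sum => n _.
  by rewrite !mul1r mulrC; exact: step_le_sqr (weight_itv la0 n k0).
Unshelve. all: by end_near. Qed.

Lemma head_upper a h k N (c : R) : (forall n, 0 <= a n) -> 0 < k ->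
  (forall u, 0 <= u <= 1 -> 0 <= h u) -> (forall n, (n < N)%N -> c <= h (weight la k n)) ->
  cvgn (wsum la a h k) -> c * \sum_(n < N) a n <= limn (wsum la a h k).
Proof.
move=> a0 k0 h0 ch cv.
apply: le_trans (nondecreasing_cvgn_le (wsum_nondecreasing la0 a0 k0 h0) cv N).
rewrite mulr_sumr; apply: ler_sum => n _.
by rewrite mulrC ler_wpM2l// ch.
Qed.

(** The terms from N on are paid for by a multiple of the second moment, which
    is asymptotically known even at another scale k'. *)
Lemma tail_lower a h k k' N (c : R) : (forall n, 0 <= a n) -> 0 < k -> 0 <= c ->
  (forall u, 0 <= u <= 1 -> h u <= 1) ->
  (forall n, (N <= n)%N -> h (weight la k n) <= c * weight la k' n ^+ 2) ->
  cvgn (wsum la a h k) -> cvgn (wsum la a (fun u => u ^+ 2) k') ->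
  limn (wsum la a h k) - c * limn (wsum la a (fun u => u ^+ 2) k') <= \sum_(n < N) a n.
Proof.
move=> a0 k0 c0 h1 hc cv cv'.
pose D M := wsum la a h k M - c * wsum la a (fun u => u ^+ 2) k' M.
have cD : D @ \oo --> limn (wsum la a h k) - c * limn (wsum la a (fun u => u ^+ 2) k').
  by apply: cvgB => //; apply: cvgMl_tmp.
have DS M : D M.+1 = D M + a M * (h (weight la k M) - c * weight la k' M ^+ 2).
  by rewrite /D /wsum !big_ord_recr/=; ring.
have DN i : D (N + i)%N <= \sum_(n < N) a n.
  elim: i => [|i IH]; last first.
    rewrite addnS DS; apply: le_trans IH; rewrite gerDl.
    by rewrite mulr_ge0_le0// subr_le0 hc// leq_addr.
  rewrite addn0 /D; apply: (@le_trans _ _ (wsum la a h k N)).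
    rewrite gerBl mulr_ge0//; apply: sumr_ge0 => n _.
    by rewrite mulr_ge0// sqr_ge0.
  apply: ler_sum => n _; rewrite -[leRHS]mulr1 ler_wpM2l// h1//.
  exact: weight_itv.
rewrite -(cvg_lim (@Rhausdorff R) cD); apply: limr_le.
  by apply/cvg_ex; eexists; exact: cD.
near=> M; have NM : (N <= M)%N by near: M; exact: nbhs_infty_ge.
by rewrite -(subnKC NM).
Unshelve. all: by end_near. Qed.

(** Otherwise the resolvent sum of the sequence 1 would diverge. *)
Lemma la_unbounded (C : R) : \forall N \near \oo, C <= la N.
Proof.
have [N0 CN0] : exists N0, C <= la N0.
  apply: contrapT => /forallNP nC.
  have laC n : la n <= C by have /negP := nC n; rewrite -ltNge => /ltW.
  have [_ _ [K K0 cK] _] := adm1.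
  have C0 : 0 <= C by apply: le_trans (laC 0%N).
  have D0 : 0 < (C + K ^+ 2) ^+ 2 by rewrite exprn_gt0// ltr_wpDl// exprn_gt0.
  pose L : R := limn (rsum (fun=> 1) la (K ^+ 2)).
  have one0 : forall n : nat, 0 <= (fun=> 1 : R) n by move=> _.
  have LN N : N%:R <= L * (C + K ^+ 2) ^+ 2.
    rewrite -ler_pdivrMr//.
    apply: le_trans (nondecreasing_cvgn_le (rsum_nondecreasing la (K ^+ 2) one0) (cK K (lexx K)) N).
    rewrite /rsum -[X in X%:R]card_ord -sumr_const mulr_suml.
    apply: ler_sum => n _; rewrite !mul1r.
    have dn : 0 < la n + K ^+ 2 by rewrite ltr_wpDl// exprn_gt0.
    have cn : la n + K ^+ 2 <= C + K ^+ 2 by rewrite lerD2r.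
    have sq : (la n + K ^+ 2) ^+ 2 <= (C + K ^+ 2) ^+ 2.
      by rewrite lerXn2r ?nnegrE ?(ltW dn)// (le_trans (ltW dn)).
    by rewrite lef_pV2 ?posrE// exprn_gt0.
  have L0 : 0 <= L * (C + K ^+ 2) ^+ 2 by exact: LN 0%N.
  by have := archi_boundP L0; rewrite ltNge LN.
near=> N; apply: le_trans CN0 _; apply: la_sorted; near: N; exact: nbhs_infty_ge.
Unshelve. all: by end_near. Qed.

(** The scale at which the weight of the index N passes through 1/2. *)
Definition freq N : R := Num.sqrt (la N).

Lemma freq_cvgy : freq N @[N --> \oo] --> +oo.
Proof.
apply/cvgryPge => C; near=> N.
have h : `|C| ^+ 2 <= la N by near: N; exact: la_unbounded.
apply: (le_trans (ler_norm C)).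
by rewrite /freq -[leLHS]normr_id -sqrtr_sqr ler_sqrt.
Unshelve. all: by end_near. Qed.

Lemma cvg_freq (F : R -> R) (l : R) :
  F k @[k --> +oo] --> l -> F (freq N) @[N --> \oo] --> l.
Proof. by move=> Fl; exact: cvg_comp freq_cvgy Fl. Qed.

Lemma freq_sqr N : freq N ^+ 2 = la N.
Proof. by rewrite /freq sqr_sqrtr. Qed.

(** The scales freq N / rho and rho * freq N are above and below the
    scale of N.  At the first one the weights of all indices below N exceed
    1/2 by a fixed factor ([weight_head]), at the second one those of all
    other indices stay below 1/2 by a fixed factor ([weight_tail]). *)
Section Window.
Variables (rho : R) (j : nat).
Hypotheses (rho0 : 0 < rho) (rho1 : rho < 1) (j1 : (1 < j)%N).
Let sg := 2 / (1 + rho ^+ 2).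
Let ta := 2 * rho ^+ 2 / (1 + rho ^+ 2).

Let den0 : 0 < 1 + rho ^+ 2. Proof. by rewrite ltr_pwDl// sqr_ge0. Qed.
Let r2 : rho ^+ 2 < 1. Proof. by rewrite exprn_ilt1// ltW. Qed.
Let sg1 : 1 < sg. Proof. by rewrite /sg ltr_pdivlMr// mul1r; move: r2; lra. Qed.
Let sgj : 0 < 1 - sg ^- j.
Proof.
rewrite subr_gt0 invf_lt1 ?exprn_gt0 ?(lt_trans ltr01)//.
by rewrite exprn_egt1// -lt0n ltnW.
Qed.
Let ta0 : 0 <= ta. Proof. by rewrite divr_ge0 ?mulr_ge0 ?sqr_ge0// ltW. Qed.

Lemma weight_head N n : 0 < freq N -> (n < N)%N -> sg <= 2 * weight la (rho^-1 * freq N) n.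
Proof.
move=> k0 nN; have lan : la n <= freq N ^+ 2 by rewrite freq_sqr; apply: la_sorted; exact: ltnW.
have d0 : 0 < la n + (rho^-1 * freq N) ^+ 2.
  by rewrite ltr_wpDl// exprn_gt0// mulr_gt0// invr_gt0.
rewrite /sg /weight ler_wpM2l//.
have -> : (1 + rho ^+ 2)^-1 = (rho^-1 * freq N) ^+ 2 / (freq N ^+ 2 + (rho^-1 * freq N) ^+ 2).
  by field; rewrite ?gt_eqF// ?addr_gt0 ?exprn_gt0 ?mulr_gt0 ?ltr_pwDl ?sqr_ge0.
rewrite ler_wpM2l ?sqr_ge0// lef_pV2 ?posrE ?lerD2r//.
by rewrite addr_gt0 ?exprn_gt0// mulr_gt0// invr_gt0.
Qed.

Lemma weight_tail N n : 0 < freq N -> (N <= n)%N -> 2 * weight la (rho * freq N) n <= ta.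
Proof.
move=> k0 nN; have lan : freq N ^+ 2 <= la n by rewrite freq_sqr; exact: la_sorted.
have rk : 0 < (rho * freq N) ^+ 2 by rewrite exprn_gt0// mulr_gt0.
have -> : ta = 2 * ((rho * freq N) ^+ 2 / (freq N ^+ 2 + (rho * freq N) ^+ 2)).
  by rewrite /ta; field; rewrite ?gt_eqF// ?addr_gt0 ?exprn_gt0 ?mulr_gt0.
rewrite ler_wpM2l// /weight ler_wpM2l ?sqr_ge0//.
rewrite lef_pV2 ?posrE ?lerD2r//; first by rewrite ltr_wpDl.
by rewrite ltr_wpDl// sqr_ge0.
Qed.

Lemma window_bounds a A g (d : R) : admissible la a A -> averages_to la (step j) g -> 0 < d ->
  \forall N \near \oo,
    A * (rho * (g - 4 * ta ^+ (j - 2))) - d <= (freq N)^-1 * \sum_(n < N) a n /\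
    (freq N)^-1 * \sum_(n < N) a n <= A * (g * (rho^-1 * (1 - sg ^- j)^-1)) + d.
Proof.
move=> aA lg d0; have [a0 _ _ _] := aA.
have [[K K0 cK] v] := lg _ _ aA; have [[K' K'0 cK'] v'] := averages_sqr aA.
pose X h k : R := k^-1 * limn (wsum la a h k).
have fge (C : R) : \forall N \near \oo, C <= freq N by have /cvgryPge := freq_cvgy; exact.
have cu : X (step j) (rho^-1 * freq N) * (rho^-1 * (1 - sg ^- j)^-1) @[N --> \oo] -->
    A * g * (rho^-1 * (1 - sg ^- j)^-1).
  apply: cvgMr_tmp; apply: (@cvg_freq (fun k => X (step j) (rho^-1 * k))).
  by apply: cvg_scale v; rewrite invr_gt0.
have cl : rho * (X (step j) (rho * freq N) - 4 * ta ^+ (j - 2) * X (fun u => u ^+ 2) (rho * freq N))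
     @[N --> \oo] --> rho * (A * g - 4 * ta ^+ (j - 2) * (A * 1)).
  apply: cvgMl_tmp; apply: cvgB.
    by apply: (@cvg_freq (fun k => X (step j) (rho * k))); exact: cvg_scale v.
  apply: cvgMl_tmp; apply: (@cvg_freq (fun k => X (fun u => u ^+ 2) (rho * k))).
  exact: cvg_scale v'.
have /cvgrPdist_le/(_ _ d0) n1 := cu.
have /cvgrPdist_le/(_ _ d0) n2 := cl.
near=> N.
have h1 : `|A * g * (rho^-1 * (1 - sg ^- j)^-1) -
    X (step j) (rho^-1 * freq N) * (rho^-1 * (1 - sg ^- j)^-1)| <= d by near: N.
have h2 : `|rho * (A * g - 4 * ta ^+ (j - 2) * (A * 1)) -
    rho * (X (step j) (rho * freq N) - 4 * ta ^+ (j - 2) * X (fun u => u ^+ 2) (rho * freq N))| <= d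
  by near: N.
have f1 : 1 <= freq N by near: N; exact: fge.
have fK : rho * K <= freq N by near: N; exact: fge.
have fK2 : rho^-1 * K <= freq N by near: N; exact: fge.
have fK3 : rho^-1 * K' <= freq N by near: N; exact: fge.
have f0 : 0 < freq N by exact: lt_le_trans f1.
have k1 : K <= rho^-1 * freq N by rewrite ler_pdivlMl.
have k2 : K <= rho * freq N by rewrite -ler_pdivrMl.
have k3 : K' <= rho * freq N by rewrite -ler_pdivrMl.
have s0 u : 0 <= u <= 1 -> 0 <= step j u by move=> /(step_itv j)/andP[].
have s1 u : 0 <= u <= 1 -> step j u <= 1 by move=> /(step_itv j)/andP[].
have rf0 : 0 < rho * freq N by rewrite mulr_gt0.
have rf0' : 0 < rho^-1 * freq N by rewrite mulr_gt0// invr_gt0.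
have up : (1 - sg ^- j) * \sum_(n < N) a n <= limn (wsum la a (step j) (rho^-1 * freq N)).
  apply: head_upper => //; last exact: cK.
  move=> n nN; have sw := weight_head f0 nN.
  have w0 := weight_gt0 la0 n rf0'; have wi := weight_itv la0 n rf0'.
  apply: le_trans (step_ge (ltnW j1) wi w0); rewrite lerD2l lerN2.
  have sgp : 0 < sg by exact: lt_trans sg1.
  have w20 : 0 < 2 * weight la (rho^-1 * freq N) n by rewrite mulr_gt0.
  rewrite lef_pV2 ?posrE ?exprn_gt0//.
  have w2 : 0 <= 2 * weight la (rho^-1 * freq N) n by rewrite mulr_ge0// ltW.
  by rewrite lerXn2r ?nnegrE ?(ltW sgp).
have lo : limn (wsum la a (step j) (rho * freq N)) -
    4 * ta ^+ (j - 2) * limn (wsum la a (fun u => u ^+ 2) (rho * freq N)) <= \sum_(n < N) a n.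
  apply: tail_lower => //; [|  | exact: cK | exact: cK'].
    by rewrite mulr_ge0// exprn_ge0.
  move=> n nN; apply: step_le_tail => //; first exact: weight_itv.
  exact: weight_tail.
move: h1 h2 up lo; rewrite /X.
set S : R := \sum_(n < N) a n.
set L1 : R := limn (wsum la a (step j) (rho^-1 * freq N)).
set L2 : R := limn (wsum la a (step j) (rho * freq N)).
set L3 : R := limn (wsum la a (fun u => u ^+ 2) (rho * freq N)).
set T := 4 * ta ^+ (j - 2).
move=> h1 h2 up lo.
have Q0 : 0 < 1 - sg ^- j by exact: sgj.
move: up h1; set Q := 1 - sg ^- j in Q0 * => up h1.
have up' : (freq N)^-1 * S <= (rho^-1 * freq N)^-1 * L1 * (rho^-1 * Q^-1).
  have -> : (rho^-1 * freq N)^-1 * L1 * (rho^-1 * Q^-1) = (freq N)^-1 * (L1 / Q).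
    by field; rewrite !gt_eqF.
  by rewrite ler_wpM2l ?invr_ge0 ?(ltW f0)// ler_pdivlMr// mulrC.
have lo' : rho * ((rho * freq N)^-1 * L2 - T * ((rho * freq N)^-1 * L3)) <= (freq N)^-1 * S.
  have -> : rho * ((rho * freq N)^-1 * L2 - T * ((rho * freq N)^-1 * L3)) =
      (freq N)^-1 * (L2 - T * L3) by field; rewrite !gt_eqF.
  by rewrite ler_wpM2l// invr_ge0 ltW.
move: h1 h2; rewrite !ler_norml => /andP[? ?] /andP[? ?]; split.
  have -> : A * (rho * (g - T)) = rho * (A * g - T * (A * 1)) by ring.
  by lra.
by rewrite mulrA; lra.
Unshelve. all: by end_near. Qed.

End Window.

(** The weight at scale freq N / 2 is at most half of that at scale freq N for
    indices beyond N, so the difference of the second moments, with factors 1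
    and 1/4, is carried by the first N indices.  Divided by freq N it tends to
    B / 2 - B / 4. *)
Lemma freq_lower : \forall N \near \oo, B / 8 <= (freq N)^-1 * N%:R.
Proof.
have [[K K0 cK] v] := averages_sqr adm1.
pose X k : R := k^-1 * limn (wsum la (fun=> 1) (fun u => u ^+ 2) k).
have fge (C : R) : \forall N \near \oo, C <= freq N by have /cvgryPge := freq_cvgy; exact.
have cl : 2^-1 * X (2^-1 * freq N) - 4^-1 * X (freq N) @[N --> \oo] -->
    2^-1 * (B * 1) - 4^-1 * (B * 1).
  apply: cvgB; apply: cvgMl_tmp.
    apply: (@cvg_freq (fun k => X (2^-1 * k))).
    by apply: cvg_scale v; rewrite invr_gt0.
  exact: (@cvg_freq X).
have B80 : 0 < B / 8 by rewrite divr_gt0.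
have /cvgrPdist_le/(_ _ B80) n1 := cl.
near=> N.
have h1 : `|2^-1 * (B * 1) - 4^-1 * (B * 1) - (2^-1 * X (2^-1 * freq N) - 4^-1 * X (freq N))| <= B / 8.
  by near: N.
have f1 : 1 <= freq N by near: N; exact: fge.
have fK : 2 * K <= freq N by near: N; exact: fge.
have f0 : 0 < freq N by exact: lt_le_trans f1.
have k1 : K <= 2^-1 * freq N by rewrite ler_pdivlMl.
have k2 : K <= freq N by lra.
have lo : limn (wsum la (fun=> 1) (fun u => u ^+ 2) (2^-1 * freq N)) -
    4^-1 * limn (wsum la (fun=> 1) (fun u => u ^+ 2) (freq N)) <= \sum_(n < N) 1.
  have f20 : 0 < 2^-1 * freq N by rewrite mulr_gt0.
  apply: tail_lower => //; [| |exact: cK|exact: cK].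
  - by move=> u /andP[u0 u1]; rewrite exprn_ile1.
  move=> n nN; have lan : freq N ^+ 2 <= la n by rewrite freq_sqr; exact: la_sorted.
  have f2 : 0 < freq N ^+ 2 by rewrite exprn_gt0.
  have -> : 4^-1 * weight la (freq N) n ^+ 2 = (2^-1 * weight la (freq N) n) ^+ 2 by field.
  have w0 := weight_gt0 la0 n f20; have w1 := weight_gt0 la0 n f0.
  have w2 : 0 <= 2^-1 * weight la (freq N) n by rewrite mulr_ge0// ltW.
  rewrite lerXn2r ?nnegrE ?(ltW w0)//.
  rewrite /weight mulrA ler_pdivrMr; last by rewrite ltr_wpDl// exprn_gt0.
  rewrite mulrAC ler_pdivlMr; last by rewrite ltr_wpDl.
  by move: lan f2; set F := freq N; set l := la n => ? ?; rewrite exprMn; nra.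
move: h1 lo; rewrite /X sumr_const card_ord.
set L1 : R := limn (wsum la (fun=> 1) (fun u => u ^+ 2) (2^-1 * freq N)).
set L2 : R := limn (wsum la (fun=> 1) (fun u => u ^+ 2) (freq N)).
move=> h1 lo.
have := ler_wpM2l (ltW (_ : 0 < (freq N)^-1)) lo; rewrite invr_gt0 => /(_ f0).
have -> : (freq N)^-1 * (L1 - 4^-1 * L2) =
    2^-1 * ((2^-1 * freq N)^-1 * L1) - 4^-1 * ((freq N)^-1 * L2).
  by field; rewrite gt_eqF.
by move: h1; rewrite ler_norml => /andP[? ?]; lra.
Unshelve. all: by end_near. Qed.

(** First rho is taken close to 1, then the degree j is taken large.  The bounds
    Lo and Up do not depend on the sequence. *)
Lemma sandwich (eta : R) : 0 < eta -> exists Lo Up : R, Up - Lo <= eta /\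
  forall a A (d : R), admissible la a A -> 0 < d -> \forall N \near \oo,
    A * Lo - d <= (freq N)^-1 * \sum_(n < N) a n /\
    (freq N)^-1 * \sum_(n < N) a n <= A * Up + d.
Proof.
move=> eta0; have eta20 : 0 < eta / 2 by rewrite divr_gt0.
have [rho [rho0 rho1 hrho]] : exists rho : R, [/\ 0 < rho, rho < 1 & 4 * (rho^-1 - rho) <= eta / 2].
  have c1 : 4 * (r^-1 - r) @[r --> (1 : R)] --> (4 * (1^-1 - 1) : R).
    apply: cvgMl_tmp; apply: cvgB; last exact: cvg_id.
    by apply: cvgV; [exact: oner_neq0 | exact: cvg_id].
  have /cvgrPdist_le/(_ _ eta20) n1 := c1.
  have : \forall r \near (1 : R)^'-, [/\ 0 < r, r < 1 & 4 * (r^-1 - r) <= eta / 2].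
    near=> r.
    have h1 : `|4 * (1^-1 - 1) - 4 * (r^-1 - r)| <= eta / 2.
      by near: r; apply: cvg_within; exact: n1.
    split; [by near: r; exact: nbhs_left_gt | by near: r; exact: nbhs_left_lt |].
    by move: h1; rewrite invr1 subrr mulr0 sub0r normrN ler_norml => /andP[].
  by move=> /filter_ex[r hr]; exists r.
pose sg := 2 / (1 + rho ^+ 2); pose ta := 2 * rho ^+ 2 / (1 + rho ^+ 2).
have r20 : 0 < rho ^+ 2 by rewrite exprn_gt0.
have r21 : rho ^+ 2 < 1 by rewrite exprn_ilt1// ltW.
have den0 : 0 < 1 + rho ^+ 2 by rewrite addr_gt0.
have sg1 : 1 < sg by rewrite /sg ltr_pdivlMr// mul1r; lra.
have sg0 : 0 < sg by exact: lt_trans sg1.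
have ta0 : 0 <= ta by rewrite divr_ge0 ?mulr_ge0// ltW.
have ta1 : ta < 1 by rewrite /ta ltr_pdivrMr// mul1r; lra.
have [i hi] : exists i : nat, 4 * (rho^-1 * ((1 - sg^-1 ^+ i.+2)^-1 - 1)) + 4 * ta ^+ i <= eta / 2.
  have c1 : 4 * (rho^-1 * ((1 - sg^-1 ^+ i.+2)^-1 - 1)) + 4 * ta ^+ i @[i --> \oo] -->
      (4 * (rho^-1 * ((1 - 0)^-1 - 1)) + 4 * 0 : R).
    apply: cvgD; apply: cvgMl_tmp; last by apply: cvg_expr; rewrite ger0_norm.
    apply: cvgMl_tmp; apply: cvgB; last exact: cvg_cst.
    apply: cvgV; first by rewrite subr0 oner_neq0.
    apply: cvgB; first exact: cvg_cst.
    have sgi : (fun i : nat => sg^-1 ^+ i) @ \oo --> (0 : R).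
      by apply: cvg_expr; rewrite ger0_norm ?invf_lt1// invr_ge0 ltW.
    by have := sgi; rewrite -(cvg_shiftn 2); under eq_fun do rewrite addn2.
  have /cvgrPdist_le/(_ _ eta20) n1 := c1.
  have [i hi] := filter_ex n1; exists i.
  move: hi; rewrite subr0 invr1 subrr !mulr0 addr0 sub0r normrN ler_norml.
  by move=> /andP[].
have [g [g0 g4 lg]] := averages_step (isT : (1 < i.+2)%N).
exists (rho * (g - 4 * ta ^+ (i.+2 - 2))), (g * (rho^-1 * (1 - sg ^- i.+2)^-1)).
split; last first.
  by move=> a A d aA d0; exact: (window_bounds rho0 rho1 _ aA lg d0).
rewrite subn2 /= -exprVn.
set P := (1 - sg^-1 ^+ i.+2)^-1 in hi *.
have P1 : 1 <= P.
  have si : 0 < sg^-1 ^+ i.+2 < 1.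
    by rewrite exprn_gt0 ?invr_gt0//= exprn_ilt1// ?invr_ge0 ?(ltW sg0)// invf_lt1.
  have /andP[si0 si1] := si.
  by rewrite /P invf_ge1 ?subr_gt0// gerBl ltW.
have t0 : 0 <= ta ^+ i by exact: exprn_ge0.
have h1 : rho <= rho^-1 * P.
  apply: (@le_trans _ _ 1); first exact: ltW.
  rewrite -[leLHS]mulr1 ler_pM// invf_ge1// ltW//.
have h2 : g * (rho^-1 * P - rho) <= 4 * (rho^-1 * P - rho) by rewrite ler_wpM2r// subr_ge0.
have h3 : rho * (4 * ta ^+ i) <= 4 * ta ^+ i by rewrite ler_piMl ?mulr_ge0// ltW.
by lra.
Unshelve. all: by end_near. Qed.

(** The partial sums of a and of 1 over n < N are A * freq N and B * freq N
    times numbers in one and the same short interval ([sandwich]); dividing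
    removes the unknown factor, and [freq_lower] keeps the denominator away from
    zero. *)
Theorem karamata a A : admissible la a A ->
  N%:R^-1 * \sum_(n < N) a n @[N --> \oo] --> A / B.
Proof.
move=> aA; have [_ A0 _ _] := aA.
apply/cvgrPdist_le => e e0.
pose eta := e * B ^+ 2 / (16 * (A * B + 1)); pose d := e * B ^+ 2 / (16 * (A + B)).
have AB0 : 0 <= A * B by rewrite mulr_ge0// ltW.
have AB1 : 0 < A * B + 1 by rewrite ltr_wpDl.
have ApB : 0 < A + B by rewrite ltr_wpDl.
have eB : 0 < e * B ^+ 2 by rewrite mulr_gt0// exprn_gt0.
have eta0 : 0 < eta by rewrite divr_gt0// mulr_gt0.
have d0 : 0 < d by rewrite divr_gt0// mulr_gt0.
have [Lo [Up [UL H]]] := sandwich eta0.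
have na := H _ _ _ aA d0; have n1 := H _ _ _ adm1 d0.
near=> N.
have [la1 ua1] : A * Lo - d <= (freq N)^-1 * \sum_(n < N) a n /\
    (freq N)^-1 * \sum_(n < N) a n <= A * Up + d by near: N.
have [l1 u1] : B * Lo - d <= (freq N)^-1 * \sum_(n < N) 1 /\
    (freq N)^-1 * \sum_(n < N) 1 <= B * Up + d by near: N.
have lz : B / 8 <= (freq N)^-1 * N%:R by near: N; exact: freq_lower.
have f1 : 1 <= freq N by near: N; have /cvgryPge := freq_cvgy; exact.
have f0 : 0 < freq N by exact: lt_le_trans f1.
have N0 : 0 < N%:R :> R by rewrite ltr0n; near: N; exact: nbhs_infty_gt.
move: la1 ua1 l1 u1 lz; rewrite sumr_const card_ord.
set S : R := \sum_(n < N) a n.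
have -> : N%:R^-1 * S = ((freq N)^-1 * S) / ((freq N)^-1 * N%:R) by field; rewrite !gt_eqF.
set Y := (freq N)^-1 * S; set Z := (freq N)^-1 * N%:R => la1 ua1 l1 u1 lz.
have Z0 : 0 < Z by rewrite mulr_gt0// invr_gt0.
have -> : A / B - Y / Z = (A * Z - B * Y) / (B * Z) by field; rewrite !gt_eqF.
have BZ : 0 < B * Z by rewrite mulr_gt0.
rewrite normrM normfV (gtr0_norm BZ) ler_pdivrMr//.
have key : `|A * Z - B * Y| <= A * B * eta + (A + B) * d.
  have m1 := ler_wpM2l A0 l1; have m2 := ler_wpM2l A0 u1.
  have m3 := ler_wpM2l (ltW B0) la1; have m4 := ler_wpM2l (ltW B0) ua1.
  have m5 := ler_wpM2l AB0 UL.
  rewrite ler_norml; apply/andP; split; lra.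
apply: (le_trans key).
have k1 : A * B * eta <= e * B ^+ 2 / 16.
  have -> : e * B ^+ 2 / 16 = (A * B + 1) * eta by rewrite /eta; field; rewrite gt_eqF.
  by rewrite ler_wpM2r ?(ltW eta0)// lerDl.
have k2 : (A + B) * d = e * B ^+ 2 / 16 by rewrite /d; field; rewrite gt_eqF.
have k3 : e * B ^+ 2 / 8 <= e * (B * Z).
  by have := ler_wpM2l (mulr_ge0 (ltW e0) (ltW B0)) lz; rewrite expr2; lra.
by rewrite k2; lra.
Unshelve. all: by end_near. Qed.

End TauberianTheorem.

(** * Eigenbases and the local Weyl law *)

Section Eigenbasis.
Variables (R : realType) (G : metric_graph R).
Implicit Types (q : edge G -> R -> R).
Local Open Scope complex_scope.

Lemma potential_le (l M M' : R) (p : R -> R) : M <= M' -> potential l M p -> potential l M' p.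
Proof.
by move=> MM' [bp cp pM]; split => // x xl; apply: le_trans MM'; exact: pM.
Qed.

Lemma graph_potential q : (forall e, smooth_bounded (elen e) (q e)) ->
  exists M : R, forall e, potential (elen e) M (q e).
Proof.
move=> hq; have /choice[M hM] := fun e => smooth_bounded_potential (hq e).
exists (\sum_(e : edge G) `|M e|) => e; apply: potential_le (hM e).
rewrite (bigD1 e)//= (le_trans (ler_norm _))// lerDl.
exact: sumr_ge0.
Qed.

Lemma eigenfunction_solves q (M : R) beta (lam : R) (f : gfun G) :
  (forall e, potential (elen e) M (q e)) -> eigenfunction q beta lam f ->
  exists f1 : gfun G, delta_prime_conditions beta f f1 /\
    forall e, solves (elen e) (q e) lam (gre f e) (gre f1 e) /\
              solves (elen e) (q e) lam (gim f e) (gim f1 e).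
Proof.
move=> pq [_ [f1 [f2 [hs hd hae]]]]; exists f1; split => // e.
exact: (sobolev_solves (pq e) (hs e) (hae e)).
Qed.

(** Without edges no function has norm 1. *)
Lemma total_length_gt0 (f : nat -> gfun G) : orthonormal_basis f -> 0 < total_length G.
Proof.
move=> [_ on _]; case: (pickP (fun _ : edge G => true)) => [e _|noedge].
  rewrite /total_length (bigD1 e)//= ltr_wpDr ?elen_gt0//.
  by apply: sumr_ge0 => e' _; rewrite ltW// elen_gt0.
have := on 0%N 0%N; rewrite /inner big_pred0// => /eqP.
by rewrite eq_sym eqxx oner_eq0.
Qed.

End Eigenbasis.

Section Admissibility.
Variables (R : realType) (G : metric_graph R).
Variables (f f1 : nat -> gfun G) (la : nat -> R) (q : edge G -> R -> R) (M : R).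
Hypothesis hf : orthonormal_basis f.
Hypothesis la0 : forall n, 0 <= la n.
Hypothesis pq : forall e, potential (elen e) M (q e).
Hypothesis sr : forall n e, solves (elen e) (q e) (la n) (gre (f n) e) (gre (f1 n) e).
Hypothesis si : forall n e, solves (elen e) (q e) (la n) (gim (f n) e) (gim (f1 n) e).

Lemma admissible_trace : admissible la (fun=> 1) (total_length G / 4).
Proof.
split => //.
- by rewrite divr_ge0// ltW// (total_length_gt0 hf).
- exists 1 => // k k1; exact: (trace_cvg hf la0 pq sr si).
- exact: (trace_law hf la0 pq sr si).
Qed.

Lemma admissible_interior e (x : R) : 0 < x -> x < elen e ->
  admissible la (fun n => Normc.normc (f n e x) ^+ 2) (1 / 4).
Proof.
move=> x0 xl; pose d := Num.min x (elen e - x).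
have d0 : 0 < d by rewrite lt_min x0 subr_gt0.
have dx : d <= x by rewrite ge_min lexx.
have dl : d <= elen e - x by rewrite ge_min lexx orbT.
have -> : (fun n => Normc.normc (f n e x) ^+ 2) = fun n => dens f n e x.
  by apply/funext => n; rewrite normc_sqr.
have law (k : R) : 1 <= k ->
  [/\ cvgn (rsum (fun n => dens f n e x) la (k ^+ 2)),
      k ^+ 3 * limn (rsum (fun n => dens f n e x) la (k ^+ 2)) <= 1 / 4 + law_const M d / k &
      1 / 4 - law_const M d / k <= k ^+ 3 * limn (rsum (fun n => dens f n e x) la (k ^+ 2))].
  by move=> k1; apply: (interior_law hf la0 pq sr si) => //; lra.
split.
- by move=> n; exact: dens_ge0.
- by [].
- by exists 1 => // k /law[].
- apply: (@cvg_rate _ _ _ (law_const M d) 1) => k k1 _; have [_ up lo] := law k k1.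
  by rewrite ler_norml; apply/andP; split; lra.
Qed.

Lemma admissible_vertex (beta : vertex G -> R) v : beta v != 0 ->
  (forall n, delta_prime_conditions beta (f n) (f1 n)) ->
  admissible la (fun n => Normc.normc (vertex_sum (f n) v) ^+ 2) ((deg v)%:R / 2).
Proof.
move=> bv hv; have [K K1 [cv lim]] := vertex_law hf la0 pq sr si bv hv.
split => //.
- by move=> n; exact: sqr_ge0.
- by exists K => //; exact: lt_le_trans K1.
Qed.

End Admissibility.

Unset Implicit Arguments.

(* Sequences are indexed from 0: (lambda n, f n) is the (n+1)-th eigenpair. *)
Theorem proposition8 (R : realType) (G : metric_graph R)
    (Gconn : graph_connected G)
    (q : edge G -> R -> R)
    (hq : forall e : edge G, smooth_bounded (elen e) (q e))
    (v : vertex G) (beta : vertex G -> R) (hbeta : beta v != 0)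
    (lambda : nat -> R) (f : nat -> gfun G)
    (hbasis : orthonormal_basis f)
    (heigen : forall n : nat, eigenfunction q beta (lambda n) (f n))
    (hsorted : forall m n : nat, (m <= n)%N -> lambda m <= lambda n) :
  (N%:R^-1 * \sum_(n < N) Normc.normc (vertex_sum (f n) v) ^+ 2
     @[N --> \oo] --> 2 * (deg v)%:R / total_length G) /\
  (forall (e : edge G) (x : R), 0 < x -> x < elen e ->
     N%:R^-1 * \sum_(n < N) Normc.normc (f n e x) ^+ 2
       @[N --> \oo] --> (total_length G)^-1).
Proof.
have [M0 pq0] := graph_potential hq.
have /choice[f1 hf1] := fun n => eigenfunction_solves pq0 (heigen n).
pose c := lambda 0%N; pose la n := lambda n - c.
pose qc e x := q e x - c.
have pq e : potential (elen e) (M0 + `|c|) (qc e) by exact: potential_shift.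
have sr n e : solves (elen e) (qc e) (la n) (gre (f n) e) (gre (f1 n) e).
  by apply: solves_shift; exact: ((hf1 n).2 e).1.
have si n e : solves (elen e) (qc e) (la n) (gim (f n) e) (gim (f1 n) e).
  by apply: solves_shift; exact: ((hf1 n).2 e).2.
have la0 n : 0 <= la n by rewrite subr_ge0 hsorted.
have las m n : (m <= n)%N -> la m <= la n by move=> mn; rewrite lerD2r hsorted.
have L0 := total_length_gt0 hbasis.
have B0 : 0 < total_length G / 4 by rewrite divr_gt0.
have adm1 := admissible_trace hbasis la0 pq sr si.
split.
  have av := admissible_vertex hbasis la0 pq sr si hbeta (fun n => (hf1 n).1).
  have -> : 2 * (deg v)%:R / total_length G = (deg v)%:R / 2 / (total_length G / 4).
    by field; rewrite gt_eqF.
  exact: (karamata la0 las B0 adm1 av).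
move=> e x x0 xl; have ai := admissible_interior hbasis la0 pq sr si x0 xl.
have -> : (total_length G)^-1 = 1 / 4 / (total_length G / 4).
  by field; rewrite gt_eqF.
exact: (karamata la0 las B0 adm1 ai).
Qed.
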